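(* Let $\mathfrak g$ be a simple complex Lie algebra of rank $r$, let choices (C1) (a linear ordering $\beta_1<\dots<\beta_m$ of the positive roots) and (C2) (generators $F_{\beta_j}\in\mathfrak n_{\beta_j}$) be made, and let $T_p$ ($p\in\mathbb N^m$) be the corresponding coefficients in the PBW expansions $\Omega_k^{\mathfrak g}=\sum_p T_p\otimes F_{\beta_1}^{p_1}F_{\beta_2}^{p_2}\cdots F_{\beta_m}^{p_m}$ of the canonical elements associated with $\mathfrak g$. Then there exist unique elements $\eta_{\beta_j}\in\mathcal A(k^{(j)})$ ($j=1,\dots,m$) such that for all $p=(p_1,\dots,p_m)\in\mathbb N^m$ $$T_p=\frac{1}{\prod_{l}p_l!}\;\underbrace{\eta_{\beta_1}*\dots*\eta_{\beta_1}}_{p_1}*\underbrace{\eta_{\beta_2}*\dots*\eta_{\beta_2}}_{p_2}*\dots*\underbrace{\eta_{\beta_m}*\dots*\eta_{\beta_m}}_{p_m}.$$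
   Context: $\mathbb N=\{0,1,2,\dots\}$. For $r\ge 1$, $k\in\mathbb N^r$, put $|k|=\sum k_i$ and let $\mathcal T(k)$ be the set of symbols $t^{(i)}_j$ ($1\le i\le r$, $1\le j\le k_i$). The spaces $\mathcal A(k)$. An ordered $|k|$-tree on $\mathcal T(k)\cup\{z\}$ is a spanning tree on this vertex set (it has $|k|$ edges) with its edges numbered $1,\dots,|k|$. Let $\mathcal A_{|k|}^{|k|}$ be the complex vector space generated by these, modulo: (R1) $T_1=-T_2$ if $T_1,T_2$ have the same underlying graph and their edge orders differ by a transposition; (R2) for three distinct vertices $t,s,u$ and labels $a\neq b$, the sum of the three ordered trees which contain respectively [edge $tu$ labelled $a$, edge $ts$ labelled $b$], [edge $us$ labelled $a$, edge $tu$ labelled $b$], [edge $ts$ labelled $a$, edge $us$ labelled $b$], and are otherwise identical, is $0$. The group $G_k=\prod_i\Sigma_{k_i}$ acts by permuting the symbols $t^{(i)}_j$ with the same upper index; $\mathcal A(k)$ is the subspace of $x$ with $\pi x=\operatorname{sgn}(\pi)x$ for all $\pi\in G_k$. $\operatorname{ASym}_k(x)=\sum_{\pi\in G_k}\operatorname{sgn}(\pi)\pi(x)$. $\mathcal A(0)=\mathbb C T_0$, where $T_0$ is the single vertex $z$. Star-product. For an edge $e$, $h(e)$ is its end vertex farther from $z$. The sign $\varepsilon(T)$ of an ordered tree with edges $e_1,\dots,e_{|k|}$ (in order) is defined by $\bigwedge_{i=1}^{|k|}d\,h(e_i)=\varepsilon(T)\bigwedge_{i=1}^r\bigwedge_{j=1}^{k_i}d\,t^{(i)}_j$.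 For ordered trees $T_1$ on $\mathcal T(k)\cup\{z\}$ and $T_2$ on $\mathcal T(l)\cup\{z\}$, let $T$ be the ordered tree on $\mathcal T(k+l)\cup\{z\}$ obtained by renaming the vertices $t^{(i)}_j$ of $T_2$ to $t^{(i)}_{k_i+j}$, adding $|k|$ to the edge numbers of $T_2$, and identifying the two $z$ vertices. Then $T_1*T_2=\frac{\varepsilon(T_1)\varepsilon(T_2)\varepsilon(T)}{\prod_i k_i!\,l_i!}\operatorname{ASym}_{k+l}(T)$. This induces a product $\mathcal A(k)\otimes\mathcal A(l)\to\mathcal A(k+l)$, making $\bigoplus_k\mathcal A(k)$ an associative commutative algebra (with unit $T_0$, the empty product). Residues and duality. For an ordered tree $T$, $\operatorname{Res}^{(i)}_jT$ is $0$ if $t^{(i)}_j$ and $z$ are not joined by an edge; if they are joined by an edge numbered $a$, it is $(-1)^{a-1}$ times the tree obtained by contracting that edge (the merged vertex is called $z$) and decreasing by $1$ all edge numbers greater than $a$. Let $U_r$ be the free associative complex algebra on $\tilde f_1,\dots,\tilde f_r$, graded by $\mathbb N^r$, with degree $k$ part $U[k]$. A $k$-multiindex is a map $J:\{1,\dots,|k|\}\to\{1,\dots,r\}$ with $\#J^{-1}(i)=k_i$; put $\tilde f_J=\tilde f_{J(|k|)}\tilde f_{J(|k|-1)}\cdots\tilde f_{J(1)}$; $c:\{1,\dots,|k|\}\to\mathbb N$ is the map whose restriction to each $J^{-1}(i)$ is the increasing bijection onto $\{1,\dots,k_i\}$; $\operatorname{sgn}(J)=(-1)^m$ with $m$ the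 minimal number of transpositions of adjacent entries sorting $J(1),\dots,J(|k|)$ into non-decreasing order. For $T\in\mathcal A(k)$ define $\langle\tilde f_J,T\rangle$ by $\operatorname{sgn}(J)\operatorname{Res}^{(J(|k|))}_{c(|k|)}\cdots\operatorname{Res}^{(J(1))}_{c(1)}(T)=\langle\tilde f_J,T\rangle T_0$. It is known that this identifies $U[k]$ with the dual space $\mathcal A(k)^*$. The canonical element is $\Omega_k=\sum_J\tilde f_J^*\otimes\tilde f_J\in\mathcal A(k)\otimes U[k]$, where $\{\tilde f_J^*\}\subset\mathcal A(k)$ is the basis dual to $\{\tilde f_J\}$. Lie algebra. $\mathfrak g=\mathfrak n_-\oplus\mathfrak h\oplus\mathfrak n_+$ is a Cartan decomposition; $f_1,\dots,f_r$ are the standard Chevalley generators of $\mathfrak n_-$; $U(\mathfrak n_-)$ is $\mathbb N^r$-graded with degree $k$ part $U(\mathfrak n_-)[k]$; $q:U_r\to U(\mathfrak n_-)$, $\tilde f_i\mapsto f_i$. The canonical element associated with $\mathfrak g$ is $\Omega_k^{\mathfrak g}=(\mathrm{id}\otimes q)\Omega_k\in\mathcal A(k)\otimes U(\mathfrak n_-)[k]$. Write $\mathfrak n_-=\bigoplus_\beta\mathfrak n_\beta$ with one-dimensional weight spaces indexed by positive roots. $k^{(j)}\in\mathbb N^r$ is the degree of $F_{\beta_j}$, i.e. $k^{(j)}_i$ is the coefficient of the $i$-th simple root in $\beta_j$. By the PBW theorem the $F_{\beta_1}^{p_1}\cdots F_{\beta_m}^{p_m}$ form a basis of $U(\mathfrak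 n_-)$, so $\Omega_k^{\mathfrak g}=\sum_pT_p\otimes F_{\beta_1}^{p_1}\cdots F_{\beta_m}^{p_m}$ with unique $T_p\in\mathcal A(k)$, the sum being over $p\in\mathbb N^m$ with $\sum_jp_jk^{(j)}=k$. *)

(* Defs.v *)
From HB Require Import structures.
From mathcomp Require Import all_boot all_order all_algebra perm.
From mathcomp Require Import finmap monalg.
From mathcomp Require Import generic_quotient ring_quotient.
From mathcomp Require Import boolp reals complex.

Set Implicit Arguments.
Unset Strict Implicit.
Unset Printing Implicit Defensive.

Import GRing.Theory Quotient.
Local Open Scope fset_scope.
Local Open Scope ring_scope.
Local Open Scope quotient_scope.

Definition in_span (K : fieldType) (E : lmodType K) (G : E -> Prop) (x : E) :
    Prop :=
  exists s : seq (K * E)%type,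
    (forall c, c \in s -> G c.2) /\ x = \sum_(c <- s) c.1 *: c.2.

Section Presentation.
Variables (K : fieldType) (X : choiceType).
Local Notation FX := {malg K[X]}.

Definition linext (W : lmodType K) (phi : X -> W) (x : FX) : W :=
  \sum_(s <- msupp x) x@_s *: phi s.

Variable G : FX -> Prop.

Definition relators : {pred FX} := [pred x | `[< in_span G x >]].

Lemma relators_submod : submod_closed relators.
Proof.
split=> [|c x y /asboolP [s [sG ->]] /asboolP [t [tG ->]]].
  by apply/asboolP; exists [::]; rewrite big_nil.
apply/asboolP; exists ([seq (c * d.1, d.2) | d <- s] ++ t); split=> [d|].
  by rewrite mem_cat => /orP [/mapP [d' /sG ? ->]|/tG].
rewrite big_cat big_map scaler_sumr; congr (_ + _).
by apply: eq_bigr => d _; rewrite scalerA.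
Qed.

HB.instance Definition _ := GRing.isSubmodClosed.Build K FX relators
  relators_submod.

Definition pres : Type := {quot relators}.

HB.instance Definition _ := ZmodQuotient.on pres.

Definition pres_scale (c : K) (x : pres) : pres := \pi_pres (c *: repr x).

Lemma pi_scale c x : pres_scale c (\pi_pres x) = \pi_pres (c *: x).
Proof.
apply/eqP; rewrite /pres_scale /= piE equivE -scalerBr rpredZ // idealrBE.
by rewrite reprK.
Qed.

Let presA c d x : pres_scale c (pres_scale d x) = pres_scale (c * d) x.
Proof. by elim/quotW: x => x; rewrite (pi_scale d x) !pi_scale scalerA. Qed.

Let pres1 : left_id 1 pres_scale.
Proof. by elim/quotW=> x; rewrite pi_scale scale1r. Qed.

Let presDr : right_distributive pres_scale +%R.
Proof.
move=> c; elim/quotW=> x; elim/quotW=> y.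
by rewrite -raddfD !pi_scale -raddfD scalerDr.
Qed.

Let presDl x : {morph pres_scale^~ x : c d / c + d}.
Proof.
elim/quotW: x => x c d.
by rewrite !pi_scale -raddfD scalerDl.
Qed.

HB.instance Definition _ := GRing.Zmodule_isLmodule.Build K pres
  presA pres1 presDr presDl.

Definition pgen (s : X) : pres := \pi_pres << s >>.

(* The linear map out of the presented space sending the class of each basis
   element s to phi s; it is independent of the chosen representative as soon
   as the linear extension of phi kills G (see pliftE). *)
Definition plift (W : lmodType K) (phi : X -> W) (x : pres) : W :=
  linext phi (repr x).

End Presentation.

Section LinextTheory.
Variables (K : fieldType) (X : choiceType) (W : lmodType K) (phi : X -> W).

Lemma linextEw (d : {fset X}) (x : {malg K[X]}) : msupp x `<=` d ->
  linext phi x = \sum_(s <- d) x@_s *: phi s.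
Proof.
move=> le; rewrite /linext (big_fset_incl _ le) => //= s _ /mcoeff_outdom ->.
by rewrite scale0r.
Qed.

Lemma linextP c x y :
  linext phi (c *: x + y) = c *: linext phi x + linext phi y.
Proof.
pose d := msupp x `|` msupp y `|` msupp (c *: x + y).
have sx : msupp x `<=` d by rewrite /d -fsetUA fsubsetUl.
have sy : msupp y `<=` d by rewrite /d fsetUAC fsubsetUr.
have sz : msupp (c *: x + y) `<=` d by rewrite fsubsetUr.
rewrite (linextEw sx) (linextEw sy) (linextEw sz) scaler_sumr -big_split /=.
by apply: eq_bigr => s _; rewrite mcoeffD mcoeffZ scalerDl scalerA.
Qed.

Lemma pliftE (G : {malg K[X]} -> Prop) x :
  (forall y, G y -> linext phi y = 0) ->
  plift phi (\pi_(pres G) x) = linext phi x.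
Proof.
move=> G0; rewrite /plift; case: piP => y /eqP; rewrite -idealrBE => xy.
have [s [sG def]] : in_span G (x - y) by apply/asboolP.
have lin0 : linext phi 0 = 0 by rewrite /linext msupp0 big_seq_fset0.
suff sub0 : linext phi (x - y) = 0.
  by rewrite -[x in RHS](subrK y) -[x - y]scale1r linextP sub0 scaler0 add0r.
rewrite {}def big_seq; elim/big_rec: _ => // c z cs z0.
by rewrite linextP z0 (G0 _ (sG _ cs)) scaler0 addr0.
Qed.

End LinextTheory.

Section Tensor.
Variables (K : fieldType).

Inductive tens_rel (M N : lmodType K) : {malg K[(M * N)%type]} -> Prop :=
| TensDl m m' n : tens_rel (<< (m + m', n) >> - << (m, n) >> - << (m', n) >>)
| TensDr m n n' : tens_rel (<< (m, n + n') >> - << (m, n) >> - << (m, n') >>)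
| TensZl c m n : tens_rel (<< (c *: m, n) >> - c *: << (m, n) >>)
| TensZr c m n : tens_rel (<< (m, c *: n) >> - c *: << (m, n) >>).

Definition tensor (M N : lmodType K) : lmodType K := pres (@tens_rel M N).

Definition tens (M N : lmodType K) (m : M) (n : N) : tensor M N :=
  pgen (@tens_rel M N) (m, n).

Definition tensmap (M N N' : lmodType K) (phi : N -> N') :
    tensor M N -> tensor M N' :=
  plift (fun mn => tens mn.1 (phi mn.2)).

End Tensor.

(* Colours i, indices j of the symbols t^(i)_j, edge labels and positions in
   words are all numbered from 0 instead of 1. *)
Notation sym r := ('I_r * nat)%type.

(* The symbols and z, which is None. *)
Notation vert r := (option (sym r)).
Notation edge r := {fset vert r}.
Notation degree r := {ffun 'I_r -> nat}.

Section Trees.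
Variable r : nat.
Local Notation sym := (sym r).
Local Notation vert := (vert r).
Local Notation edge := (edge r).
Local Notation degree := (degree r).

Definition wt (k : degree) : nat := (\sum_i k i)%N.

(* The set T(k), listed in the order of the exterior product defining epsilon. *)
Definition syms (k : degree) : seq sym :=
  [seq (i, j) | i <- enum 'I_r, j <- iota 0 (k i)].

Definition symset (k : degree) : {fset sym} := [fset t in syms k].

Definition vset (S : {fset sym}) : edge := None |` [fset Some t | t in S].

(* The vertices at distance at most n from z in the graph with edges s. *)
Definition ball (s : seq edge) (n : nat) : edge :=
  iter n (fun B => B `|` \bigcup_(e <- s | e `&` B != fset0) e) [fset None].

(* The ordered trees on S u {z}: the a-th item of s is the edge labelled a.
   A connected graph is a tree iff it has one edge less than vertices. *)
Definition otree (S : {fset sym}) (s : seq edge) : bool :=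
  [&& size s == #|` S|,
      all (fun e => (#|` e| == 2) && (e `<=` vset S)) s
    & vset S `<=` ball s (size s)].

Definition dist (s : seq edge) (v : vert) : nat :=
  find (fun n => v \in ball s n) (iota 0 (size s).+1).

(* v is the end vertex of e farther from z in the tree s. *)
Definition is_head (s : seq edge) (e : edge) (v : vert) : bool :=
  (v \in e) && all (fun w => dist s w <= dist s v)%N e.

Definition relabel (phi : vert -> vert) (s : seq edge) : seq edge :=
  [seq phi @` e | e <- s].

(* T with the edges labelled a and b replaced by e and f. *)
Definition put2 (s : seq edge) (a b : nat) (e f : edge) : seq edge :=
  set_nth fset0 (set_nth fset0 s a e) b f.

(* The k such that s is a tree on T(k) u {z}, if there is one. *)
Definition tdeg (s : seq edge) : degree :=
  [ffun i => count (fun v => if v is Some (i', _) then i' == i else false)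
                   (\bigcup_(e <- s) e)].

Definition symgroup (k : degree) : finType := {dffun forall i, 'S_(k i)}.

Definition permv (k : degree) (pi : symgroup k) (v : vert) : vert :=
  if v is Some (i, j) then
    Some (i, if insub j is Some j' then val (pi i j') else j)
  else None.

Definition shiftv (k : degree) (v : vert) : vert :=
  if v is Some (i, j) then Some (i, k i + j)%N else None.

Definition mergev (t : sym) (v : vert) : vert :=
  if v == Some t then None else v.

Definition multiindex (k : degree) (J : seq 'I_r) : bool :=
  [forall i, count_mem i J == k i].

(* The number of inversions of J, which is the least number of adjacent
   transpositions sorting it. *)
Fixpoint inversions (J : seq 'I_r) : nat :=
  if J is i :: J' then (count (fun j : 'I_r => j < i) J' + inversions J')%N
  else 0%N.

End Trees.

Section TreeSpaces.
Variables (K : fieldType) (r : nat).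
Local Notation edge := (edge r).
Local Notation degree := (degree r).
Local Notation FT := {malg K[seq edge]}.

Inductive tree_rel : FT -> Prop :=
| TreeR1 S s1 e s2 f s3 :
    otree S (s1 ++ e :: s2 ++ f :: s3) ->
    tree_rel (<< s1 ++ e :: s2 ++ f :: s3 >> + << s1 ++ f :: s2 ++ e :: s3 >>)
| TreeR2 S s a b (t x u : vert r) :
    t != x -> t != u -> x != u ->
    (a < size s)%N -> (b < size s)%N -> a != b ->
    let T1 := put2 s a b [fset t; u] [fset t; x] in
    let T2 := put2 s a b [fset u; x] [fset t; u] in
    let T3 := put2 s a b [fset t; x] [fset u; x] in
    otree S T1 -> otree S T2 -> otree S T3 ->
    tree_rel (<< T1 >> + << T2 >> + << T3 >>).

(* The direct sum, over all finite sets S of symbols, of the spaces of ordered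
   trees on S u {z} modulo the two relations, which are both homogeneous in S.
   General S are needed since residues remove symbols.  The lists that are not
   ordered trees are subject to no relation and play no role. *)
Definition trees : lmodType K := pres tree_rel.

Definition tree (s : seq edge) : trees := pgen tree_rel s.

Definition T0 : trees := tree [::].

Definition perm_act (k : degree) (pi : symgroup k) : trees -> trees :=
  plift (fun s => tree (relabel (permv pi) s)).

Definition sgnG (k : degree) (pi : symgroup k) : K :=
  \prod_i (-1) ^+ (pi i : 'S_(k i)).

Definition ASym (k : degree) (x : trees) : trees :=
  \sum_(pi : symgroup k) sgnG pi *: perm_act pi x.

Definition calA (k : degree) (x : trees) : Prop :=
  in_span (fun y => exists2 s, otree (symset k) s & y = tree s) x /\
  forall pi : symgroup k, perm_act pi x = sgnG pi *: x.

(* The exterior product of the vectors d h(e_a) is the determinant of the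
   matrix of their coordinates in the basis (d t) times that of this basis. *)
Definition epsilon (k : degree) (s : seq edge) : K :=
  \det (\matrix_(a < size s, b < size s)
    (is_head s (nth fset0 s a) (nth None (map Some (syms k)) b))%:R).

Definition star_tree (s1 s2 : seq edge) : trees :=
  let k := tdeg s1 in let l := tdeg s2 in
  let s := s1 ++ relabel (shiftv k) s2 in
  if otree (symset k) s1 && otree (symset l) s2 then
    (epsilon k s1 * epsilon l s2 * epsilon (k + l) s
       / (\prod_i ((k i)`! * (l i)`!))%N%:R) *: ASym (k + l) (tree s)
  else 0.

(* Bilinear in x and y; the summands of [trees] indexed by an S which is not of the form
   T(k) are sent to 0. *)
Definition star (x y : trees) : trees :=
  plift (fun s1 => plift (star_tree s1) y) x.

Definition Res (t : sym r) : trees -> trees :=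
  plift (fun s => let e := [fset Some t; None] in let a := index e s in
    if e \in s then
      (-1) ^+ a *: tree (relabel (mergev t) (take a s ++ drop a.+1 s))
    else 0).

Definition resJ n (J : n.-tuple 'I_r) (x : trees) : trees :=
  foldl (fun y (a : 'I_n) =>
           Res (tnth J a, count_mem (tnth J a) (take a J)) y) x (enum 'I_n).

Definition pairing n (J : n.-tuple 'I_r) (x : trees) (c : K) : Prop :=
  (-1) ^+ inversions J *: resJ J x = c *: T0.

(* fs is the basis of A(k) dual to the f_J; its linear independence follows
   from the second clause. *)
Definition dual_basis (k : degree) (fs : (wt k).-tuple 'I_r -> trees) : Prop :=
  [/\ forall J : (wt k).-tuple 'I_r, multiindex k J -> calA k (fs J),
      forall J J' : (wt k).-tuple 'I_r,
        multiindex k J -> multiindex k J' ->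
        pairing J (fs J') (J == J')%:R
    & forall x, calA k x ->
        in_span (fun y =>
          exists2 J : (wt k).-tuple 'I_r, multiindex k J & y = fs J) x].

Definition freealg : lalgType K := {malg K[{fmonom 'I_r}]}.

Definition freegen (i : 'I_r) : freealg := << fmu i >>.

Definition freeword (J : seq 'I_r) : freealg := \prod_(i <- rev J) freegen i.

(* This is the morphism of algebras sending freegen i to f i. *)
Definition freeeval (U : algType K) (f : 'I_r -> U) : freealg -> U :=
  linext (fun w : {fmonom 'I_r} => \prod_(i <- w) f i).

Definition Omega (k : degree) (fs : (wt k).-tuple 'I_r -> trees) :
    tensor trees freealg :=
  \sum_(J : (wt k).-tuple 'I_r | multiindex k J) tens (fs J) (freeword J).

End TreeSpaces.

Section Lie.
Variables (K : fieldType) (g : vectType K) (br : g -> g -> g).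

Definition lie_bracket : Prop :=
  [/\ forall x, linear (br x), forall y, linear (br^~ y),
      forall x, br x x = 0
    & forall x y z, br x (br y z) + br y (br z x) + br z (br x y) = 0].

Definition simple_lie : Prop :=
  [/\ lie_bracket, exists x y, br x y != 0
    & forall I : {vspace g},
        (forall x y, y \in I -> br x y \in I) -> I = 0%VS \/ I = fullv].

Definition lie_subalgebra (n : {vspace g}) : Prop :=
  forall x y, x \in n -> y \in n -> br x y \in n.

Variable h : {vspace g}.

Definition cartan_subalgebra : Prop :=
  [/\ lie_subalgebra h,
      exists n, forall (xs : n.-tuple g) y,
        {subset xs <= h} -> y \in h -> foldr br y xs = 0
    & forall x, (forall y, y \in h -> br x y \in h) -> x \in h].

Definition weight : vectType K := 'Hom(subvs_of h, K^o).

Definition weight_vector (al : weight) (x : g) : Prop :=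
  forall y : subvs_of h, br (vsval y) x = (al y : K) *: x.

Definition lie_root (al : weight) : Prop :=
  al != 0 /\ exists2 x, x != 0 & weight_vector al x.

Definition weight_generator (al : weight) (x : g) : Prop :=
  [/\ weight_vector al x, x != 0
    & forall y, weight_vector al y -> exists c : K, y = c *: x].

Variables (r : nat) (simple : 'I_r -> weight).

Definition nat_comb (k : degree r) : weight := \sum_i simple i *+ k i.

Definition simple_roots : Prop :=
  [/\ basis_of fullv [tuple simple i | i < r], forall i, lie_root (simple i)
    & forall al, lie_root al -> exists k, al = nat_comb k \/ al = - nat_comb k].

Definition positive_root (al : weight) : Prop :=
  lie_root al /\ exists k, al = nat_comb k.

(* f completes to a system of generators (e, f, coroots) with
   [e_i, f_j] = delta_ij h_i, where the h_i are normalized by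
   alpha_i(h_i) = 2. *)
Definition chevalley_generators (f : 'I_r -> g) : Prop :=
  exists (e : 'I_r -> g) (hc : 'I_r -> subvs_of h), forall i,
    [/\ weight_vector (simple i) (e i), weight_vector (- simple i) (f i),
        (simple i (hc i) : K) = 2%:R
      & forall j, br (e i) (f j) = if i == j then vsval (hc i) else 0].

Definition weight_space_sum (P : weight -> Prop) (n : {vspace g}) : Prop :=
  forall x, x \in n <->
    in_span (fun y => exists2 al, P al & weight_vector al y) x.

Definition cartan_decomposition (nm np : {vspace g}) : Prop :=
  [/\ weight_space_sum (fun al => positive_root (- al)) nm,
      weight_space_sum positive_root np,
      lie_subalgebra nm, lie_subalgebra np
    & (nm + h + np)%VS = fullv /\ directv (nm + h + np)].

Variable n : {vspace g}.

Definition lie_morphism (A : algType K) (phi : {linear subvs_of n -> A}) :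
    Prop :=
  forall x y z, vsval z = br (vsval x) (vsval y) ->
    phi z = phi x * phi y - phi y * phi x.

Definition universal_enveloping (U : algType K)
    (iota : {linear subvs_of n -> U}) : Prop :=
  lie_morphism iota /\
  forall (A : algType K) (phi : {linear subvs_of n -> A}), lie_morphism phi ->
    exists2 psi : {lrmorphism U -> A}, (forall x, psi (iota x) = phi x)
      & forall psi' : {lrmorphism U -> A},
          (forall x, psi' (iota x) = phi x) -> psi' =1 psi.

End Lie.

Section PBW.
Variables (K : fieldType) (r m : nat) (kd : 'I_m -> degree r).

Definition pdeg (p : {ffun 'I_m -> nat}) : degree r := \sum_j kd j *+ p j.

Definition pbw_monomial (U : algType K) (F : 'I_m -> U)
    (p : {ffun 'I_m -> nat}) : U := \prod_j F j ^+ p j.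

(* The sum is over all p with pdeg p = k: such a p satisfies p j <= |k| for
   all j since the kd j, being degrees of roots, are nonzero. *)
Definition pbw_expansion (U : algType K) (F : 'I_m -> U)
    (T : {ffun 'I_m -> nat} -> trees K r) (k : degree r) :
    tensor (trees K r) U :=
  \sum_(p : {ffun 'I_m -> 'I_(wt k).+1}
        | pdeg [ffun j => val (p j)] == k)
     tens (T [ffun j => val (p j)]) (pbw_monomial F [ffun j => val (p j)]).

Definition star_monomial (eta : 'I_m -> trees K r) (p : {ffun 'I_m -> nat}) :
    trees K r :=
  \big[@star K r/T0 K r]_(j < m) iter (p j) (star (eta j)) (T0 K r).

End PBW.

(* Main.v *)
Require Import Defs.
From HB Require Import structures.
From mathcomp Require Import all_boot all_order all_algebra perm.
From mathcomp Require Import finmap monalg.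
From mathcomp Require Import generic_quotient ring_quotient.
From mathcomp Require Import boolp reals complex mxtens zify ring.

Set Implicit Arguments.
Unset Strict Implicit.
Unset Printing Implicit Defensive.

Import GRing.Theory Num.Theory.
Local Open Scope fset_scope.
Local Open Scope ring_scope.

(** The space A(k) is dual to the part of degree k of the free algebra on
    f_1, ..., f_r, and under this duality the star product is the transpose of the
    coproduct for which the f_i are primitive: the pairing of a word J with x * y is
    the sum, over all splittings of J into two complementary subwords a and b, of
    the pairing of a with x times the pairing of b with y ([pair_word_star]). The
    coefficient T_p of the canonical element is, as a functional on words, the
    projection to U(n_-) followed by the coefficient of the ordered monomial F^p.
    As the F_j are primitive, the coproduct of F^p is the sum of the
    F^p' tensor F^p'' with p' + p'' = p, weighted by products of binomial
    coefficients. Dually, T_p' * T_p'' is a product of binomial coefficients times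
    T_(p' + p'') ([T_star]); in other words, p! T_p is multiplicative in p. Hence
    p! T_p is the star monomial of exponent p in the elements eta_j = T_(e_j), where
    e_j is the j-th unit vector. Conversely, the case p = e_j of the formula
    determines eta_j, because the one-vertex tree is a unit for the star product.

    For the duality, call a listing of the vertices of a tree a growth order if
    each vertex is joined to the root or to an earlier vertex. The iterated residue
    of a tree along a listing is the determinant of a matrix of zeros and ones
    ([res_seq_tree]); it is a sign if the listing is a growth order and zero
    otherwise, and this sign times that of the listing is epsilon of the tree
    ([resval_epsilon]). So the pairing of J with an antisymmetrized tree counts,
    up to epsilon, the growth orders with colours J ([pair_word_ASym]). A growth
    order of two trees glued at the root is a shuffle of growth orders of the two
    trees ([growths_star]), which gives the coproduct formula. The star product is
    well defined because its values are determined by their pairings with words,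
    by the existence of dual bases, and these respect the relations.

    Comparing coefficients in U(n_-) tensor U(n_-) requires that the ordered
    monomials be linearly independent. This is obtained from matrix coefficients of
    finite-dimensional representations, which are multiplied by means of tensor
    products of representations ([representative_mul]). The adjoint representation
    of a simple Lie algebra is faithful, and the F_j are linearly independent as
    weight vectors for distinct weights, so some matrix coefficients vanish at 1 and
    are dual to the F_j ([coordinate_functional]). In characteristic zero the
    products of these are, up to factorials, dual to the ordered monomials modulo
    longer ones ([dual_monomials]). *)

(** * Trees as connected lists of edges *)

Section Connectivity.
Variable r : nat.
Local Notation edge := (edge r).
Implicit Types (S : {fset sym r}) (s : seq edge) (B e : edge).

Definition edge_closed s B :=
  forall e, e \in s -> e `&` B != fset0 -> e `<=` B.

(** Every set of vertices that contains the root and is closed under the edges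
    is everything. Unlike the growth of balls, this form of connectedness is
    stable under contraction and gluing by direct arguments. *)
Definition connected S s :=
  forall B, None \in B -> edge_closed s B -> vset S `<=` B.

Definition pair_edges S s :=
  all (fun e => (#|` e| == 2) && (e `<=` vset S)) s.

Lemma in_vset S v : (v \in vset S) = if v is Some t then t \in S else true.
Proof.
rewrite !inE; case: v => [t|] //=.
by apply/imfsetP/idP => [[x xS [->]]|tS] //; exists t.
Qed.

Lemma card_vset S : #|` vset S| = #|` S|.+1.
Proof.
rewrite cardfsU1 card_imfset; last by move=> x y [].
case: imfsetP => [[x _ //]|_]; by rewrite add1n.
Qed.

Lemma meetP e B : reflect (exists2 v, v \in e & v \in B) (e `&` B != fset0).
Proof.
apply: (iffP (fset0Pn _)) => [[v /fsetIP[]]|[v ve vB]]; first by exists v.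
by exists v; rewrite inE ve.
Qed.

Lemma ballS s n v : v \in ball s n.+1 <->
  v \in ball s n \/ exists2 e, e \in s & v \in e /\ e `&` ball s n != fset0.
Proof.
rewrite /= in_fsetU; split=> [/orP[->|/bigfcupP[e /andP[es me] ve]]|].
- by left.
- by right; exists e.
case=> [->//|[e es [ve me]]]; apply/orP; right.
by apply/bigfcupP; exists e; rewrite ?es.
Qed.

Lemma ball_root s n : None \in ball s n.
Proof. by elim: n => [|n IH]; [rewrite inE | apply/ballS; left]. Qed.

Lemma ball_leq s m n : (m <= n)%N -> ball s m `<=` ball s n.
Proof.
move/subnK <-; elim: (n - m)%N => [|d IH] //.
by apply: fsubset_trans IH _; rewrite addSn; apply/fsubsetP=> v vb; apply/ballS; left.
Qed.

Lemma ball_closed s B n : None \in B -> edge_closed s B -> ball s n `<=` B.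
Proof.
move=> B0 cl; elim: n => [|n /fsubsetP IH]; first by rewrite fsub1set.
apply/fsubsetP => v /ballS [/IH//|[e es [ve /meetP[w we wb]]]].
by have /fsubsetP := cl e es (introT (meetP _ _) (ex_intro2 _ _ w we (IH _ wb))); apply.
Qed.

Lemma ball_sub_vset S s n : pair_edges S s -> ball s n `<=` vset S.
Proof.
move=> /allP pe; apply: ball_closed; first by rewrite in_vset.
by move=> e /pe /andP[].
Qed.

(** A ball that stops growing is closed under the edges, so balls gain at least
    one vertex per step until they contain every vertex. *)
Lemma connected_ball S s : pair_edges S s -> connected S s ->
  vset S `<=` ball s #|` S|.
Proof.
move=> pe cn.
have H n : vset S `<=` ball s n \/ (n < #|` ball s n|)%N.
  elim: n => [|n [sb|IH]]; first by right; rewrite cardfs1.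
    by left; apply: fsubset_trans sb (ball_leq _ _).
  have [E|ne] := eqVneq (ball s n) (ball s n.+1).
    left; rewrite -E; apply: cn; first exact: ball_root.
    move=> e es me; rewrite E; apply/fsubsetP => v ve; apply/ballS; right.
    by exists e.
  right; apply: leq_ltn_trans IH _; apply: fproper_ltn_card.
  by rewrite fproperEneq ne ball_leq.
case: (H #|` S|) => // lt.
have := ball_sub_vset #|` S| pe.
move=> sub; have/eqP <- // : ball s #|` S| == vset S.
by rewrite eqEfcard sub card_vset.
Qed.

Lemma otreeP S s :
  reflect [/\ size s = #|` S|, pair_edges S s & connected S s] (otree S s).
Proof.
apply: (iffP and3P) => [[/eqP sz pe sb]|[sz pe cn]]; split=> //.
- by move=> B B0 cl; apply: fsubset_trans sb (ball_closed _ B0 cl).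
- by rewrite sz.
by rewrite sz connected_ball.
Qed.

Lemma card_bigfcup_le (I : eqType) (l : seq I) (P : pred I) (F : I -> edge) :
  (forall i, i \in l -> P i -> #|` F i| <= 1)%N ->
  (#|` \bigcup_(i <- l | P i) F i| <= count P l)%N.
Proof.
elim: l => [|i l IH] H; first by rewrite big_nil cardfs0.
have {}IH := IH (fun j jl => H j (mem_behead (s := i :: l) jl)).
rewrite big_cons /=; case: ifP => Pi; last by rewrite add0n.
rewrite (leq_trans _ (leq_add (H i (mem_head _ _) Pi) IH)) // cardfsU.
exact: leq_subr.
Qed.

(** The left-hand side does not increase with [n], because each vertex that
    enters the ball uses up an edge that was not inside it. At the end it says
    that a connected graph has at least as many distinct edges as vertices other
    than the root; this is why the edges of a tree do not repeat. *)
Lemma card_ball_leq S s n : pair_edges S s ->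
  (#|` ball s n| + count (fun e => ~~ (e `<=` ball s n)) (undup s)
     <= (size (undup s)).+1)%N.
Proof.
move=> /allP pe; elim: n => [|n IH].
  by rewrite cardfs1 add1n ltnS count_size.
apply: leq_trans IH; set B := ball s n; set B' := ball s n.+1.
(* The edges along which the ball grows in this step. *)
pose N e := (e `&` B != fset0) && ~~ (e `<=` B).
have leB : (#|` B'| <= #|` B| + count N (undup s))%N.
  have sub : B' `<=` B `|` \bigcup_(e <- undup s | N e) (e `\` B).
    apply/fsubsetP => v /ballS; rewrite in_fsetU -/B.
    case: (boolP (v \in B)) => //= vB [//|[e es [ve me]]].
    apply/bigfcupP; exists e; last by rewrite inE vB.
    rewrite mem_undup es /N me; apply: contraNN vB => /fsubsetP; exact.
  apply: leq_trans (fsubset_leq_card sub) _.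
  rewrite cardfsU (leq_trans (leq_subr _ _)) // leq_add2l.
  apply: card_bigfcup_le => e; rewrite mem_undup => /pe /andP[/eqP e2 _].
  move=> /andP[me _]; rewrite cardfsD e2 leq_subLR addn1 ltnS.
  by rewrite cardfs_gt0.
have leC : (count N (undup s) + count (fun e => ~~ (e `<=` B')) (undup s) <=
            count (fun e => ~~ (e `<=` B)) (undup s))%N.
  rewrite -count_predUI; rewrite [X in (_ + X)%N](@eq_in_count _ _ pred0).
    rewrite count_pred0 addn0; apply: sub_count => e /=.
    move=> /orP[/andP[_ //]|]; apply: contraNN => sub.
    exact: fsubset_trans sub (ball_leq _ _).
  move=> e; rewrite mem_undup => es /=; apply/negP=> /andP[/andP[me _]].
  move=> /negP; apply; apply/fsubsetP => v ve; apply/ballS; right.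
  by exists e.
by apply: leq_trans (leq_add leB (leqnn _)) _; rewrite -addnA leq_add2l.
Qed.

Lemma otree_uniq S s : otree S s -> uniq s.
Proof.
move=> /and3P[/eqP sz pe sb]; rewrite -[uniq s]negbK -ltn_size_undup -leqNgt.
have := card_ball_leq (size s) pe; have := fsubset_leq_card sb.
rewrite card_vset -sz => le1 le2; rewrite -ltnS (leq_trans le1) //.
exact: leq_trans (leq_addr _ _) le2.
Qed.

Lemma otree_perm S s s' : perm_eq s s' -> otree S s -> otree S s'.
Proof.
move=> ps /otreeP[sz pe cn]; apply/otreeP; split.
- by rewrite -(perm_size ps).
- by apply/allP => e; rewrite -(perm_mem ps); apply: (allP pe).
by move=> B B0 cl; apply: cn => // e; rewrite (perm_mem ps); apply: cl.
Qed.

Lemma size_relabel (phi : vert r -> vert r) s : size (relabel phi s) = size s.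
Proof. exact: size_map. Qed.

Lemma relabelP phi s e' :
  reflect (exists2 e, e \in s & e' = phi @` e) (e' \in relabel phi s).
Proof. exact: mapP. Qed.

Lemma otree_relabel S S' s (phi : vert r -> vert r) :
  injective phi -> phi None = None -> vset S' = phi @` vset S ->
  otree S s -> otree S' (relabel phi s).
Proof.
move=> inj phi0 vS' /otreeP[sz /allP pe cn]; apply/otreeP; split.
- apply/eqP; rewrite size_relabel sz -eqSS -!card_vset vS' (card_imfset _ _ inj) //.
- apply/allP => e' /relabelP[e /pe /andP[e2 sub] ->].
  rewrite (card_imfset _ _ inj) e2 vS'; apply/fsubsetP => v /imfsetP[w we ->].
  by apply: in_imfset => /=; apply: (fsubsetP sub).
move=> B B0 cl; rewrite vS'; apply/fsubsetP => v /imfsetP[w /= wS ->].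
pose B' := [fset u in vset S | phi u \in B].
have inB' u : (u \in B') = (u \in vset S) && (phi u \in B) by rewrite inE.
have /fsubsetP sub : vset S `<=` B'.
  apply: cn; first by rewrite inB' in_vset phi0.
  move=> e es /meetP[u ue]; rewrite inB' => /andP[_ uB].
  have /fsubsetP sB : phi @` e `<=` B.
    apply: cl; first by apply/relabelP; exists e.
    by apply/meetP; exists (phi u) => //; apply: in_imfset.
  apply/fsubsetP => x xe; rewrite inB' sB ?andbT; last exact: in_imfset.
  by have /andP[_ /fsubsetP] := pe e es; apply.
by have := sub _ wS; rewrite inB' => /andP[].
Qed.

Lemma mergevE t v : mergev t v = if v == Some t then None else v :> vert r.
Proof. by []. Qed.

Lemma card2P e : #|` e| == 2 -> exists v w, v != w /\ e = [fset v; w].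
Proof.
move=> e2; have /fset0Pn[v ve] : e != fset0 by rewrite -cardfs_gt0 (eqP e2).
have : #|` e `\ v| == 1%N by move: e2; rewrite (cardfsD1 v e) ve.
move=> /cardfs1P[w E]; have : w \in e `\ v by rewrite E inE.
rewrite !inE => /andP[wv _]; exists v, w; split; first by rewrite eq_sym.
by rewrite -(fsetD1K ve) E.
Qed.

Lemma mergev_card S s t e : otree S s -> [fset Some t; None] \in s ->
  e \in s -> e != [fset Some t; None] -> #|` mergev t @` e| = 2.
Proof.
move=> ot ds es; have /otreeP[_ /allP pe _] := ot.
have /andP[e2 _] := pe e es.
have [v [w [vw ->]]] := card2P e2; rewrite imfset_fset2 cardfs2 => ed.
suff -> : mergev t v != mergev t w by [].
rewrite !mergevE; have [Ev|_] := eqVneq v (Some t); have [Ew|_] := eqVneq w (Some t) => //.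
- by rewrite Ev Ew eqxx in vw.
- by apply: contraNneq ed => <-; rewrite Ev.
- by apply: contraNneq ed => ->; rewrite Ew fsetUC.
Qed.

(** A set closed under the edges of the contracted tree becomes closed under the
    edges of the original tree once [t] is added. *)
Lemma otree_contract S s t : otree S s -> [fset Some t; None] \in s ->
  otree (S `\ t) (relabel (mergev t) (rem [fset Some t; None] s)).
Proof.
move=> ot ds; have us := otree_uniq ot; have /otreeP[sz /allP pe cn] := ot.
set d := [fset Some t; None] in ds *.
have tS : t \in S.
  have /andP[_ /fsubsetP/(_ (Some t))] := pe _ ds.
  by rewrite in_vset; apply; rewrite !inE eqxx.
apply/otreeP; split.
- by rewrite size_relabel size_rem // sz (cardfsD1 t S) tS.
- apply/allP => e' /relabelP[e]; rewrite mem_rem_uniq // inE => /andP[ed es] ->.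
  rewrite (mergev_card ot ds es ed) eqxx /=; apply/fsubsetP => v /imfsetP[w /= we ->].
  have /andP[_ /fsubsetP/(_ w we)] := pe _ es; rewrite !in_vset mergevE.
  by case: ifPn => // /eqP wt; case: w we wt => // u ue ut uS; rewrite !inE uS andbT; apply/eqP => E; apply: ut; rewrite E.
move=> B B0 cl; have /fsubsetP sub : vset S `<=` Some t |` B.
  apply: cn; first by rewrite !inE B0 orbT.
  move=> e es me; have [->|ed] := eqVneq e d.
    apply/fsubsetP => v; rewrite !inE => /orP[]/eqP->; rewrite ?B0 ?eqxx ?orbT //.
  have /fsubsetP sB : mergev t @` e `<=` B.
    apply: cl; first by apply/relabelP; exists e; rewrite // mem_rem_uniq // inE ed.
    have/meetP[v ve vB] := me; apply/meetP; exists (mergev t v); first exact: in_imfset.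
    rewrite mergevE; case: eqP => [//|vt]; move: vB; rewrite !inE => /orP[/eqP//|//].
  apply/fsubsetP => v ve; have := sB _ (in_imfset _ (mergev t) ve) => /=.
  by rewrite mergevE !inE; case: eqP.
apply/fsubsetP => v; rewrite in_vset; case: v => [u|_ //].
rewrite !inE => /andP[ut uS]; have := sub (Some u); rewrite in_vset => /(_ uS).
by rewrite !inE => /orP[/eqP[E]|//]; rewrite E eqxx in ut.
Qed.

Lemma otree_glue S1 S2 s1 s2 : [disjoint S1 & S2]%fset ->
  otree S1 s1 -> otree S2 s2 -> otree (S1 `|` S2) (s1 ++ s2).
Proof.
move=> dis /otreeP[sz1 pe1 cn1] /otreeP[sz2 pe2 cn2].
have H1 : vset S1 `<=` vset (S1 `|` S2).
  by apply/fsubsetP => -[v|]; rewrite !in_vset // !inE => ->.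
have H2 : vset S2 `<=` vset (S1 `|` S2).
  by apply/fsubsetP => -[v|]; rewrite !in_vset // !inE => ->; rewrite orbT.
apply/otreeP; split.
- by rewrite size_cat sz1 sz2 cardfsU (eqP dis) cardfs0 subn0.
- rewrite /pair_edges all_cat; apply/andP; split; apply/allP => e.
    by move=> /(allP pe1)/andP[-> /fsubset_trans]; apply.
  by move=> /(allP pe2)/andP[-> /fsubset_trans]; apply.
move=> B B0 cl; have /fsubsetP C1 : vset S1 `<=` B.
  by apply: cn1 => // e es; apply: cl; rewrite mem_cat es.
have /fsubsetP C2 : vset S2 `<=` B.
  by apply: cn2 => // e es; apply: cl; rewrite mem_cat es orbT.
apply/fsubsetP => -[v|//]; rewrite in_vset inE => /orP[vS|vS].
  by apply: C1; rewrite in_vset.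
by apply: C2; rewrite in_vset.
Qed.

End Connectivity.

(** * Linear maps out of presented spaces and out of the space of trees *)

Section Linext.
Variables (K : fieldType) (X : choiceType) (W : lmodType K) (phi : X -> W).

HB.instance Definition _ := GRing.isLinear.Build K {malg K[X]} W _
  (linext phi) (linextP phi).

Lemma linextU s : linext phi << s >> = phi s.
Proof. by rewrite /linext msuppU oner_eq0 big_seq_fset1 mcoeffUU scale1r. Qed.

Variable G : {malg K[X]} -> Prop.
Hypothesis G0 : forall y, G y -> linext phi y = 0.

Lemma plift_linear : linear (plift phi : pres G -> W).
Proof.
move=> c; elim/quotW=> x; elim/quotW=> y.
rewrite [c *: _]pi_scale -raddfD !(pliftE _ G0) linextP //.
Qed.

Lemma plift_pgen s : plift phi (pgen G s) = phi s.
Proof. by rewrite /pgen pliftE // linextU. Qed.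

End Linext.

(** Linear statements about a presented space need only be checked on the
    generators. *)
Lemma pres_ind (K : fieldType) (X : choiceType) (G : {malg K[X]} -> Prop)
    (x : pres G) :
  exists c : seq (K * X), x = \sum_(d <- c) d.1 *: pgen G d.2.
Proof.
elim/quotW: x => x; exists [seq (x@_s, s) | s <- msupp x].
rewrite big_map /= {1}(monalgE x) raddf_sum; apply: eq_bigr => s _.
have -> : << x@_s *g s >> = x@_s *: << s >>.
  by apply/malgP => t; rewrite mcoeffZ !mcoeffU mulr_natr.
by rewrite /pgen /= [RHS]pi_scale.
Qed.

(* The atoms are generalized before the arithmetic decision procedure is called,
   as it would otherwise compare finite sets up to conversion. *)
Ltac perm_count :=
  let p := fresh "p" in
  apply/seq.permP => p; do 4 rewrite ?count_cat -?cats1 /=;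
  do ?move: (count _ _); do ?move: (p _); clear; intros; lia.

Section TreeRelations.
Variables (K : fieldType) (r : nat) (W : lmodType K).
Local Notation edge := (edge r).
Variable phi : seq edge -> W.

(** The relations R1 and R2 are equivalent to their instances with adjacent
    edges, for R1, and with the two special edges in front, for R2: the sign for
    moving two edges to the front depends only on their positions. Maps on lists
    of edges that satisfy these two instances descend to the space of trees. *)
Definition alternating := forall S s1 e f s2, otree S (s1 ++ e :: f :: s2) ->
  phi (s1 ++ e :: f :: s2) = - phi (s1 ++ f :: e :: s2).

Definition triangular := forall S s (t x u : vert r),
  t != x -> t != u -> x != u ->
  otree S ([fset t; u] :: [fset t; x] :: s) ->
  otree S ([fset u; x] :: [fset t; u] :: s) ->
  otree S ([fset t; x] :: [fset u; x] :: s) ->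
  phi ([fset t; u] :: [fset t; x] :: s) +
  phi ([fset u; x] :: [fset t; u] :: s) +
  phi ([fset t; x] :: [fset u; x] :: s) = 0.

Hypotheses (alt : alternating) (tri : triangular).

Lemma alt_move S s1 e s2 s3 : otree S (s1 ++ e :: s2 ++ s3) ->
  phi (s1 ++ e :: s2 ++ s3) = (-1) ^+ size s2 *: phi (s1 ++ s2 ++ e :: s3).
Proof.
elim: s2 s1 => [|f s2 IH] s1 ot /=; first by rewrite scale1r.
rewrite (alt ot) -cat_rcons IH; last by apply: otree_perm ot; perm_count.
by rewrite cat_rcons exprS mulN1r scaleNr.
Qed.

Lemma alt_swap S s1 e s2 f s3 : otree S (s1 ++ e :: s2 ++ f :: s3) ->
  phi (s1 ++ e :: s2 ++ f :: s3) + phi (s1 ++ f :: s2 ++ e :: s3) = 0.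
Proof.
move=> ot; rewrite (alt_move ot).
have ot1 : otree S (s1 ++ f :: s2 ++ e :: s3).
  by apply: otree_perm ot; perm_count.
have ot2 : otree S ((s1 ++ s2) ++ e :: f :: s3).
  by apply: otree_perm ot; perm_count.
by rewrite (alt_move ot1) catA (alt ot2) -catA scalerN addNr.
Qed.

Lemma alt_front S s1 e s2 f s3 : otree S (s1 ++ e :: s2 ++ f :: s3) ->
  otree S (e :: f :: s1 ++ s2 ++ s3) /\
  phi (s1 ++ e :: s2 ++ f :: s3) =
    (-1) ^+ size s2 *: phi (e :: f :: s1 ++ s2 ++ s3).
Proof.
move=> ot.
have ot1 : otree S (e :: s1 ++ s2 ++ f :: s3).
  by apply: otree_perm ot; perm_count.
have ot2 : otree S (e :: f :: s1 ++ s2 ++ s3).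
  by apply: otree_perm ot; perm_count.
split=> //.
have := @alt_move S [:: e] f (s1 ++ s2) s3; rewrite -catA => /(_ ot2) /= ->.
have := @alt_move S [::] e s1 (s2 ++ f :: s3); rewrite /= => /(_ ot1).
rewrite -catA => ->; rewrite !scalerA size_cat exprD.
have sq n : (-1) ^+ n * (-1) ^+ n = 1 :> K by rewrite -expr2 sqrr_sign.
by rewrite [X in X * _]mulrCA sq mulr1 sq scale1r.
Qed.

Lemma set_nth_cat (s1 s2 : seq edge) x y :
  set_nth fset0 (s1 ++ x :: s2) (size s1) y = s1 ++ y :: s2.
Proof. by elim: s1 => //= z s1 ->. Qed.

Lemma set_nth_cat2 (s1 s2 s3 : seq edge) x x' y z :
  set_nth fset0 (s1 ++ x :: s2 ++ y :: s3) (size (s1 ++ x' :: s2)) z =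
  s1 ++ x :: s2 ++ z :: s3.
Proof. by elim: s1 => [|t s1 /= ->] //=; rewrite set_nth_cat. Qed.

Lemma split_nth (s : seq edge) a : (a < size s)%N ->
  exists s1 x s2, s = s1 ++ x :: s2 /\ size s1 = a.
Proof.
move=> lt; exists (take a s), (nth fset0 s a), (drop a.+1 s).
by rewrite -drop_nth // cat_take_drop size_takel // ltnW.
Qed.

Lemma put2_split (s : seq edge) a b :
  (a < size s)%N -> (b < size s)%N -> a != b ->
  exists s1 s2 s3, (forall e f, put2 s a b e f = s1 ++ e :: s2 ++ f :: s3) \/
                   (forall e f, put2 s a b e f = s1 ++ f :: s2 ++ e :: s3).
Proof.
have H c d : (c < d)%N -> (d < size s)%N -> exists s1 x s2 y s3,
    [/\ s = s1 ++ x :: s2 ++ y :: s3, size s1 = c & size (s1 ++ x :: s2) = d].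
  move=> cd /split_nth[t [y [s3 [Es sd]]]]; move: cd; rewrite -sd.
  move=> /split_nth[s1 [x [s2 [Et sc]]]]; exists s1, x, s2, y, s3.
  by rewrite -Et Es Et -catA.
move=> as_ bs; rewrite /put2; have [ab _|ba _|] := ltngtP a b; last by [].
  have [s1 [x [s2 [y [s3 [-> <- <-]]]]]] := H a b ab bs.
  by exists s1, s2, s3; left=> e f; rewrite set_nth_cat set_nth_cat2.
have [s1 [x [s2 [y [s3 [-> <- <-]]]]]] := H b a ba as_.
by exists s1, s2, s3; right=> e f; rewrite set_nth_cat2 set_nth_cat.
Qed.

Lemma tree_rel_kill y : tree_rel y -> linext phi y = 0.
Proof.
case=> [S s1 e s2 f s3 ot|S s a b t x u tx tu xu as_ bs ab T1 T2 T3].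
  by rewrite linearD /= !linextU (alt_swap ot).
rewrite !linearD /= !linextU.
have [s1 [s2 [s3 [H|H]]]] := put2_split as_ bs ab; rewrite /T1 /T2 /T3 !H.
  move=> /alt_front[o1 ->] /alt_front[o2 ->] /alt_front[o3 ->].
  by rewrite -!scalerDr (tri tx tu xu o1 o2 o3) scaler0.
move=> /alt_front[o1 ->] /alt_front[o2 ->] /alt_front[o3 ->].
have sw e f (o : otree S (e :: f :: s1 ++ s2 ++ s3)) :
   phi (e :: f :: s1 ++ s2 ++ s3) = - phi (f :: e :: s1 ++ s2 ++ s3).
  exact: (@alt S [::]).
rewrite -!scalerDr (sw _ _ o1) (sw _ _ o2) (sw _ _ o3) -!opprD.
have swo e f : otree S (e :: f :: s1 ++ s2 ++ s3) -> otree S (f :: e :: s1 ++ s2 ++ s3).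
  by move=> o; apply: otree_perm o; perm_count.
by rewrite (tri tx tu xu (swo _ _ o1) (swo _ _ o2) (swo _ _ o3)) oppr0 scaler0.
Qed.

Lemma plift_tree s : plift phi (tree K s) = phi s.
Proof. exact/plift_pgen/tree_rel_kill. Qed.

Lemma plift_tree_linear : linear (plift phi : trees K r -> W).
Proof. exact/plift_linear/tree_rel_kill. Qed.

End TreeRelations.

Lemma pi_rel0 (K : fieldType) (X : choiceType) (G : {malg K[X]} -> Prop) y :
  G y -> \pi_(pres G)%qT y = 0 :> pres G.
Proof.
move=> Gy; rewrite -(raddf0 (\pi_(pres G)%qT)).
apply/eqP; rewrite piE Quotient.equivE subr0; apply/asboolP.
exists [:: (1, y)]; split; first by move=> c; rewrite inE => /eqP->.
by rewrite big_seq1 scale1r.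
Qed.

Lemma pgen_rel2 (K : fieldType) (X : choiceType) (G : {malg K[X]} -> Prop)
  a b : G (<< a >> + << b >>) -> pgen G a + pgen G b = 0.
Proof. by move=> /pi_rel0 H; rewrite -H raddfD. Qed.

Lemma pgen_rel3 (K : fieldType) (X : choiceType) (G : {malg K[X]} -> Prop)
  a b c : G (<< a >> + << b >> + << c >>) -> pgen G a + pgen G b + pgen G c = 0.
Proof. by move=> /pi_rel0 H; rewrite -H !raddfD. Qed.

(** * Residues and permutations act on the space of trees *)

Section TreeOps.
Variables (K : fieldType) (r : nat).
Local Notation edge := (edge r).
Local Notation tree := (@tree K r).
Local Notation trees := (trees K r).

Lemma tree_alternating : alternating tree.
Proof.
move=> S s1 e f s2 ot; apply/eqP; rewrite -addr_eq0; apply/eqP.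
by apply: pgen_rel2; apply: (@TreeR1 K r S s1 e [::] f s2).
Qed.

Lemma put2_front (s : seq edge) x y e f :
  put2 (x :: y :: s) 0 1 e f = e :: f :: s.
Proof. by []. Qed.

Lemma tree_triangular : triangular tree.
Proof.
move=> S s t x u tx tu xu o1 o2 o3; apply: pgen_rel3.
have := @TreeR2 K r S (fset0 :: fset0 :: s) 0 1 t x u tx tu xu isT isT isT.
cbv zeta; rewrite 1!put2_front 2!put2_front => H; exact: (H o1 o2 o3).
Qed.

(** The residue of a single list of edges, which is linearly extended in the
    definition of residues. *)
Definition res_tree (t : sym r) (s : seq edge) : trees :=
  let e := [fset Some t; None] in let a := index e s in
  if e \in s then
    (-1) ^+ a *: tree (relabel (mergev t) (take a s ++ drop a.+1 s))
  else 0.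

Lemma res_tree0 t s : [fset Some t; None] \notin s -> res_tree t s = 0.
Proof. by move=> ds; rewrite /res_tree (negbTE ds). Qed.

Lemma drop_size_cons (T : Type) (x : T) p q : drop (size p).+1 (p ++ x :: q) = q.
Proof. by elim: p => [|y p IH] //=; rewrite drop0. Qed.

Lemma index_split (T : eqType) (x : T) p q : x \notin p ->
  index x (p ++ x :: q) = size p.
Proof. by move=> xp; rewrite index_cat (negbTE xp) /= eqxx addn0. Qed.

Lemma rem_split (T : eqType) (x : T) p q : x \notin p -> rem x (p ++ x :: q) = p ++ q.
Proof.
by move=> xp; rewrite remE index_split // take_size_cat // drop_size_cons.
Qed.

Lemma res_tree_split t p q : [fset Some t; None] \notin p ->
  res_tree t (p ++ [fset Some t; None] :: q) =
  (-1) ^+ size p *: tree (relabel (mergev t) (p ++ q)).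
Proof.
rewrite /res_tree; move: [fset _; _] => d dp.
have -> : d \in p ++ d :: q by rewrite mem_cat mem_head orbT.
by rewrite (index_split q dp) take_size_cat // drop_size_cons.
Qed.

Lemma relabel_cat (phi : vert r -> vert r) s1 s2 :
  relabel phi (s1 ++ s2) = relabel phi s1 ++ relabel phi s2.
Proof. exact: map_cat. Qed.

Lemma in_splitP (T : eqType) (x : T) s : x \in s ->
  exists p q, s = p ++ x :: q /\ x \notin p.
Proof.
elim: s => //= y s IH; rewrite inE; have [->|xy /= /IH[p [q [-> xp]]]] := eqVneq x y.
  by exists [::], s.
by exists (y :: p), q; rewrite inE negb_or xy.
Qed.

(** Contracting one of the two exchanged edges gives the same tree in both
    terms, and the position of that edge changes by one; contracting another edge
    leaves an exchange of two adjacent edges. *)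
Lemma res_alternating t : alternating (res_tree t).
Proof.
move=> S s1 e f s2 ot; set d := [fset Some t; None].
have us := otree_uniq ot.
have ct p q : d \notin p -> s1 ++ e :: f :: s2 = p ++ d :: q ->
    otree (S `\ t) (relabel (mergev t) (p ++ q)).
  move=> dp E; rewrite -(rem_split q dp) -E; apply: otree_contract ot _.
  by rewrite E mem_cat mem_head orbT.
have [/in_splitP[p [q [E dp]]]|ds1] := boolP (d \in s1).
  move: ct; rewrite E -!catA !cat_cons => /(_ p _ dp erefl).
  rewrite !res_tree_split // !relabel_cat /= catA => ot'.
  by rewrite (tree_alternating ot') scalerN -catA.
have [de|de] := eqVneq d e.
  have df : d \notin s1 ++ [:: f].
    move: us; rewrite cat_uniq => /and3P[_ _]; rewrite mem_cat de negb_or -de ds1.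
    by rewrite cons_uniq !inE negb_or => /andP[/andP[]].
  rewrite -de res_tree_split // -[f :: d :: s2]/([:: f] ++ d :: s2) catA.
  by rewrite res_tree_split // -catA size_cat addn1 exprS mulN1r scaleNr opprK.
have [df|df] := eqVneq d f.
  have de' : d \notin s1 ++ [:: e] by rewrite mem_cat negb_or ds1 inE.
  rewrite -df res_tree_split // -[e :: d :: s2]/([:: e] ++ d :: s2) catA.
  by rewrite res_tree_split // -catA size_cat addn1 exprS mulN1r scaleNr.
have [/in_splitP[p [q [E dp]]]|ds2] := boolP (d \in s2).
  have H x y : x \in [:: e; f] -> y \in [:: e; f] -> d \notin s1 ++ x :: y :: p.
    rewrite mem_cat !inE !negb_or ds1 dp => /orP[]/eqP-> /orP[]/eqP->.
    - by rewrite !de.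
    - by rewrite de df.
    - by rewrite df de.
    by rewrite df.
  move: ct; rewrite E -!cat_cons !catA => /(_ _ _ _ erefl).
  rewrite !res_tree_split ?H ?inE ?eqxx ?orbT // => /(_ isT).
  rewrite -!catA /= !relabel_cat /= => ot'.
  by rewrite (tree_alternating ot') scalerN !size_cat.
by rewrite !res_tree0 ?oppr0 // mem_cat !inE !negb_or ds1 ds2 de df.
Qed.

(** If the contracted edge joins two of the three vertices, it occurs in exactly
    two of the three trees, at adjacent positions, and the remaining special edges
    become equal after contraction; so the two residues cancel. Otherwise the three
    residues form again a relation R2, the three vertices staying distinct because
    contraction creates no loop. *)
Lemma res_triangular t : triangular (res_tree t).
Proof.
move=> S s p x u px pu xu o1 o2 o3; set d := [fset Some t; None].
have pair_eq (a b : vert r) : d = [fset a; b] ->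
  mergev t a = None /\ mergev t b = None.
  move=> E; have ad : a \in d by rewrite E !inE eqxx.
  have bd : b \in d by rewrite E !inE eqxx orbT.
  by move: ad bd; rewrite !mergevE !inE => /orP[]/eqP-> /orP[]/eqP->; rewrite ?eqxx.
have hd q s' : res_tree t (d :: q :: s') = tree (relabel (mergev t) (q :: s')).
  by rewrite (@res_tree_split t [::]) // scale1r.
have hd2 q s' : d != q -> res_tree t (q :: d :: s') = - tree (relabel (mergev t) (q :: s')).
  by move=> dq; rewrite (@res_tree_split t [:: q]) ?inE // scaleN1r.
have ne e f (ot : otree S (e :: f :: s)) : [&& e != f, e \notin s & f \notin s].
  move: (otree_uniq ot); rewrite !cons_uniq inE negb_or -!andbA => /and4P[-> -> ->] //.
have key q q' : d != q' ->
    relabel (mergev t) (q :: s) = relabel (mergev t) (q' :: s) ->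
    res_tree t (d :: q :: s) + res_tree t (q' :: d :: s) = 0.
  by move=> dq E; rewrite hd hd2 // E subrr.
have none e f : d != e -> d != f -> d \notin s -> res_tree t (e :: f :: s) = 0.
  by move=> de df ds; apply: res_tree0; rewrite !inE !negb_or de df.
have := ne _ _ o1; have := ne _ _ o2; have := ne _ _ o3.
move=> /and3P[n3 a3 b3] /and3P[n2 a2 b2] /and3P[n1 a1 b1].
have rl a b : relabel (mergev t) ([fset a; b] :: s) =
    [fset mergev t a; mergev t b] :: relabel (mergev t) s.
  by rewrite /= imfset_fset2.
have n1' := n1; have n2' := n2; have n3' := n3; rewrite eq_sym in n1'.
rewrite eq_sym in n2'; rewrite eq_sym in n3'.
have [E|d1] := eqVneq d [fset p; u].
  have [mp mu] := pair_eq _ _ E; rewrite -E in n1 n2 n1' n2' a1 *.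
  by rewrite (none [fset p; x]) // addr0; apply: key; rewrite // !rl mp mu.
have [E|d2] := eqVneq d [fset u; x].
  have [mu mx] := pair_eq _ _ E; rewrite -E in n2 n3 n2' n3' a2 *.
  by rewrite (none [fset p; u]) // add0r; apply: key; rewrite // !rl mu mx fsetUC.
have [E|d3] := eqVneq d [fset p; x].
  have [mp mx] := pair_eq _ _ E; rewrite -E in n1 n3 n1' n3' a3 *.
  rewrite (none [fset u; x]) // addr0 addrC.
  by apply: key; rewrite // !rl mp mx fsetUC.
have [ds|ds] := boolP (d \in s); last by rewrite !none // !addr0.
have [a [b [Es da]]] := in_splitP ds.
have split e f : d != e -> d != f -> otree S (e :: f :: s) ->
    otree (S `\ t) (relabel (mergev t) (e :: f :: a ++ b)) /\
    res_tree t (e :: f :: s) =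
      (-1) ^+ size (e :: f :: a) *: tree (relabel (mergev t) (e :: f :: a ++ b)).
  move=> de df ot; have dn : d \notin e :: f :: a by rewrite !inE !negb_or de df.
  have dm : d \in e :: f :: s by rewrite !inE ds !orbT.
  split; last by rewrite Es -!cat_cons res_tree_split.
  by have := otree_contract ot dm; rewrite -/d Es -!cat_cons rem_split.
have mne v w l : otree S l -> d \in l -> [fset v; w] \in l -> d != [fset v; w] ->
    mergev t v != mergev t w.
  move=> ot dl vl dv; have := mergev_card ot dl vl.
  by rewrite eq_sym imfset_fset2 cardfs2 => /(_ dv) [] /eqP; rewrite eqb1.
have [c1 ->] := split _ _ d1 d3 o1; have [c2 ->] := split _ _ d2 d1 o2.
have [c3 ->] := split _ _ d3 d2 o3.
have dm e f : d \in e :: f :: s by rewrite !inE ds !orbT.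
move: c1 c2 c3; rewrite -!scalerDr /= !imfset_fset2 => c1 c2 c3.
rewrite (tree_triangular _ _ _ c1 c2 c3) ?scaler0 //.
- by apply: (mne _ _ _ o1 (dm _ _)); rewrite ?inE ?eqxx ?orbT.
- by apply: (mne _ _ _ o1 (dm _ _)); rewrite ?inE ?eqxx ?orbT.
- by rewrite eq_sym; apply: (mne _ _ _ o2 (dm _ _)); rewrite ?inE ?eqxx ?orbT.
Qed.

Lemma Res_tree t s : Res t (tree s) = res_tree t s.
Proof. exact: (plift_tree (@res_alternating t) (@res_triangular t)). Qed.

Lemma Res_linear t : linear (Res t : trees -> trees).
Proof. exact: (plift_tree_linear (@res_alternating t) (@res_triangular t)). Qed.

HB.instance Definition _ t := GRing.isLinear.Build K trees trees _
  (@Res K r t) (Res_linear t).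

(** The coefficient of the one-vertex tree; it is well defined since all relations
    involve trees with at least two edges. *)
Definition root_coef : trees -> K^o := plift (fun s : seq edge => (s == [::])%:R).

Lemma root_alternating : alternating (fun s : seq edge => (s == [::])%:R : K^o).
Proof. by move=> S s1 e f s2 _; case: s1 => [|? ?]; rewrite /= oppr0. Qed.

Lemma root_triangular : triangular (fun s : seq edge => (s == [::])%:R : K^o).
Proof. by move=> S s t x u *; rewrite !addr0. Qed.

Lemma root_coef_tree s : root_coef (tree s) = (s == [::])%:R.
Proof. exact: (plift_tree root_alternating root_triangular). Qed.

Lemma root_coef_linear : linear root_coef.
Proof. exact: (plift_tree_linear root_alternating root_triangular). Qed.

HB.instance Definition _ := GRing.isLinear.Build K trees K^o _
  root_coef root_coef_linear.

Lemma relabel_otree S (phi : vert r -> vert r) :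
  injective phi -> phi None = None ->
  exists S', forall s, otree S s -> otree S' (relabel phi s).
Proof.
move=> inj phi0; exists [fset odflt t (phi (Some t)) | t in S] => s.
apply: otree_relabel => //; apply/fsetP => v; rewrite in_vset.
have some t : exists u, phi (Some t) = Some u.
  case E: (phi (Some t)) => [u|]; first by exists u.
  by have := inj (Some t) None; rewrite phi0 E => /(_ erefl).
apply/idP/imfsetP => /= [|[w wS ->]].
  case: v => [v|_]; last by exists None; rewrite ?in_vset ?phi0.
  move=> /imfsetP[t /= tS ->]; exists (Some t); first by rewrite in_vset.
  by have [u ->] := some t.
case: w wS => [t|]; rewrite in_vset ?phi0 // => tS.
by have [u E] := some t; rewrite E; apply/imfsetP; exists t; rewrite //= E.
Qed.

Section Relabel.
Variable phi : vert r -> vert r.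
Hypotheses (inj : injective phi) (phi0 : phi None = None).

Lemma relabel_alternating : alternating (fun s => tree (relabel phi s)).
Proof.
move=> S s1 e f s2 ot; have [S' ot'] := relabel_otree S inj phi0.
by move: (ot' _ ot); rewrite !relabel_cat /= => /tree_alternating.
Qed.

Lemma relabel_triangular : triangular (fun s => tree (relabel phi s)).
Proof.
move=> S s t x u tx tu xu o1 o2 o3.
have [S' ot'] := relabel_otree S inj phi0.
move: (ot' _ o1) (ot' _ o2) (ot' _ o3).
rewrite /= !imfset_fset2; apply: tree_triangular; by rewrite inj_eq.
Qed.
End Relabel.

Section Perm.
Variable k : degree r.
Implicit Types pi tau : symgroup k.

Lemma permvE pi i (j : 'I_(k i)) : permv pi (Some (i, val j)) = Some (i, val (pi i j)).
Proof. by rewrite /= valK. Qed.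

Lemma permv_out pi i j : (k i <= j)%N -> permv pi (Some (i, j)) = Some (i, j).
Proof. by move=> le; rewrite /= insubF // ltnNge le. Qed.

Lemma permv_inj pi : injective (permv pi).
Proof.
case=> [[i j]|] [[i' j']|] // [Ei]; subst i'.
case: insubP => [u _ <-|nj]; case: insubP => [u' _ <-|nj'].
- by move=> /val_inj/perm_inj->.
- by move=> E; rewrite -E ltn_ord in nj'.
- by move=> E; rewrite E ltn_ord in nj.
by move=> ->.
Qed.

Lemma perm_act_tree pi s : perm_act pi (tree s) = tree (relabel (permv pi) s).
Proof.
exact: (plift_tree (relabel_alternating (@permv_inj pi) erefl)
         (relabel_triangular (@permv_inj pi) erefl)).
Qed.

Lemma perm_act_linear pi : linear (perm_act pi : trees -> trees).
Proof.
exact: (plift_tree_linear (relabel_alternating (@permv_inj pi) erefl)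
         (relabel_triangular (@permv_inj pi) erefl)).
Qed.

HB.instance Definition _ pi := GRing.isLinear.Build K trees trees _
  (@perm_act K r k pi) (perm_act_linear pi).

Lemma ASym_linear : linear (@ASym K r k).
Proof.
move=> c x y; rewrite /ASym scaler_sumr -big_split /=; apply: eq_bigr => pi _.
by rewrite linearP scalerDr !scalerA mulrC.
Qed.

HB.instance Definition _ := GRing.isLinear.Build K trees trees _
  (@ASym K r k) ASym_linear.

(** The family of groups [symgroup k] acts through permutations applied from left
    to right, hence the order of the factors. *)
Definition pcomp (tau pi : symgroup k) : symgroup k := [ffun i => (pi i * tau i)%g].

Lemma permv_comp tau pi v : permv tau (permv pi v) = permv (pcomp tau pi) v.
Proof.
case: v => [[i j]|] //; have [lt|ge] := ltnP j (k i); last by rewrite (permv_out pi ge) !(permv_out _ ge).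
by rewrite -[j]/(val (Ordinal lt)) !permvE ffunE permM.
Qed.

Lemma relabel_comp (f g : vert r -> vert r) s : relabel f (relabel g s) = relabel (f \o g) s.
Proof. rewrite /relabel -map_comp; apply: eq_map => e /=; apply/fsetP => v.
apply/imfsetP/imfsetP => /= [[w /imfsetP[u /= ue ->] ->]|[u ue ->]]; first by exists u.
by exists (g u) => //; apply: in_imfset. Qed.

Lemma eq_relabel (f g : vert r -> vert r) s : f =1 g -> relabel f s = relabel g s.
Proof.
move=> fg; apply: eq_map => e; apply/fsetP => v.
by apply/imfsetP/imfsetP => -[w we ->]; exists w; rewrite ?fg.
Qed.

Lemma trees_ind (P : trees -> Prop) :
  P 0 -> (forall c s x, P x -> P (c *: tree s + x)) -> forall x, P x.
Proof.
move=> P0 PD x; have [c ->] := pres_ind x.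
by elim: c => [|d c IH]; rewrite ?big_nil // big_cons; apply: PD.
Qed.

Lemma perm_act_comp tau pi x :
  perm_act tau (perm_act pi x) = perm_act (pcomp tau pi) x :> trees.
Proof.
elim/trees_ind: x => [|c s x IH]; first by rewrite !linear0.
rewrite !linearP /= IH !perm_act_tree relabel_comp; congr (_ *: tree _ + _).
by apply: eq_relabel => v /=; rewrite permv_comp.
Qed.

Lemma sgnG_comp tau pi : sgnG K (pcomp tau pi) = sgnG K tau * sgnG K pi.
Proof.
rewrite /sgnG -big_split /=; apply: eq_bigr => i _.
by rewrite ffunE odd_permM signr_addb mulrC.
Qed.

Lemma sgnG_sqr pi : sgnG K pi * sgnG K pi = 1.
Proof.
by rewrite /sgnG -big_split big1 //= => i _; rewrite -expr2 sqrr_sign.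
Qed.

Definition pinv pi : symgroup k := [ffun i => (pi i)^-1%g].

Lemma pcompK tau : cancel (pcomp tau) (pcomp (pinv tau)).
Proof. by move=> pi; apply/ffunP => i; rewrite !ffunE mulgK. Qed.

Lemma pcompKV tau : cancel (pcomp (pinv tau)) (pcomp tau).
Proof. by move=> pi; apply/ffunP => i; rewrite !ffunE mulgVK. Qed.

Lemma perm_act_ASym tau (x : trees) :
  perm_act tau (ASym k x) = sgnG K tau *: ASym k (x : trees).
Proof.
rewrite /ASym linear_sum /= scaler_sumr.
rewrite [RHS](reindex_onto (pcomp tau) (pcomp (pinv tau))) /=; last first.
  by move=> pi _; rewrite pcompKV.
apply: eq_big => [pi|pi _]; first by rewrite pcompK eqxx.
by rewrite linearZ /= perm_act_comp sgnG_comp !scalerA mulrA sgnG_sqr mul1r.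
Qed.

Lemma card_symgroup : #|symgroup k| = (\prod_i (k i)`!)%N.
Proof.
rewrite card_dep_ffun foldrE big_map big_enum /=; apply: eq_bigr => i _.
by rewrite card_Sn.
Qed.

(** On antisymmetric elements all terms of the antisymmetrization agree. *)
Lemma ASym_calA (x : trees) : calA k x -> ASym k x = (\prod_i (k i)`!)%N%:R *: x.
Proof.
move=> [_ anti]; transitivity (\sum_(pi : symgroup k) x).
  by apply: eq_bigr => pi _; rewrite anti scalerA sgnG_sqr scale1r.
by rewrite sumr_const card_symgroup scaler_nat.
Qed.

End Perm.
End TreeOps.

(** * Signs of listings, as determinants *)

Section BoolDet.
Variable K : fieldType.

Definition bool_mx n (b : 'I_n -> 'I_n -> bool) : 'M[K]_n := \matrix_(i, j) (b i j)%:R.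

Lemma det_bool_mx_col0 n (b : 'I_n -> 'I_n -> bool) j :
  (forall i, ~~ b i j) -> \det (bool_mx b) = 0.
Proof.
move=> b0; rewrite (expand_det_col _ j) big1 // => i _.
by rewrite mxE (negbTE (b0 i)) mul0r.
Qed.

Lemma det_bool_mx_row_eq n (b : 'I_n -> 'I_n -> bool) i1 i2 :
  i1 != i2 -> b i1 =1 b i2 -> \det (bool_mx b) = 0.
Proof.
by move=> ne E; apply: (determinant_alternate ne) => j; rewrite !mxE E.
Qed.

(** If no column is zero, choosing an entry in each column gives an injection,
    and the matrix is a permutation matrix. *)
Lemma det_bool_mx_sqr n (b : 'I_n -> 'I_n -> bool) :
  (forall i j j', b i j -> b i j' -> j = j') ->
  \det (bool_mx b) ^+ 2 = [forall j, exists i, b i j]%:R.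
Proof.
move=> row; case: (boolP [forall j, _]) => [/forallP ex|]; last first.
  move=> /forallPn[j /existsPn nj]; by rewrite (det_bool_mx_col0 nj) expr0n.
have {ex} ex j : {i | b i j} by apply/sigW/existsP.
pose s j := sval (ex j).
have bs j : b (s j) j by rewrite /s; case: (ex j).
have s_inj : injective s by move=> j j' E; apply: (row (s j)); rewrite ?E // -E.
have -> : bool_mx b = (perm_mx (perm s_inj))^T.
  apply/matrixP => i j; rewrite !mxE permE; congr (nat_of_bool _)%:R.
  have [<-|ne] := eqVneq (s j) i; first by rewrite bs.
  have /injF_bij[s' ss' s's] := s_inj.
  apply/negP => bij; move/negP: ne; apply; rewrite -(s's i); apply/eqP; congr s.
  by apply: (row i) => //; rewrite -{1}(s's i).
by rewrite det_tr det_perm sqrr_sign.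
Qed.

End BoolDet.

Section SeqSign.
Variable K : fieldType.

Lemma onth_bump (T : Type) (p q : seq T) x i :
  onth (p ++ x :: q) (bump (size p) i) = onth (p ++ q) i.
Proof.
rewrite /bump; elim: p i => [|y p IH] [|i] //=.
by rewrite ltnS addnS /= IH.
Qed.

(** The sign of the permutation that turns [L] into [M]. As a determinant it is
    multiplicative, and it can be expanded in the same way as the iterated residues
    and the sign of a tree. *)
Definition seqsign (T : eqType) (L M : seq T) : K :=
  \det (bool_mx K (fun i j : 'I_(size L) => onth L i == onth M j)).

Lemma seqsignE (T : eqType) n (L M : seq T) : size L = n ->
  seqsign L M = \det (bool_mx K (fun i j : 'I_n => onth L i == onth M j)).
Proof. by move <-. Qed.

Lemma onth_lt (T : Type) (L : seq T) n (i : 'I_n) : size L = n ->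
  exists x, onth L i = Some x.
Proof.
elim: L n i => [|x L IH] [|n] i //=; first by case: i.
move=> [sz]; case: i => -[|i] lt /=; first by exists x.
by apply: (IH n (Ordinal (lt : i < n)%N)).
Qed.

Lemma onth_inj (T : eqType) (L : seq T) n (i j : 'I_n) : size L = n -> uniq L ->
  onth L i = onth L j -> i = j.
Proof.
move=> sz u E; apply: val_inj => /=.
have [x Ei] := onth_lt i sz.
have x0 := x; apply/eqP; rewrite -(nth_uniq x0 _ _ u) ?sz //.
move: E; rewrite !onthE => E.
have H k : (k < n)%N -> nth None (map some L) k = Some (nth x0 L k).
  by move=> kn; rewrite (nth_map x0) ?sz.
by move: E; rewrite !H // => -[->].
Qed.

Lemma onth_mem (T : eqType) (L : seq T) n x : size L = n -> x \in L ->
  exists i : 'I_n, onth L i = Some x.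
Proof.
move=> sz xL; have lt : (index x L < n)%N by rewrite -sz index_mem.
exists (Ordinal lt) => /=; rewrite onthE (nth_map x) ?sz //.
by rewrite nth_index.
Qed.

Lemma mem_onth (T : eqType) (L : seq T) i x : onth L i = Some x -> x \in L.
Proof.
elim: L i => [|y L IH] [|i] //= [E]; first by rewrite E mem_head.
by rewrite inE (IH i) ?orbT.
Qed.

Lemma bool_mx_mul_seq (T : eqType) n (b : 'I_n -> T -> bool) (L M : seq T) :
  size L = n -> uniq L -> perm_eq L M ->
  bool_mx K (fun i j : 'I_n => if onth L j is Some x then b i x else false) *m
  bool_mx K (fun i j : 'I_n => onth L i == onth M j) =
  bool_mx K (fun i j : 'I_n => if onth M j is Some x then b i x else false).
Proof.
move=> sz u pm; apply/matrixP => i j; rewrite !mxE.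
have szM : size M = n by rewrite -(perm_size pm).
(* Only the position of [x] in [L] contributes to the sum. *)
have [x Ex] := onth_lt j szM; have xM := mem_onth Ex.
rewrite -(perm_mem pm) in xM; have [c Ec] := onth_mem sz xM.
rewrite (bigD1 c) //= big1 ?addr0 => [|d dc].
  by rewrite !mxE Ex Ec eqxx mulr1.
rewrite !mxE Ex -Ec; case: eqP => [/(onth_inj sz u) E|_]; last by rewrite mulr0.
by rewrite E eqxx in dc.
Qed.

Lemma seqsign_mul (T : eqType) (A L M : seq T) :
  uniq L -> perm_eq A L -> perm_eq L M ->
  seqsign A L * seqsign L M = seqsign A M.
Proof.
move=> u pA pM; have sA := perm_size pA.
rewrite (@seqsignE _ (size A) A) // (@seqsignE _ (size A) L) //.
have H (B : seq T) : size B = size A ->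
   bool_mx K (fun i j : 'I_(size A) => onth A i == onth B j) =
   bool_mx K (fun i j : 'I_(size A) =>
     if onth B j is Some x then onth A i == Some x else false).
  move=> sB; apply/matrixP => i j; rewrite !mxE.
  by have [x ->] := onth_lt j sB.
rewrite -det_mulmx H // bool_mx_mul_seq // /seqsign -H //.
by rewrite -(perm_size pM).
Qed.

Lemma seqsign_map (T T' : eqType) (f : T -> T') (L M : seq T) :
  injective f -> seqsign (map f L) (map f M) = seqsign L M.
Proof.
move=> inj; rewrite (@seqsignE _ (size L)) ?size_map // /seqsign; congr (\det _).
apply/matrixP => i j; rewrite !mxE; congr (nat_of_bool _)%:R.
rewrite !onthE -!map_comp.
have H (A : seq T) k : nth None (map (some \o f) A) k = omap f (nth None (map some A) k).
  by elim: A k => [|x A IH] [|k] /=.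
rewrite !H; case: (nth _ _ i) => [x|]; case: (nth _ _ j) => [y|] //=.
by rewrite !(inj_eq (@Some_inj _)) inj_eq.
Qed.

Lemma seqsign_sqr (T : eqType) (L M : seq T) : uniq L -> perm_eq L M ->
  seqsign L M ^+ 2 = 1.
Proof.
move=> u pm; rewrite /seqsign det_bool_mx_sqr.
  suff -> : [forall j : 'I_(size L), exists i : 'I_(size L), onth L i == onth M j] by [].
  apply/forallP => j; apply/existsP.
  have [x Ex] := onth_lt j (esym (perm_size pm)).
  have xL : x \in L by rewrite (perm_mem pm) (mem_onth Ex).
  by have [i Ei] := onth_mem erefl xL; exists i; rewrite Ei Ex.
move=> i j j' /eqP -> /eqP /onth_inj; apply; last by rewrite -(perm_uniq pm).
by rewrite (perm_size pm).
Qed.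

Fixpoint nb_inv (T : eqType) (lt : rel T) (L : seq T) : nat :=
  if L is x :: L' then (count (lt^~ x) L' + nb_inv lt L')%N else 0%N.

(** Expansion along the first row: the first entry [x] of [L] stands in [M] after
    exactly those entries of [L] that are smaller than [x]. *)
Lemma seqsign_nb_inv (T : eqType) (lt : rel T) (L M : seq T) :
  irreflexive lt -> (forall x y, lt x y -> ~~ lt y x) ->
  pairwise lt M -> perm_eq L M -> seqsign L M = (-1) ^+ nb_inv lt L.
Proof.
move=> irr asym; elim: L M => [|x L IH] M srt pm.
  by rewrite /seqsign det_mx00.
have /in_splitP[p [q [E xp]]] : x \in M by rewrite -(perm_mem pm) mem_head.
move: srt pm; rewrite {}E => srt pm.
have pm' : perm_eq L (p ++ q).
  rewrite -(perm_cons x); apply: perm_trans pm _.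
  by rewrite -cat1s perm_catCA.
have Ep : size p = count (lt^~ x) L.
  rewrite (seq.permP pm') count_cat; move: srt; rewrite pairwise_cat /=.
  move=> /and3P[/allrelP H _ /andP[/allP Hq _]].
  have -> : count (lt^~ x) p = size p.
    by apply/eqP; rewrite -all_count; apply/allP => y yp; apply: H; rewrite ?mem_head.
  rewrite (@eq_in_count _ (lt^~ x) pred0 q) ?count_pred0 ?addn0 // => y yq.
  by apply/negbTE/asym/Hq.
have szL : size L = size (p ++ q) by rewrite (perm_size pm').
have lep : (size p < (size L).+1)%N by rewrite szL size_cat ltnS leq_addr.
rewrite /seqsign (expand_det_row _ (ord0 : 'I_(size L).+1)).
rewrite (bigD1 (Ordinal lep)) //= big1 ?addr0 => [|j jp]; last first.
  rewrite mxE /=; case: eqP => [|_]; last by rewrite mul0r.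
  have -> : Some x = onth (p ++ x :: q) (Ordinal lep : 'I_(size L).+1).
    by rewrite /= onthE map_cat nth_cat size_map ltnn subnn.
  have sz : size (p ++ x :: q) = (size L).+1.
    by rewrite szL !size_cat addnS.
  have u : uniq (p ++ x :: q).
    by apply: pairwise_uniq srt.
  by move=> /(onth_inj sz u) E; rewrite E eqxx in jp.
rewrite mxE /= onthE map_cat nth_cat size_map ltnn subnn /= eqxx mul1r.
rewrite /cofactor add0n exprD -Ep; congr (_ * _).
have srt' : pairwise lt (p ++ q).
  by apply: subseq_pairwise srt; rewrite cat_subseq // subseq_cons.
rewrite -(IH _ srt' pm') /seqsign; congr (\det _).
by apply/matrixP => i j; rewrite !mxE /= onth_bump.
Qed.

End SeqSign.

(** * Iterated residues of a tree along a listing of its vertices *)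

Section Growth.
Variables (K : fieldType) (r : nat).
Local Notation edge := (edge r).
Local Notation sym := (sym r).
Local Notation vert := (vert r).
Local Notation tree := (@tree K r).
Implicit Types (L : seq sym) (s : seq edge) (e : edge) (t : sym).

(** The root precedes all listed symbols. *)
Definition rank L (v : vert) : nat := index v (None :: map Some L).

(** [t] is the end of [e] that comes last in [L]. If the tree grows from the root
    by adding the vertices in the order [L], this is the end farther from the
    root. *)
Definition last_end L e t :=
  (Some t \in e) && all (fun w => rank L w <= rank L (Some t))%N e.

(** Rows are the edges and columns the entries of [L]. *)
Definition last_end_mx n L s :=
  bool_mx K (fun i j : 'I_n => if onth L j is Some t then last_end L (nth fset0 s i) t
                           else false).

(** The scalar by which the iterated residue along [L] takes a tree to the
    one-vertex tree: the sign of the matching of labels and vertices given by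
    [last_end] if each vertex is the last end of one edge, and zero otherwise. *)
Definition resval L s : K := \det (last_end_mx (size s) L s).

Lemma resvalE n L s : size s = n -> resval L s = \det (last_end_mx n L s).
Proof. by move <-. Qed.

Lemma last_endP L e t : reflect (Some t \in e /\
    forall w, w \in e -> (rank L w <= rank L (Some t))%N) (last_end L e t).
Proof.
apply: (iffP andP) => [[te /allP al]|[te al]]; split=> //.
exact/allP.
Qed.

Lemma rank_cons t L v : rank (t :: L) v =
  if v == None then 0%N else if v == Some t then 1%N else (rank L v).+1.
Proof.
rewrite /rank /= [None == v]eq_sym [Some t == v]eq_sym.
by case: eqP => //; case: eqP.
Qed.

Lemma rank_inj L v w : v \in None :: map Some L -> rank L v = rank L w -> v = w.
Proof.
rewrite /rank => vL E; have wL : w \in None :: map Some L.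
  by rewrite -index_mem -E index_mem.
by rewrite -[v](nth_index None vL) E nth_index.
Qed.

Lemma mem_vL L (v : vert) : (v \in None :: map Some L) = if v is Some t then t \in L else true.
Proof.
case: v => [t|]; rewrite inE //= mem_map //; exact: Some_inj.
Qed.

Lemma last_end_inj L e t t' : t \in L -> last_end L e t -> last_end L e t' -> t = t'.
Proof.
move=> tL /last_endP[te al] /last_endP[te' al'].
suff [] : Some t = Some t' by [].
apply: (@rank_inj L); first by rewrite mem_vL.
by apply/eqP; rewrite eqn_leq al' // al.
Qed.

Lemma last_end_merge t L e u : u != t ->
  last_end (t :: L) e u = last_end L (mergev t @` e) u.
Proof.
move=> ut.
have rk w : (rank (t :: L) w <= rank (t :: L) (Some u))%N =
            (rank L (mergev t w) <= rank L (Some u))%N.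
  rewrite !rank_cons mergevE /= (inj_eq (@Some_inj _)) (negbTE ut).
  case: w => [w|] //=.
  by case: eqP.
apply/last_endP/last_endP => -[ue al]; split.
- apply/imfsetP; exists (Some u) => //=.
  by rewrite mergevE (inj_eq (@Some_inj _)) (negbTE ut).
- by move=> w' /imfsetP[w /= we ->]; rewrite -rk al.
- by have /imfsetP[[w|] /= we] := ue; rewrite mergevE; case: eqP => // _ ->.
by move=> w we; rewrite rk al //; apply: in_imfset.
Qed.

(** Only the edge to the root can end at the first vertex of a listing. *)
Lemma last_end_first t L S e : #|` e| == 2 -> e `<=` vset S ->
  {subset S <= t :: L} -> t \notin L ->
  last_end (t :: L) e t = (e == [fset Some t; None]).
Proof.
move=> e2 /fsubsetP sub subL tL; apply/last_endP/eqP => [[te al]|->].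
  apply/eqP; rewrite eqEfcard cardfs2 (eqP e2) andbT.
  apply/fsubsetP => w we; have := al w we; rewrite !rank_cons /= eqxx !inE.
  case: w we => [w|] //= we; case: eqVneq => //= wt.
split; first by rewrite !inE eqxx.
by move=> w; rewrite !inE => /orP[]/eqP->; rewrite ?rank_cons.
Qed.

Definition res_seq L (x : trees K r) := foldl (fun y t => Res t y) x L.

Lemma res_seq_linear L : linear (res_seq L).
Proof.
elim: L => [|t L IH] c x y //=; by rewrite /res_seq /= linearP; apply: IH.
Qed.

HB.instance Definition _ L := GRing.isLinear.Build K (trees K r) (trees K r) _
  (res_seq L) (res_seq_linear L).

(** The first residue expands the determinant along its first column: the only
    nonzero entry is at the label of the edge joining the first vertex to the root,
    and contracting that edge deletes its row, by [last_end_merge]. *)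
Lemma res_seq_tree S L s : otree S s -> uniq L -> S =i L ->
  res_seq L (tree s) = resval L s *: T0 K r.
Proof.
elim: L S s => [|t L IH] S s ot uL SL.
  have s0 : s = [::].
    have /otreeP[sz _ _] := ot; apply/eqP; rewrite -size_eq0 sz cardfs_eq0.
    by apply/eqP/fsetP => x; rewrite SL !inE.
  by rewrite s0 /resval det_mx00 scale1r.
have /otreeP[sz /allP pe _] := ot; have us := otree_uniq ot.
have [tL uL'] : t \notin L /\ uniq L by move: uL => /andP[].
have first e : e \in s -> last_end (t :: L) e t = (e == [fset Some t; None]).
  move=> /pe/andP[e2 sub]; apply: last_end_first e2 sub _ tL => x.
  by rewrite SL.
have szs : size s = (size L).+1.
  have -> : (size L).+1 = size (t :: L) by [].
  rewrite sz; apply/eqP; rewrite -uniq_size_uniq // => x; exact: SL.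
rewrite (resvalE _ szs) /res_seq /= Res_tree.
have [ds|ds] := boolP ([fset Some t; None] \in s); last first.
  rewrite res_tree0 // -/(res_seq _ _) [LHS](linear0 (res_seq L)).
  rewrite (@det_bool_mx_col0 _ _ _ ord0) ?scale0r // => i /=.
  have mi : nth fset0 s i \in s by rewrite mem_nth // szs.
  by rewrite first //; apply: contraNneq ds => <-.
have ct := otree_contract ot ds.
have [p [q [E dp]]] := in_splitP ds.
move: ct first us szs; rewrite E rem_split // => ct first us szs.
rewrite res_tree_split // -/(res_seq _ _) [LHS](linearZ_LR (res_seq L)) /=.
rewrite (IH _ _ ct uL'); last first.
  by move=> x; rewrite !inE SL inE; case: eqVneq => [->|//]; rewrite (negbTE tL).
rewrite scalerA; congr (_ *: _).
have szpq : size (p ++ q) = size L.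
  by move: szs; rewrite !size_cat addnS => -[].
have lep : (size p < (size L).+1)%N by rewrite -szpq size_cat ltnS leq_addr.
rewrite (expand_det_col _ (ord0 : 'I_(size L).+1)).
rewrite (bigD1 (Ordinal lep)) //= big1 ?addr0 => [|j jp]; last first.
  rewrite mxE /= first; last by rewrite mem_nth // szs.
  case: eqP => [E'|_]; last by rewrite mul0r.
  case/eqP: jp; apply: val_inj => /=; apply/eqP.
  rewrite -(nth_uniq fset0 _ _ us) ?szs // E' nth_cat ltnn subnn //.
rewrite mxE /= nth_cat ltnn subnn /= first ?mem_cat ?mem_head ?orbT // eqxx mul1r.
rewrite /cofactor addn0; congr (_ * _).
rewrite (@resvalE (size L)) ?size_relabel //; congr (\det _).
apply/matrixP => i j; rewrite !mxE /=.
have -> : nth fset0 (p ++ [fset Some t; None] :: q) (bump (size p) i) = nth fset0 (p ++ q) i.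
  by rewrite -!odflt_onth onth_bump.
have [u Eu] := onth_lt j erefl; rewrite Eu.
have ut : u != t by apply: contraNneq tL => <-; apply: mem_onth Eu.
rewrite last_end_merge // (nth_map fset0) // szpq //.
Qed.

Lemma resval_relabel (phi : vert -> vert) (f : sym -> sym) L s :
  injective phi -> phi None = None -> (forall t, phi (Some t) = Some (f t)) ->
  resval (map f L) (relabel phi s) = resval L s.
Proof.
move=> inj phi0 phiS; rewrite (@resvalE (size s)) ?size_relabel // /resval; congr (\det _).
apply/matrixP => i j; rewrite !mxE; congr (nat_of_bool _)%:R.
have rk w : rank (map f L) (phi w) = rank L w.
  rewrite /rank -[RHS](index_map inj); congr index.
  by rewrite /= phi0 -!map_comp; congr (_ :: _); apply: eq_map => t /=.
have -> : onth (map f L) j = omap f (onth L j).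
  by elim: L {rk} (val j) => [|x L IH] [|k] /=.
case: onth => [t|] //=.
rewrite (nth_map fset0) //; apply/last_endP/last_endP => -[te al]; split.
- by move: te; rewrite -phiS => /imfsetP[w /= we /inj ->].
- by move=> w we; rewrite -!rk phiS al //; apply: in_imfset.
- by rewrite -phiS; apply: in_imfset.
by move=> w' /imfsetP[w /= we ->]; rewrite -phiS !rk al.
Qed.

(** So the square of [resval] is one exactly when every vertex of [L] is joined to
    an earlier vertex or to the root, that is, when [L] is a growth order of the
    tree. *)
Lemma resval_sqr L s : size s = size L -> uniq L ->
  resval L s ^+ 2 = (all (fun t => has (fun e => last_end L e t) s) L)%:R.
Proof.
move=> sz u; rewrite (resvalE _ sz) det_bool_mx_sqr; last first.
  move=> i j j'; have [t Et] := onth_lt j erefl; have [t' Et'] := onth_lt j' erefl.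
  rewrite Et Et' => T1 T2; apply: (onth_inj erefl u); rewrite Et Et'.
  by rewrite (last_end_inj (mem_onth Et) T1 T2).
congr (nat_of_bool _)%:R; apply/forallP/allP => [H t tL|H j].
  have [j Ej] := onth_mem erefl tL; have /existsP[i ti] := H j.
  by rewrite Ej in ti; apply/hasP; exists (nth fset0 s i); rewrite // mem_nth // sz.
have [t Et] := onth_lt j erefl; have /hasP[e es te] := H t (mem_onth Et).
have lt : (index e s < size L)%N by rewrite -sz index_mem.
by apply/existsP; exists (Ordinal lt); rewrite Et /= nth_index.
Qed.

End Growth.

(** * Heads of edges and the sign of a tree *)

Section Heads.
Variables (K : fieldType) (r : nat).
Local Notation edge := (edge r).
Local Notation sym := (sym r).
Local Notation vert := (vert r).

Lemma edge_other (e : edge) v w u : #|` e| == 2 -> v \in e -> w \in e -> w != v ->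
  u \in e -> u != v -> u = w :> vert.
Proof.
move=> e2 ve we wv ue uv; have [a [b [ab E]]] := card2P e2.
by move: ve we ue wv uv; rewrite E !inE
  => /orP[]/eqP-> /orP[]/eqP-> /orP[]/eqP->; rewrite ?eqxx // => _; rewrite ?eqxx.
Qed.

Variables (S : {fset sym}) (s : seq edge) (L : seq sym).
Hypotheses (ot : otree S s) (uL : uniq L) (SL : S =i L) (rv0 : resval K L s != 0).

Let pe : {in s, forall e : edge, (#|` e| == 2) && (e `<=` vset S)}.
Proof. by have /otreeP[_ /allP] := ot. Qed.

Lemma size_listing : size s = size L.
Proof.
by have /otreeP[-> _ _] := ot; apply/eqP; rewrite -uniq_size_uniq // => x; apply: SL.
Qed.

Lemma last_end_edge_uniq e e' t : e \in s -> e' \in s ->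
  last_end L e t -> last_end L e' t -> t \in L -> e = e'.
Proof.
move=> es es' te te' tL; apply/eqP; apply: contraNT rv0 => ne.
have lt f : f \in s -> (index f s < size s)%N by rewrite index_mem.
rewrite /resval /last_end_mx (@det_bool_mx_row_eq _ _ _ (Ordinal (lt _ es)) (Ordinal (lt _ es'))) //.
  by apply: contra ne => /eqP[] E; rewrite -(nth_index fset0 es) E nth_index.
move=> j /=; rewrite !nth_index //; case: onth => // u.
by apply/idP/idP => tu; [rewrite -(last_end_inj tL te tu)|rewrite -(last_end_inj tL te' tu)].
Qed.

(** A path from the root to [t] has to pass through the vertex to which [t] is
    attached in the growth order. *)
Lemma parent_ball n t e w : t \in L -> e \in s -> last_end L e t -> w \in e ->
  w != Some t -> Some t \in ball s n -> (0 < n)%N /\ w \in ball s n.-1.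
Proof.
elim: n t e w => [|n IH] t e w tL es te we wt; first by rewrite inE.
have mono m v : v \in ball s m.-1 -> v \in ball s m.
  by apply: (fsubsetP (ball_leq _ (leq_pred _))).
move=> /ballS[/(IH _ _ _ tL es te we wt)[_ /mono]|] //.
move=> [e' es' [te' /meetP[x xe' xb]]]; split=> //=.
have [Ex|xt] := eqVneq x (Some t).
  by rewrite Ex in xb; have [_ /mono] := IH _ _ _ tL es te we wt xb.
have /andP[e2 /fsubsetP sub] := pe es'.
have oth := edge_other e2 te' xe' xt.
have [le|lt] := leqP (rank L x) (rank L (Some t)).
  have Tt : last_end L e' t.
    apply/last_endP; split=> // u ue'; have [->|ut] := eqVneq u (Some t) => //.
    by rewrite (oth u ue' ut).
  have E := last_end_edge_uniq es' es Tt te tL; rewrite E in oth.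
  by rewrite (oth w we wt).
case: x xe' xb xt oth lt => [x|] xe' xb xt oth lt; last by rewrite /rank in lt.
have xL : x \in L by have := sub _ xe'; rewrite in_vset SL.
have Tx : last_end L e' x.
  apply/last_endP; split=> // u ue'; have [->|ut] := eqVneq u (Some t); first exact: ltnW.
  by rewrite (oth u ue' ut).
have tx : Some t != Some x by rewrite eq_sym.
have [_ /mono tb] := IH _ _ _ xL es' Tx te' tx xb.
by have [_ /mono] := IH _ _ _ tL es te we wt tb.
Qed.

Lemma dist_leq v n : (n <= size s)%N -> v \in ball s n -> (dist s v <= n)%N.
Proof.
move=> ns vb; rewrite leqNgt; apply/negP => lt.
by have := before_find 0 lt; rewrite nth_iota ?ltnS // add0n vb.
Qed.

Lemma dist_lt t e w : t \in L -> e \in s -> last_end L e t -> w \in e ->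
  w != Some t -> (dist s w < dist s (Some t))%N.
Proof.
move=> tL es te we wt; have /and3P[_ _ /fsubsetP sub] := ot.
have tb : Some t \in ball s (size s) by apply: sub; rewrite in_vset SL.
have hs : has (fun n => Some t \in ball s n) (iota 0 (size s).+1).
  by apply/hasP; exists (size s); rewrite // mem_iota ltnS leqnn.
have ld : (dist s (Some t) < (size s).+1)%N.
  by rewrite -[X in (_ < X)%N](size_iota 0) -has_find.
have := nth_find 0 hs; rewrite -/(dist s (Some t)) nth_iota // add0n => db.
have [d0 wb] := parent_ball tL es te we wt db.
by rewrite -(ltn_predK d0) ltnS dist_leq // -ltnS (ltn_predK d0) ltnW.
Qed.

(** Distances from the root increase along the edges of a growing tree, so the
    end farther from the root is the one added last. *)
Lemma is_head_last_end e t : t \in L -> e \in s -> is_head s e (Some t) = last_end L e t.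
Proof.
move=> tL es; have /andP[e2 /fsubsetP sub] := pe es.
apply/andP/last_endP => [[te /allP al]|[te al]]; split=> //.
  move=> w we; rewrite leqNgt; apply/negP => lt.
  case: w we lt => [w|] we lt; last by rewrite /rank in lt.
  have wL : w \in L by have := sub _ we; rewrite in_vset SL.
  have tw : Some t != Some w by apply: contraTneq lt => ->; rewrite ltnn.
  have Tw : last_end L e w.
    apply/last_endP; split=> // u ue; have [->|uw] := eqVneq u (Some w) => //.
    by rewrite (edge_other e2 we te tw ue uw) ltnW.
  by have := dist_lt wL es Tw te tw; rewrite ltnNge al.
apply/allP => w we; have [->|wt] := eqVneq w (Some t); first exact: leqnn.
by apply/ltnW/(dist_lt tL es _ we wt)/last_endP.
Qed.

End Heads.

Section Epsilon.
Variables (K : fieldType) (r : nat).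
Local Notation edge := (edge r).
Local Notation sym := (sym r).

Lemma symsP (k : degree r) t : (t \in syms k) = (t.2 < k t.1)%N.
Proof.
case: t => i j; apply/allpairsPdep/idP => /= [[i' [j' [_ + [-> ->]]]]|lt].
  by rewrite mem_iota add0n.
by exists i, j; rewrite mem_enum mem_iota.
Qed.

Lemma syms_uniq (k : degree r) : uniq (syms k).
Proof.
apply: allpairs_uniq_dep; first exact: enum_uniq.
  by move=> i _; apply: iota_uniq.
by move=> [i j] [i' j'] _ _ /= [-> ->].
Qed.

Lemma symset_mem (k : degree r) : symset k =i syms k.
Proof. by move=> t; rewrite !inE. Qed.

(** When [L] is a growth order, the matrix of heads defining epsilon is the product
    of the matrices defining [resval] and [seqsign]; otherwise both sides are
    zero. *)
Lemma resval_epsilon (k : degree r) s L : otree (symset k) s -> perm_eq L (syms k) ->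
  epsilon K k s * resval K L s ^+ 2 = seqsign K L (syms k) * resval K L s.
Proof.
move=> ot pm; have uL : uniq L by rewrite (perm_uniq pm) syms_uniq.
have SL : symset k =i L by move=> t; rewrite symset_mem (perm_mem pm).
have [->|rv0] := eqVneq (resval K L s) 0; first by rewrite expr0n mulr0 mulr0.
have sz := size_listing ot uL SL.
have -> : epsilon K k s = resval K L s * seqsign K L (syms k).
  rewrite /resval (@seqsignE _ _ (size s)) // -det_mulmx (bool_mx_mul_seq K _ (esym sz) uL pm).
  rewrite /epsilon; congr (\det _); apply/matrixP => a b; rewrite !mxE.
  congr (nat_of_bool _)%:R; rewrite -onthE.
  have szk : size (syms k) = size s by rewrite sz (perm_size pm).
  have [t Et] := onth_lt b szk; rewrite Et.
  have tL : t \in L by rewrite (perm_mem pm) (mem_onth Et).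
  by rewrite (is_head_last_end ot SL rv0 tL) // mem_nth.
have -> : resval K L s ^+ 2 = 1.
  by move: rv0; have := resval_sqr K sz uL; case: all => // /eqP; rewrite expf_eq0 /= => ->.
by rewrite mulr1 mulrC.
Qed.

Lemma epsilon_sqr (k : degree r) s L : otree (symset k) s -> perm_eq L (syms k) ->
  resval K L s != 0 -> epsilon K k s ^+ 2 = 1.
Proof.
move=> ot pm rv0; have uL : uniq L by rewrite (perm_uniq pm) syms_uniq.
have SL : symset k =i L by move=> t; rewrite symset_mem (perm_mem pm).
have sz := size_listing ot uL SL.
have E2 : resval K L s ^+ 2 = 1.
  by move: (rv0); have := resval_sqr K sz uL; case: all => // /eqP; rewrite expf_eq0 /= => ->.
have := resval_epsilon ot pm; rewrite E2 mulr1 => ->.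
by rewrite exprMn E2 mulr1 seqsign_sqr.
Qed.

End Epsilon.

(** * Words, listings of symbols and shuffles *)

Section Words.
Variables (K : fieldType) (r : nat).
Local Notation edge := (edge r).
Local Notation sym := (sym r).
Implicit Types (J : seq 'I_r) (L A : seq sym) (k : degree r).

(** [acc] holds the letters already read. *)
Fixpoint label (acc J : seq 'I_r) : seq sym :=
  if J is i :: J' then (i, count_mem i acc) :: label (rcons acc i) J' else [::].

(** The symbols whose residues are taken along the word [J], in order. *)
Definition word_syms J := label [::] J.

Lemma mem_label acc J t : (t \in label acc J) =
  (count_mem t.1 acc <= t.2 < count_mem t.1 (acc ++ J))%N.
Proof.
case: t => i c; elim: J acc => [|j J IH] acc.
  by rewrite cats0 /= in_nil ltnNge andbN.
rewrite /= inE IH cat_rcons /= -cats1 count_cat /= addn0 xpair_eqE.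
rewrite count_cat /= [j == i]eq_sym.
case: eqVneq => [->|_] /=; last by rewrite addn0.
by case: ltngtP => //; lia.
Qed.

Lemma label_colours acc J : map fst (label acc J) = J.
Proof. by elim: J acc => [|i J IH] acc //=; rewrite IH. Qed.

(** Symbols of the same colour are listed in increasing order, so the inversions of
    this listing are those of the word of colours. *)
Lemma label_pairwise acc J :
  pairwise (fun x y : sym => (x.1 == y.1) ==> (x.2 < y.2)%N) (label acc J).
Proof.
elim: J acc => [|i J IH] acc //=; rewrite IH andbT; apply/allP => y.
rewrite mem_label => /andP[le _]; apply/implyP => /= /eqP E.
by move: le; rewrite -E -cats1 count_cat /= eqxx addn1.
Qed.

Lemma word_syms_uniq J : uniq (word_syms J).
Proof.
by apply: pairwise_uniq (label_pairwise _ _) => x; rewrite eqxx ltnn.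
Qed.

Lemma word_syms_perm k J : multiindex k J -> perm_eq (word_syms J) (syms k).
Proof.
move=> /forallP mJ; apply: uniq_perm (word_syms_uniq J) (syms_uniq k) _ => t.
by rewrite mem_label symsP cat0s (eqP (mJ t.1)).
Qed.

Lemma resJE n (J : n.-tuple 'I_r) x : resJ J x = res_seq (word_syms J) x :> trees K r.
Proof.
rewrite /resJ /res_seq.
suff -> : word_syms J = [seq (tnth J a, count_mem (tnth J a) (take a J)) | a <- enum 'I_n].
  by elim: (enum 'I_n) x => //= a l IH x; rewrite IH.
have H acc (s : seq 'I_r) i0 m : (m < size s)%N ->
   nth (i0, 0%N) (label acc s) m =
   (nth i0 s m, count_mem (nth i0 s m) (acc ++ take m s)).
  elim: s acc m => [|i s IH] acc [|m] //= lt; first by rewrite cats0.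
  by rewrite IH // cat_rcons.
have szl acc (s : seq 'I_r) : size (label acc s) = size s.
  by rewrite -{2}(label_colours acc s) size_map.
case: n J => [|n] J; first by rewrite tuple0 enum_ord0.
have i0 := tnth J ord0.
apply: (@eq_from_nth _ (i0, 0%N)).
  by rewrite szl size_map size_enum_ord size_tuple.
move=> m; rewrite szl size_tuple => lt; rewrite H ?size_tuple // cat0s.
rewrite (nth_map ord0) ?size_enum_ord // (tnth_nth i0).
by rewrite nth_enum_ord.
Qed.

(** The order in which [syms] lists the symbols. *)
Definition sym_lt (x y : sym) : bool :=
  (x.1 < y.1)%N || (x.1 == y.1) && (x.2 < y.2)%N.

Lemma sym_lt_irr : irreflexive sym_lt.
Proof. by move=> x; rewrite /sym_lt !ltnn andbF. Qed.

Lemma sym_lt_asym x y : sym_lt x y -> ~~ sym_lt y x.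
Proof.
rewrite /sym_lt -!(inj_eq val_inj) /= eq_sym; case: ltngtP => //= _ lt.
by rewrite -leqNgt ltnW.
Qed.

Lemma enum_ord_pairwise : pairwise (fun i j : 'I_r => i < j)%N (enum 'I_r).
Proof.
rewrite -(pairwise_map val ltn) val_enum_ord -sorted_pairwise; last exact: ltn_trans.
exact: iota_ltn_sorted.
Qed.

Lemma iota_pairwise m n : pairwise ltn (iota m n).
Proof.
by rewrite -sorted_pairwise; [exact: iota_ltn_sorted | exact: ltn_trans].
Qed.

Lemma syms_pairwise k : pairwise sym_lt (syms k).
Proof.
rewrite /syms; elim: (enum 'I_r) enum_ord_pairwise => [|i l IH] //= /andP[al pl].
rewrite pairwise_cat IH // andbT; apply/andP; split.
  apply/allrelP => x y /mapP[j _ ->] /allpairsPdep[i' [j' [/(allP al) lt _ ->]]].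
  by rewrite /sym_lt /= lt.
rewrite (pairwise_map (pair i) sym_lt); apply: sub_pairwise (iota_pairwise _ _) => x y /= lt.
by rewrite /sym_lt /= eqxx lt orbT.
Qed.

Lemma seqsign_word k J : multiindex k J ->
  seqsign K (word_syms J) (syms k) = (-1) ^+ inversions J.
Proof.
move=> mJ; rewrite (seqsign_nb_inv K sym_lt_irr sym_lt_asym (syms_pairwise k)
  (word_syms_perm mJ)); congr (_ ^+ _).
rewrite /word_syms; elim: J [::] {mJ} => [|i J IH] acc //=; rewrite IH; congr (_ + _)%N.
have /andP[/allP al _] := label_pairwise acc (i :: J).
rewrite -[in RHS](label_colours (rcons acc i) J) count_map.
apply: eq_in_count => y /al /=; rewrite /sym_lt /=.
by case: eqVneq => [<-|_]; rewrite ?orbF // => /= lt; rewrite ltnn /= ltnNge ltnW.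
Qed.

Lemma nb_inv_cat (T : eqType) (lt : rel T) (B C : seq T) :
  (forall x y, x \in B -> y \in C -> ~~ lt y x) ->
  nb_inv lt (B ++ C) = (nb_inv lt B + nb_inv lt C)%N.
Proof.
elim: B => [|x B IH] H //=; rewrite IH => [|y z yB]; last first.
  by apply: H; rewrite inE yB orbT.
rewrite count_cat [X in (_ + X + _)%N](@eq_in_count _ _ pred0).
  by rewrite count_pred0 addn0 addnA.
by move=> y yC; apply/negbTE/H; rewrite ?mem_head.
Qed.

Lemma nb_inv_map (T T' : eqType) (lt : rel T) (lt' : rel T') (f : T' -> T) (B : seq T') :
  (forall x y, lt (f x) (f y) = lt' x y) -> nb_inv lt (map f B) = nb_inv lt' B.
Proof.
move=> H; elim: B => [|x B IH] //=; rewrite IH count_map; congr (_ + _)%N.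
by apply: eq_count => y /=; rewrite H.
Qed.

Section Perm.
Variable k : degree r.
Implicit Types pi : symgroup k.

Definition permidx pi i (j : nat) : nat :=
  if insub j is Some j' then val (pi i j') else j.

Definition permsym pi (t : sym) : sym := (t.1, permidx pi t.1 t.2).

Lemma permv_sym pi t : permv pi (Some t) = Some (permsym pi t).
Proof. by case: t. Qed.

Lemma permsym_inj pi : injective (permsym pi).
Proof.
move=> t u E; suff [] : Some t = Some u by [].
by apply: (@permv_inj _ _ pi); rewrite !permv_sym E.
Qed.

Lemma permidxE pi i (j : 'I_(k i)) : permidx pi i (val j) = val (pi i j).
Proof. by rewrite /permidx valK. Qed.

Lemma permsym_syms pi t : (permsym pi t \in syms k) = (t \in syms k).
Proof.
case: t => i j; rewrite !symsP /=; have [lt|ge] := ltnP j (k i).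
  by rewrite -[j]/(val (Ordinal lt)) permidxE ltn_ord.
by rewrite /permidx insubF // ?ltnNge ?ge.
Qed.

Lemma perm_syms pi : perm_eq (map (permsym pi) (syms k)) (syms k).
Proof.
have u : uniq (map (permsym pi) (syms k)).
  by rewrite map_inj_uniq ?syms_uniq //; apply: permsym_inj.
apply: uniq_perm (syms_uniq k) _ => //.
apply: (uniq_min_size u _ _).2; last by rewrite size_map.
by move=> t /mapP[t' t'k ->]; rewrite permsym_syms.
Qed.

Lemma seqsign_permidx pi i :
  (-1) ^+ nb_inv ltn (map (permidx pi i) (iota 0 (k i))) = (-1) ^+ (pi i : 'S_(k i)) :> K.
Proof.
have E : map (permidx pi i) (iota 0 (k i)) = map val (map (pi i) (enum 'I_(k i))).
  rewrite -val_enum_ord -!map_comp; apply: eq_map => j /=; exact: permidxE.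
have pm : perm_eq (map (permidx pi i) (iota 0 (k i))) (iota 0 (k i)).
  rewrite E -val_enum_ord; apply: perm_map; apply: uniq_perm.
  - by rewrite map_inj_uniq ?enum_uniq //; apply: perm_inj.
  - exact: enum_uniq.
  move=> j; rewrite mem_enum; apply/mapP; exists ((pi i)^-1%g j); rewrite ?mem_enum //.
  by rewrite permKV.
rewrite -(seqsign_nb_inv K ltnn _ (iota_pairwise _ _) pm); last first.
  by move=> x y lt; rewrite -leqNgt ltnW.
rewrite (@seqsignE _ _ (k i)) ?size_map ?size_iota // -det_perm; congr (\det _).
apply/matrixP => a c; rewrite !mxE; congr (nat_of_bool _)%:R.
rewrite !onthE E -map_comp -map_comp (nth_map a) ?size_enum_ord //=.
rewrite (nth_map 0%N) ?size_iota // nth_iota // add0n nth_ord_enum.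
by rewrite (inj_eq (@Some_inj _)).
Qed.

(** Symbols of different colours create no inversion, so the inversions add up over
    the colours. *)
Lemma seqsign_permsym pi :
  seqsign K (map (permsym pi) (syms k)) (syms k) = sgnG K pi.
Proof.
rewrite (seqsign_nb_inv K sym_lt_irr sym_lt_asym (syms_pairwise k) (perm_syms pi)).
rewrite /sgnG -big_enum /= /syms.
elim: (enum 'I_r) enum_ord_pairwise => [|i l IH] /=.
  by rewrite big_nil.
move=> /andP[al pl]; rewrite map_cat nb_inv_cat.
  rewrite exprD IH // big_cons; congr (_ * _); rewrite -seqsign_permidx.
  rewrite -map_comp -(@nb_inv_map _ _ sym_lt ltn (pair i)) -?map_comp //.
  by move=> x y; rewrite /sym_lt /= ltnn eqxx.
move=> x y /mapP[_ /mapP[j _ ->] ->] /mapP[_ /allpairsPdep[i' [j' [/(allP al) lt _ ->]]] ->].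
by apply: sym_lt_asym; rewrite /sym_lt /= lt.
Qed.

Lemma seqsign_map_word pi J : multiindex k J ->
  seqsign K (map (permsym pi) (word_syms J)) (syms k) =
  (-1) ^+ inversions J * sgnG K pi.
Proof.
move=> mJ; rewrite -(@seqsign_mul K _ _ (map (permsym pi) (syms k))).
- by rewrite (seqsign_map _ _ _ (@permsym_inj pi)) seqsign_word // seqsign_permsym.
- by rewrite (perm_uniq (perm_syms pi)) syms_uniq.
- by apply/perm_map/word_syms_perm.
exact: perm_syms.
Qed.

End Perm.

(** The orderings of [A] in which the colours of the symbols form the word [J]. *)
Fixpoint listings A J : seq (seq sym) :=
  if J is i :: J' then
    [seq t :: L | t <- [seq t <- A | t.1 == i], L <- listings (rem t A) J']
  else if A is [::] then [:: [::]] else [::].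

Lemma listingsP A J L : (L \in listings A J) = perm_eq L A && (map fst L == J).
Proof.
elim: J A L => [|i J IH] A L /=.
  case: A => [|t A]; first by rewrite inE; case: L => [|u L] /=; rewrite ?andbF.
  by rewrite in_nil; case: L => [|u L] /=; rewrite ?andbF ?andbT //; apply/esym/negbTE/negP => /perm_size.
apply/allpairsPdep/andP => [[t [L' [+ + ->]]]|].
  rewrite mem_filter IH => /andP[/eqP <- tA] /andP[pm /eqP <-]; split=> //.
  by rewrite perm_sym (permPl (perm_to_rem tA)) perm_cons perm_sym.
case: L => [|t L] [pm /eqP] //= [Ei EJ].
have tA : t \in A by rewrite -(perm_mem pm) mem_head.
exists t, L; rewrite mem_filter Ei eqxx IH EJ eqxx andbT; split=> //.
by rewrite -(perm_cons t) (permPl pm) perm_to_rem.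
Qed.

Lemma listings_uniq A J : uniq A -> uniq (listings A J).
Proof.
elim: J A => [|i J IH] A uA /=; first by case: A uA.
apply: allpairs_uniq_dep.
- by rewrite filter_uniq.
- by move=> t _; apply/IH/rem_uniq.
by move=> [t L] [t' L'] _ _ /= [-> ->].
Qed.

Lemma map_nth_index (T : eqType) (w l : seq T) : uniq w -> size l = size w ->
  map (fun t => nth t l (index t w)) w = l.
Proof.
case: w => [|t w] uw sz; first by case: l sz.
apply: (@eq_from_nth _ t); rewrite size_map ?sz // => m lt.
by rewrite (nth_map t) // index_uniq // (set_nth_default t) ?sz.
Qed.

(** The group acts simply transitively on the listings with given colours. *)
Lemma sum_symgroup (V : nmodType) k J (F : seq sym -> V) : multiindex k J ->
  \sum_(pi : symgroup k) F (map (permsym pi) (word_syms J)) =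
  \sum_(L <- listings (syms k) J) F L.
Proof.
move=> mJ; have pw := word_syms_perm mJ.
have wmem t : (t \in word_syms J) = (t \in syms k) by rewrite (perm_mem pw).
rewrite -big_enum -(big_map (fun pi : symgroup k => map (permsym pi) (word_syms J)) predT) /=.
apply: perm_big; apply: uniq_perm.
- rewrite map_inj_uniq ?enum_uniq // => pi pi' /eq_in_map E.
  apply/ffunP => i; apply/permP => j; apply: val_inj => /=.
  have /E[] : (i, val j) \in word_syms J by rewrite wmem symsP /= ltn_ord.
  by rewrite !permidxE.
- exact/listings_uniq/syms_uniq.
move=> L; rewrite listingsP; apply/mapP/andP => [[pi _ ->]|[pm /eqP cL]].
  split; last by rewrite -map_comp (eq_map (g := fst)) // label_colours.
  apply: perm_trans (perm_syms pi); exact: perm_map.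
have szL : size L = size (word_syms J).
  by rewrite (perm_size pm) (perm_size pw).
(* The symbol of [L] at the position of [t] in the standard listing. *)
pose g t := nth t L (index t (word_syms J)).
have uL : uniq L by rewrite (perm_uniq pm) syms_uniq.
have gE t : t \in word_syms J -> (g t).1 = t.1.
  move=> tw; rewrite /g -(nth_map _ t.1 fst) ?szL ?index_mem // cL.
  by rewrite -{1}(label_colours [::] J) (nth_map t) ?index_mem // nth_index.
have gS t : t \in word_syms J -> g t \in syms k.
  by move=> tw; rewrite -(perm_mem pm) mem_nth // szL index_mem.
have g_inj : {in word_syms J &, injective g}.
  move=> t u tw uw /eqP; rewrite /g (set_nth_default t) ?szL ?index_mem //.
  rewrite nth_uniq ?szL ?index_mem // => /eqP E.
  by rewrite -(nth_index t tw) E nth_index.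
have wj i (j : 'I_(k i)) : (i, val j) \in word_syms J by rewrite wmem symsP /= ltn_ord.
have gl i (j : 'I_(k i)) : ((g (i, val j)).2 < k i)%N.
  by have := gS _ (wj i j); rewrite symsP gE.
have f_inj i : injective (fun j : 'I_(k i) => Ordinal (gl i j)).
  move=> j j' [] E; suff [] : (i, val j) = (i, val j') by move=> /val_inj.
  by apply: g_inj => //; rewrite [LHS]surjective_pairing [RHS]surjective_pairing E !gE.
exists [ffun i => perm (f_inj i)]; first by rewrite mem_enum.
rewrite -(map_nth_index (word_syms_uniq J) szL) -/g.
apply/eq_in_map => -[i j] tw; have := tw; rewrite wmem symsP /= => lt.
rewrite /permsym /= -[j]/(val (Ordinal lt)) permidxE ffunE permE /=.
by rewrite [LHS]surjective_pairing gE.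
Qed.

(** The sum of [G a b] over all ways of splitting [J] into complementary subwords
    [a] and [b]. This is evaluation on the coproduct of [J] for which all letters
    are primitive. *)
Fixpoint shuf (T : Type) (V : nmodType) (J : seq T) (G : seq T -> seq T -> V) : V :=
  if J is i :: J' then
    shuf J' (fun a b => G (i :: a) b) + shuf J' (fun a b => G a (i :: b))
  else G [::] [::].

Lemma eq_shuf (T : Type) (V : nmodType) (J : seq T) (G G' : seq T -> seq T -> V) :
  (forall a b, G a b = G' a b) -> shuf J G = shuf J G'.
Proof.
by elim: J G G' => [|i J IH] G G' E //=; congr (_ + _); apply: IH.
Qed.

Lemma shuf0 (T : Type) (V : nmodType) (J : seq T) : shuf J (fun _ _ => 0 : V) = 0.
Proof. by elim: J => [|i J IH] //=; rewrite IH addr0. Qed.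

Lemma shufD (T : Type) (V : nmodType) (J : seq T) (G G' : seq T -> seq T -> V) :
  shuf J (fun a b => G a b + G' a b) = shuf J G + shuf J G'.
Proof. by elim: J G G' => [|i J IH] G G' //=; rewrite !IH addrACA. Qed.

Lemma shuf_sum (T I : Type) (V : nmodType) (J : seq T) (l : seq I) (P : pred I)
   (G : I -> seq T -> seq T -> V) :
  shuf J (fun a b => \sum_(x <- l | P x) G x a b) = \sum_(x <- l | P x) shuf J (G x).
Proof.
elim: l => [|x l IH].
  by rewrite big_nil -[RHS](shuf0 V J); apply: eq_shuf => a b; rewrite big_nil.
rewrite big_cons -IH; case: ifP => Px; last first.
  by apply: eq_shuf => a b; rewrite big_cons Px.
by rewrite -shufD; apply: eq_shuf => a b; rewrite big_cons Px.
Qed.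

Lemma rem_cat_r (T : eqType) (x : T) (A1 A2 : seq T) :
  rem x (A1 ++ A2) = if x \in A1 then rem x A1 ++ A2 else A1 ++ rem x A2.
Proof.
elim: A1 => [|y A1 IH] //=; rewrite inE eq_sym; case: eqP => //= _.
by rewrite IH; case: ifP.
Qed.

(** A listing of a disjoint union amounts to a splitting of the word of colours
    together with a listing of each part. *)
Lemma sum_listings_cat (V : nmodType) (P : pred sym) A1 A2 J
    (F : seq sym -> seq sym -> V) :
  all P A1 -> all (predC P) A2 ->
  \sum_(L <- listings (A1 ++ A2) J) F (filter P L) (filter (predC P) L) =
  shuf J (fun a b => \sum_(L1 <- listings A1 a) \sum_(L2 <- listings A2 b) F L1 L2).
Proof.
elim: J A1 A2 F => [|i J IH] A1 A2 F al1 al2 /=.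
  case: A1 A2 {al1 al2} => [|? ?] [|? ?] /=; by do 2 rewrite ?big_seq1 ?big_nil.
rewrite big_allpairs_dep /= filter_cat big_cat /=; congr (_ + _).
  under [RHS]eq_shuf => a b do rewrite big_allpairs_dep /=.
  rewrite shuf_sum; apply: eq_big_seq => t; rewrite mem_filter => /andP[_ tA].
  rewrite rem_cat_r tA -(IH _ _ (fun L1 L2 => F (t :: L1) L2)) //; last first.
    by apply/allP => u /mem_rem; apply: (allP al1).
  by apply: eq_bigr => L _ /=; rewrite (allP al1 _ tA).
under [RHS]eq_shuf => a b.
  under eq_bigr => L1 _ do rewrite big_allpairs_dep /=.
  rewrite exchange_big /=; over.
rewrite shuf_sum; apply: eq_big_seq => t; rewrite mem_filter => /andP[_ tA].
have nP := allP al2 _ tA; have tA1 : t \notin A1.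
  by apply: contraL nP => /(allP al1) /=; rewrite negbK.
rewrite rem_cat_r (negbTE tA1) -(IH _ _ (fun L1 L2 => F L1 (t :: L2))) //; last first.
  by apply/allP => u /mem_rem; apply: (allP al2).
by apply: eq_bigr => L _ /=; move: nP => /= /negbTE ->.
Qed.

End Words.

(** * Pairing of words with antisymmetrized trees *)

Lemma index_filter_leq (T : eqType) (P : pred T) (s : seq T) x y : P x -> P y ->
  (index x (filter P s) <= index y (filter P s))%N = (index x s <= index y s)%N.
Proof.
move=> Px Py; elim: s => [|z s IH] //=; case: ifP => Pz /=.
  by case: eqP => // _; case: eqP.
have zx : z != x by apply: contraFneq Pz => ->.
have zy : z != y by apply: contraFneq Pz => ->.
by rewrite (negbTE zx) (negbTE zy) IH.
Qed.

Section Pairing.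
Variables (K : fieldType) (r : nat).
Local Notation edge := (edge r).
Local Notation sym := (sym r).
Local Notation trees := (trees K r).
Local Notation tree := (@tree K r).
Implicit Types (J : seq 'I_r) (L A : seq sym) (k l : degree r).

(** The pairing of words with trees as a linear form, defined on all trees. *)
Definition pair_word J (x : trees) : K^o :=
  (-1) ^+ inversions J *: root_coef (res_seq (word_syms J) x).

Lemma pair_word_linear J : linear (pair_word J).
Proof.
move=> c x y; rewrite /pair_word (res_seq_linear (word_syms J) c x y) (root_coef_linear c).
by rewrite scalerDr !scalerA mulrC.
Qed.

HB.instance Definition _ J := GRing.isLinear.Build K trees K^o _ (pair_word J) (pair_word_linear J).

Lemma root_coef_T0 : root_coef (T0 K r) = 1.
Proof. by rewrite root_coef_tree. Qed.

Lemma root_coefZ c : root_coef (c *: T0 K r) = c :> K.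
Proof. by rewrite linearZ /= root_coef_T0; apply: mulr1. Qed.

Lemma pairing_pair_word n (J : n.-tuple 'I_r) x c : pairing J x c -> pair_word J x = c :> K.
Proof.
rewrite /pairing /pair_word resJE => E.
transitivity (root_coef ((-1) ^+ inversions J *: res_seq (word_syms J) x)).
  by rewrite linearZ.
by rewrite E root_coefZ.
Qed.

Lemma otree_permv k (pi : symgroup k) s :
  otree (symset k) s -> otree (symset k) (relabel (permv pi) s).
Proof.
apply: otree_relabel => //; first exact: permv_inj.
apply/eqP; rewrite eq_sym eqEfcard (card_imfset _ _ (@permv_inj _ _ pi)) leqnn andbT.
apply/fsubsetP => v /imfsetP[[t|] tS ->] //.
have : Some t \in vset (symset k) := tS.
by rewrite permv_sym !in_vset !symset_mem permsym_syms.
Qed.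

Lemma symset_word k J : multiindex k J -> symset k =i word_syms J.
Proof.
by move=> mJ t; rewrite symset_mem (perm_mem (word_syms_perm mJ)).
Qed.

(** The number of growth orders of the tree [s] with colours [J]. *)
Definition growths k s J : K := \sum_(L <- listings (syms k) J) resval K L s ^+ 2.

Lemma multiindexE k J : multiindex k J = perm_eq J (map fst (syms k)).
Proof.
have cs i : count_mem i (map fst (syms k)) = k i.
  rewrite count_map -size_filter.
  have -> : [seq t <- syms k | preim fst (pred1 i) t] = [seq (i, j) | j <- iota 0 (k i)] :> seq sym.
    rewrite /syms; elim: (enum 'I_r) (mem_enum 'I_r i) (enum_uniq 'I_r) => [|i' l0 IH] //=.
    rewrite inE filter_cat => + /andP[il' ul].
    have fn (i0 : 'I_r) : [seq t <- [seq (i0, j) | j <- iota 0 (k i0)] | preim fst (pred1 i) t] =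
       if i0 == i then [seq (i0, j) | j <- iota 0 (k i0)] else [::] :> seq sym.
      by rewrite filter_map; case: eqP => [->|ne];
        [rewrite (@eq_filter _ _ predT) ?filter_predT // => j /=; rewrite eqxx
        |rewrite (@eq_filter _ _ pred0) ?filter_pred0 // => j /=; case: eqP].
    rewrite fn eq_sym; case: eqVneq => [E _|ne /= il]; last by rewrite IH.
    have -> : [seq t <- [seq (i0, j) | i0 <- l0, j <- iota 0 (k i0)] | preim fst (pred1 i) t] = [::] :> seq sym.
      apply/eqP; rewrite -[_ == _]negbK -has_filter; apply/hasPn => t.
      move=> /allpairsPdep[i0 [j [il0 _ ->]]] /=; apply: contraNneq il' => E0.
      by rewrite E -E0.
    by rewrite cats0 E.
  by rewrite size_map size_iota.
apply/forallP/idP => [H|/seq.permP H i]; last by rewrite H cs.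
apply/allP => i _; rewrite /= cs; exact: H.
Qed.

Lemma listings_nil k J : ~~ multiindex k J -> listings (syms k) J = [::].
Proof.
move=> nJ; apply/eqP; rewrite -size_eq0; apply: contraNT nJ.
case: (listings _ _) (fun L => listingsP (syms k) J L) => [|L s] //= H _.
have := H L; rewrite mem_head => /esym/andP[pm /eqP <-].
by rewrite multiindexE perm_map.
Qed.

(** Antisymmetrizing a tree sums its residues over all listings with colours [J].
    Each growth order contributes the sign of the listing times the sign of the
    residue, which is epsilon by [resval_epsilon]. *)
Lemma pair_word_ASym k s J : otree (symset k) s -> multiindex k J ->
  pair_word J (ASym k (tree s)) = epsilon K k s * growths k s J.
Proof.
move=> ot mJ; rewrite /ASym linear_sum /= /growths mulr_sumr -(sum_symgroup _ mJ).
(* Moving the permutation from the tree to the listing inverts it. *)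
rewrite (reindex_inj (h := @pinv r k)) /=; last first.
  by move=> p q E; apply/ffunP => i; have /ffunP/(_ i) := E; rewrite !ffunE => /invg_inj.
apply: eq_bigr => pi _; rewrite linearZ /= perm_act_tree.
have pm : perm_eq (map (permsym pi) (word_syms J)) (syms k).
  by apply: perm_trans (perm_syms pi); apply/perm_map/word_syms_perm.
rewrite (resval_epsilon K ot pm) seqsign_map_word //.
have -> : sgnG K (pinv pi) = sgnG K pi.
  by apply: eq_bigr => i _; rewrite ffunE odd_permV.
rewrite /pair_word (res_seq_tree K (otree_permv _ ot) (word_syms_uniq J) (symset_word mJ)).
rewrite root_coefZ.
rewrite -(@resval_relabel K r _ _ (map (permsym pi) (word_syms J)) s
  (@permv_inj r k (pinv pi)) erefl (permv_sym (pinv pi))).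
rewrite -map_comp map_id_in; last first.
  move=> [i j] tw; rewrite /= /permsym /= /permidx.
  have lt : (j < k i)%N by move: tw; rewrite -(symset_word mJ) symset_mem symsP.
  by rewrite -[j]/(val (Ordinal lt)) !valK ffunE permK.
by rewrite [X in _ = X * _]mulrC -mulrA.
Qed.


Lemma growths0 k s J : ~~ multiindex k J -> growths k s J = 0.
Proof. by move=> nJ; rewrite /growths listings_nil // big_nil. Qed.

(** A vertex on no edge could be removed from the set of all vertices without
    destroying closedness. *)
Lemma otree_cover (S : {fset sym}) (s : seq edge) t : otree S s ->
  (Some t \in \bigcup_(e <- s) e) = (t \in S).
Proof.
move=> ot; have /otreeP[_ /allP pe cn] := ot; apply/idP/idP.
  move=> /bigfcupP[e /andP[es _] te].
  by have /andP[_ /fsubsetP/(_ _ te)] := pe e es; rewrite in_vset.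
move=> tS; apply: contraT => nt.
have tv : Some t \in vset S by rewrite in_vset.
have B0 : None \in vset S `\ Some t by rewrite in_fsetD1 in_vset.
have cl : edge_closed s (vset S `\ Some t).
  move=> e es _; apply/fsubsetP => w we; rewrite in_fsetD1.
  have -> : w != Some t.
    by apply: contraNneq nt => <-; apply/bigfcupP; exists e; rewrite ?es.
  by have /andP[_ /fsubsetP] := pe e es; apply.
by have /fsubsetP/(_ _ tv) := cn _ B0 cl; rewrite in_fsetD1 eqxx.
Qed.

Lemma otree_tdeg k s : otree (symset k) s -> tdeg s = k.
Proof.
move=> ot; apply/ffunP => i; rewrite ffunE -size_filter.
set p := fun v => _; set B := \bigcup_(e <- s) e.
have -> : k i = size [seq Some (i, j) : vert r | j <- iota 0 (k i)].
  by rewrite size_map size_iota.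
apply: perm_size; apply: uniq_perm.
- exact/filter_uniq/fset_uniq.
- by rewrite map_inj_uniq ?iota_uniq // => j j' [].
move=> v; rewrite mem_filter; apply/andP/mapP => [[]|[j]].
  case: v => [[i' j]|] //= /eqP-> vB.
  have : Some (i, j) \in B by [].
  rewrite (otree_cover _ ot) symset_mem symsP /= => lt.
  by exists j; rewrite ?mem_iota.
rewrite mem_iota /= => lt ->; split; first exact: eqxx.
suff : Some (i, j) \in B by [].
by rewrite (otree_cover _ ot) symset_mem symsP.
Qed.

Lemma otree_symset_eq k S s : otree (symset k) s -> otree S s -> symset k = S.
Proof.
by move=> o1 o2; apply/fsetP => t; rewrite -(otree_cover t o1) (otree_cover t o2).
Qed.

(** The renaming of the symbols of the second factor in the star product. *)
Definition shiftsym k (t : sym) : sym := (t.1, (k t.1 + t.2)%N).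

Lemma shiftv_sym k t : shiftv k (Some t) = Some (shiftsym k t).
Proof. by case: t. Qed.

Lemma shiftsym_inj k : injective (shiftsym k).
Proof. by move=> [i j] [i' j'] [/= -> /addnI ->]. Qed.

Lemma shiftv_inj k : injective (shiftv k).
Proof.
by case=> [[i j]|] [[i' j']|] //= [-> /addnI ->].
Qed.

Lemma degD k l i : (k + l) i = (k i + l i)%N.
Proof. by rewrite ffunE. Qed.

Lemma syms_add k l :
  perm_eq (syms (k + l)) (syms k ++ map (shiftsym k) (syms l)).
Proof.
have nin t : t \in map (shiftsym k) (syms l) -> t \notin syms k.
  by move=> /mapP[u _ ->]; rewrite symsP /= -leqNgt leq_addr.
apply: uniq_perm; first exact: syms_uniq.
  rewrite cat_uniq !(syms_uniq, map_inj_uniq (@shiftsym_inj k)) andbT /=.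
  by apply/hasPn => t /nin.
move=> t; rewrite mem_cat !symsP degD; case: (ltnP t.2 (k t.1)) => [lt|ge] /=.
  by rewrite ltn_addr.
apply/idP/mapP => [lt|[u + ->]]; last by rewrite symsP /= ltn_add2l.
exists (t.1, t.2 - k t.1)%N; first by rewrite symsP /= ltn_subLR.
by case: t ge {lt} => i j /= ge; rewrite /shiftsym /= subnKC.
Qed.

Lemma otree_star k l s1 s2 : otree (symset k) s1 -> otree (symset l) s2 ->
  otree (symset (k + l)) (s1 ++ relabel (shiftv k) s2).
Proof.
move=> o1 o2; pose S2 := [fset shiftsym k t | t in symset l].
have memS2 t : (t \in S2) = (t \in map (shiftsym k) (syms l)).
  apply/imfsetP/mapP => -[u /= ul ->]; exists u; rewrite ?symset_mem //.
  by rewrite -symset_mem.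
have o2' : otree S2 (relabel (shiftv k) s2).
  apply: otree_relabel o2 => //; first exact: shiftv_inj.
  apply/fsetP => v; rewrite in_vset; apply/idP/imfsetP => [|[[t|] tS ->] //].
    case: v => [t|_]; last by exists None; rewrite //= in_vset.
    rewrite memS2 => /mapP[u ul ->]; exists (Some u); last by rewrite shiftv_sym.
    by rewrite /= in_vset symset_mem.
  have : Some t \in vset (symset l) := tS.
  by rewrite in_vset shiftv_sym memS2 symset_mem => ?; apply: map_f.
have -> : symset (k + l) = symset k `|` S2.
  apply/fsetP => t; rewrite in_fsetU memS2 !symset_mem (perm_mem (syms_add k l)).
  by rewrite mem_cat.
apply: otree_glue => //; apply/fdisjointP => t.
rewrite memS2 symset_mem => tk; apply/negP => /mapP[u _ E].
by move: tk; rewrite E symsP /= -[X in (_ < X)%N]addn0 ltn_add2l.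
Qed.

Lemma last_end_filter (P : pred sym) S L (e : edge) t :
  e `<=` vset S -> {subset S <= P} -> P t ->
  last_end L e t = last_end (filter P L) e t.
Proof.
move=> /fsubsetP sub SP Pt; pose Q (v : vert r) := if v is Some t then P t else true.
have rk (v w : vert r) : Q v -> Q w ->
    (rank (filter P L) v <= rank (filter P L) w)%N = (rank L v <= rank L w)%N.
  move=> Qv Qw; rewrite /rank.
  have -> : None :: map Some (filter P L) = filter Q (None :: map Some L).
    by rewrite /= filter_map.
  by rewrite index_filter_leq.
have Qe w : w \in e -> Q w.
  by move=> /sub; rewrite in_vset; case: w => // u /SP.
by apply/last_endP/last_endP => -[te al]; split=> // w we; have := al w we; rewrite rk // Qe.
Qed.

(** A listing is a growth order of two trees glued at the root exactly when its
    restriction to each of the trees is a growth order of that tree. *)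
Lemma resval_sqr_cat (P : pred sym) S1 S2 (s1 s2 : seq edge) L :
  pair_edges S1 s1 -> pair_edges S2 s2 -> {subset S1 <= P} -> {subset S2 <= predC P} ->
  uniq L -> size s1 = size (filter P L) -> size s2 = size (filter (predC P) L) ->
  resval K L (s1 ++ s2) ^+ 2 =
  resval K (filter P L) s1 ^+ 2 * resval K (filter (predC P) L) s2 ^+ 2.
Proof.
move=> pe1 pe2 SP1 SP2 uL sz1 sz2.
rewrite !resval_sqr ?filter_uniq //; last first.
  by rewrite size_cat sz1 sz2 !size_filter count_predC.
rewrite -natrM mulnb; congr (nat_of_bool _)%:R.
have sub (S : {fset sym}) s e : pair_edges S s -> e \in s -> e `<=` vset S.
  by move=> /allP pe /pe/andP[].
have no (S : {fset sym}) (Q : pred sym) s e t : pair_edges S s -> {subset S <= Q} -> e \in s -> ~~ Q t ->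
    ~~ last_end L e t.
  move=> pe SQ /(sub _ _ _ pe)/fsubsetP se nQ; apply: contra nQ => /andP[/se + _].
  by rewrite in_vset => /SQ.
rewrite !all_filter -all_predI; apply: eq_in_all => t tL /=; rewrite has_cat.
have [Pt|Pt] /= := boolP (P t).
  rewrite [X in _ || X](_ : _ = false) ?orbF ?andbT; last first.
    by apply/hasPn => e es; apply: no pe2 SP2 es _; rewrite /= negbK.
  by apply: eq_in_has => e es; apply: last_end_filter (sub _ _ _ pe1 es) SP1 Pt.
rewrite [X in X || _](_ : _ = false) /=; last first.
  by apply/hasPn => e es; apply: no pe1 SP1 es Pt.
by apply: eq_in_has => e es; apply: last_end_filter (sub _ _ _ pe2 es) SP2 Pt.
Qed.

End Pairing.

(** * The star product is dual to the shuffle coproduct *)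

Section Star.
Variables (K : numFieldType) (r : nat).
Local Notation edge := (edge r).
Local Notation sym := (sym r).
Local Notation trees := (trees K r).
Local Notation tree := (@tree K r).
Implicit Types (J : seq 'I_r) (L A : seq sym) (k l : degree r).

Lemma rem_map (T T' : eqType) (f : T -> T') (x : T) (s : seq T) : injective f ->
  rem (f x) (map f s) = map f (rem x s).
Proof. by move=> inj; elim: s => //= y s IH; rewrite (inj_eq inj) IH; case: eqP. Qed.

Lemma sum_listings_map (V : nmodType) (f : sym -> sym) A J (F : seq sym -> V) :
  injective f -> (forall t, (f t).1 = t.1) ->
  \sum_(L <- listings (map f A) J) F L = \sum_(L <- listings A J) F (map f L).
Proof.
move=> inj f1; elim: J A F => [|i J IH] A F /=.
  by case: A => [|t A]; rewrite ?big_nil // !big_seq1.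
rewrite !big_allpairs_dep filter_map big_map /= (eq_filter (a2 := fun t => t.1 == i)).
  by apply: eq_bigr => t _; rewrite rem_map // (IH _ (fun L => F (f t :: L))).
by move=> t /=; rewrite f1.
Qed.

Lemma growths_star k l s1 s2 J : otree (symset k) s1 -> otree (symset l) s2 ->
  growths K (k + l) (s1 ++ relabel (shiftv k) s2) J =
  shuf J (fun a b => growths K k s1 a * growths K l s2 b).
Proof.
move=> o1 o2; have /otreeP[z1 pe1 _] := o1; have /otreeP[z2 pe2 _] := o2.
have szs k' : #|` symset k'| = size (syms k').
  by rewrite /symset card_fseq undup_id ?syms_uniq.
pose P t := t \in syms k; pose S2 := [fset shiftsym k t | t in symset l].
have al1 : all P (syms k) by apply/allP.
have al2 : all (predC P) (map (shiftsym k) (syms l)).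
  by apply/allP => t /mapP[u _ ->]; rewrite /= /P symsP /= -leqNgt leq_addr.
have pe2' : pair_edges S2 (relabel (shiftv k) s2).
  apply/allP => e' /relabelP[e es ->]; have /andP[e2 /fsubsetP se] := allP pe2 e es.
  rewrite (card_imfset _ _ (@shiftv_inj _ k)) e2 /=; apply/fsubsetP => v /imfsetP[[t|] te ->]; last by rewrite in_vset.
  have := se _ te; rewrite shiftv_sym !in_vset => tl; exact: in_imfset.
rewrite /growths.
transitivity (\sum_(L <- listings (syms k ++ map (shiftsym k) (syms l)) J)
   resval K L (s1 ++ relabel (shiftv k) s2) ^+ 2).
  apply/perm_big/uniq_perm.
  - exact/listings_uniq/syms_uniq.
  - by apply: listings_uniq; rewrite -(perm_uniq (syms_add k l)) syms_uniq.
  by move=> L; rewrite !listingsP (permPr (syms_add k l)).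
pose F L1 L2 := resval K L1 s1 ^+ 2 * resval K L2 (relabel (shiftv k) s2) ^+ 2.
transitivity (\sum_(L <- listings (syms k ++ map (shiftsym k) (syms l)) J)
   F (filter P L) (filter (predC P) L)).
  apply: eq_big_seq => L; rewrite listingsP => /andP[pm _].
  have uL : uniq L by rewrite (perm_uniq pm) -(perm_uniq (syms_add k l)) syms_uniq.
  have p1 : perm_eq (filter P L) (syms k).
    apply: perm_trans (perm_filter P pm) _; rewrite filter_cat.
    rewrite (all_filterP al1) -[X in perm_eq _ X]cats0 perm_cat2l.
    by rewrite (eq_in_filter (a2 := pred0)) ?filter_pred0 // => t /(allP al2)/negbTE.
  have p2 : perm_eq (filter (predC P) L) (map (shiftsym k) (syms l)).
    apply: perm_trans (perm_filter (predC P) pm) _; rewrite filter_cat.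
    rewrite (all_filterP al2) -[X in perm_eq _ X]cat0s perm_cat2r.
    by rewrite (eq_in_filter (a2 := pred0)) ?filter_pred0 // => t tk; rewrite /= /P tk.
  apply: (@resval_sqr_cat K r P (symset k) S2) => //.
  - by move=> t; rewrite symset_mem.
  - move=> t /imfsetP[u /= ul ->]; apply: (allP al2); apply: map_f.
    by rewrite -symset_mem.
  - by rewrite (perm_size p1) z1 szs.
  - by rewrite (perm_size p2) size_relabel size_map z2 szs.
rewrite (sum_listings_cat _ _ al1 al2); apply: eq_shuf => a b.
rewrite mulr_suml; apply: eq_bigr => L1 _; rewrite mulr_sumr.
rewrite (sum_listings_map _ _ _ (@shiftsym_inj _ k)) //; apply: eq_bigr => L2 _.
by rewrite /F (resval_relabel K _ _ (@shiftv_inj _ k) erefl (@shiftv_sym _ k)).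
Qed.


Definition degfact k : nat := (\prod_i (k i)`!)%N.

Lemma degfact_neq0 k : (degfact k)%:R != 0 :> K.
Proof.
rewrite pnatr_eq0 -lt0n /degfact; elim/big_ind: _ => // [m n m0 n0|i _].
  by rewrite muln_gt0 m0.
exact: fact_gt0.
Qed.

(** The pairing with the component of degree [k]; in [shuf] the two subwords range
    over all degrees. *)
Definition pair_deg k J (x : trees) : K^o := if multiindex k J then pair_word J x else 0.

Lemma pair_deg_linear k J : linear (pair_deg k J).
Proof.
move=> c x y; rewrite /pair_deg; case: ifP => _; first exact: pair_word_linear.
by rewrite scaler0 addr0.
Qed.

HB.instance Definition _ k J := GRing.isLinear.Build K trees K^o _ (pair_deg k J) (pair_deg_linear k J).

Lemma pair_deg_ASym k s J : otree (symset k) s ->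
  pair_deg k J (ASym k (tree s)) = epsilon K k s * growths K k s J.
Proof.
move=> ot; rewrite /pair_deg; case: ifPn => mJ; first exact: pair_word_ASym.
by rewrite growths0 // mulr0.
Qed.

Lemma shuf_scale (I : Type) (J : seq I) (c : K) G : shuf J (fun a b => c * G a b) = c * shuf J G.
Proof. by elim: J G => [|i J IH] G //=; rewrite !IH mulrDr. Qed.

Lemma star_treeE k l s1 s2 : otree (symset k) s1 -> otree (symset l) s2 ->
  star_tree K s1 s2 =
  (epsilon K k s1 * epsilon K l s2 * epsilon K (k + l) (s1 ++ relabel (shiftv k) s2)
     / (degfact k * degfact l)%:R) *:
  ASym (k + l) (tree (s1 ++ relabel (shiftv k) s2)).
Proof.
move=> o1 o2; rewrite /star_tree (otree_tdeg o1) (otree_tdeg o2) o1 o2 /=.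
by rewrite /degfact -big_split.
Qed.

(** Epsilon is a sign as soon as the tree has a growth order. *)
Lemma epsilon_growths k s J : otree (symset k) s ->
  epsilon K k s ^+ 2 * growths K k s J = growths K k s J.
Proof.
move=> ot; rewrite /growths mulr_sumr; apply: eq_big_seq => L.
rewrite listingsP => /andP[pm _].
have [->|rv0] := eqVneq (resval K L s) 0; first by rewrite expr0n mulr0.
by rewrite (epsilon_sqr ot pm rv0) mul1r.
Qed.

(** The sign of the glued tree enters twice, in the definition of the star product
    and in the pairing with its antisymmetrization, and cancels. *)
Lemma pair_word_star_tree k l s1 s2 J : otree (symset k) s1 -> otree (symset l) s2 ->
  multiindex (k + l) J ->
  pair_word J (star_tree K s1 s2) = shuf J (fun a b =>
    ((degfact k)%:R^-1 * pair_deg k a (ASym k (tree s1))) *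
    ((degfact l)%:R^-1 * pair_deg l b (ASym l (tree s2)))).
Proof.
move=> o1 o2 mJ; rewrite (star_treeE o1 o2) linearZ /= pair_word_ASym ?otree_star //.
set T := s1 ++ _; set e1 := epsilon K k s1; set e2 := epsilon K l s2.
transitivity (e1 * e2 / (degfact k * degfact l)%:R *
   (epsilon K (k + l) T ^+ 2 * growths K (k + l) T J)).
  by rewrite -[_ *: _]/(_ * _); ring.
rewrite epsilon_growths ?otree_star // growths_star // -shuf_scale.
apply: eq_shuf => a b; rewrite !pair_deg_ASym // natrM invfM -/e1 -/e2; ring.
Qed.

Lemma calA_lin k c (x y : trees) : calA k x -> calA k y -> calA k (c *: x + y).
Proof.
move=> [[s [sG ->]] ax] [[t [tG ->]] ay]; split; last first.
  by move=> pi; rewrite linearP /= ax ay scalerDr !scalerA mulrC.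
exists ([seq (c * d.1, d.2) | d <- s] ++ t); split=> [d|].
  by rewrite mem_cat => /orP [/mapP [d' /sG ? ->]|/tG].
rewrite big_cat big_map scaler_sumr; congr (_ + _).
by apply: eq_bigr => d _; rewrite scalerA.
Qed.

Lemma calA0 k : calA k (0 : trees).
Proof.
split=> [|pi]; last by rewrite linear0 scaler0.
by exists [::]; rewrite big_nil.
Qed.

Lemma ASym_tree_calA k s : otree (symset k) s -> calA k (ASym k (tree s)).
Proof.
move=> ot; split=> [|pi]; last exact: perm_act_ASym.
exists [seq (sgnG K pi, perm_act pi (tree s)) | pi <- enum (symgroup k)]; split.
  move=> _ /mapP[pi _ ->] /=; exists (relabel (permv pi) s); last exact: perm_act_tree.
  exact: otree_permv.
by rewrite big_map big_enum.
Qed.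

Lemma star_tree_calA k l s1 s2 : otree (symset k) s1 -> otree (symset l) s2 ->
  calA (k + l) (star_tree K s1 s2).
Proof.
move=> o1 o2; rewrite (star_treeE o1 o2) -[X in calA _ X]addr0.
by apply: calA_lin (calA0 _); apply/ASym_tree_calA/otree_star.
Qed.

(** If the pairings with words separate the elements of the spaces A(k), then the
    star product is compatible with the relations between trees: it takes values in
    these spaces, and its pairings with words depend only on the classes of the two
    factors. *)
Section Separated.
Hypothesis sep : forall k (x : trees), calA k x ->
  (forall J, multiindex k J -> pair_word J x = 0) -> x = 0.

Lemma star_tree_rel (c : seq (K * (seq edge * seq edge))) k l :
  {in c, forall d, otree (symset k) d.2.1 /\ otree (symset l) d.2.2} ->
  (forall J, multiindex (k + l) J -> \sum_(d <- c) d.1 * shuf J (fun a b =>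
     pair_deg k a (ASym k (tree d.2.1)) * pair_deg l b (ASym l (tree d.2.2))) = 0) ->
  \sum_(d <- c) d.1 *: star_tree K d.2.1 d.2.2 = 0.
Proof.
move=> ot H; apply: (sep (k := (k + l)%R)) => [|J mJ].
  elim: c ot {H} => [|d c IH] ot; first by rewrite big_nil; apply: calA0.
  rewrite big_cons; apply: calA_lin; last first.
    by apply: IH => d' d'c; apply: ot; rewrite inE d'c orbT.
  by have [o1 o2] := ot d (mem_head _ _); apply: star_tree_calA.
rewrite linear_sum /=.
transitivity ((degfact k)%:R^-1 * (degfact l)%:R^-1 *
  \sum_(d <- c) d.1 * shuf J (fun a b =>
     pair_deg k a (ASym k (tree d.2.1)) * pair_deg l b (ASym l (tree d.2.2)))); last first.
  by rewrite H // mulr0.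
rewrite mulr_sumr; apply: eq_big_seq => d /ot[o1 o2].
transitivity (d.1 * pair_word J (star_tree K d.2.1 d.2.2)); first by rewrite linearZ.
rewrite (pair_word_star_tree o1 o2 mJ) [RHS]mulrCA -[in RHS]shuf_scale; congr (_ * _).
by apply: eq_shuf => a b; ring.
Qed.

Lemma star_tree_kill2 s1 (c : seq (seq edge)) S :
  {in c, forall s, otree S s} -> \sum_(s <- c) tree s = 0 ->
  \sum_(s <- c) star_tree K s1 s = 0.
Proof.
move=> ot H; case: (boolP (otree (symset (tdeg s1)) s1)) => o1; last first.
  by rewrite big1 // => s _; rewrite /star_tree (negbTE o1).
case: c ot H => [|s0 c] ot H; first by rewrite big_nil.
case: (boolP (otree (symset (tdeg s0)) s0)) => o0; last first.
  rewrite big_seq big1 // => s sc; rewrite /star_tree o1 /=; case: ifP => // os.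
  have E := otree_symset_eq os (ot _ sc).
  move: o0; have := ot _ (mem_head s0 c); rewrite -E => o0.
  by rewrite (otree_tdeg o0) o0.
have E := otree_symset_eq o0 (ot _ (mem_head s0 c)).
have := @star_tree_rel [seq (1, (s1, s)) | s <- s0 :: c] (tdeg s1) (tdeg s0).
rewrite big_map; under eq_bigr do rewrite scale1r; apply.
  by move=> _ /mapP[s sc ->] /=; rewrite o1 E ot.
move=> J mJ; rewrite big_map; under eq_bigr do rewrite mul1r.
rewrite -shuf_sum -[RHS](shuf0 _ J); apply: eq_shuf => a b.
rewrite /= -mulr_sumr -linear_sum -linear_sum H linear0 linear0; exact: mulr0.
Qed.

Lemma star_tree_kill1 s2 (c : seq (seq edge)) S :
  {in c, forall s, otree S s} -> \sum_(s <- c) tree s = 0 ->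
  \sum_(s <- c) star_tree K s s2 = 0.
Proof.
move=> ot H; case: (boolP (otree (symset (tdeg s2)) s2)) => o1; last first.
  by rewrite big1 // => s _; rewrite /star_tree (negbTE o1) andbF.
case: c ot H => [|s0 c] ot H; first by rewrite big_nil.
case: (boolP (otree (symset (tdeg s0)) s0)) => o0; last first.
  rewrite big_seq big1 // => s sc; rewrite /star_tree o1 andbT; case: ifP => // os.
  have E := otree_symset_eq os (ot _ sc).
  move: o0; have := ot _ (mem_head s0 c); rewrite -E => o0.
  by rewrite (otree_tdeg o0) o0.
have E := otree_symset_eq o0 (ot _ (mem_head s0 c)).
have := @star_tree_rel [seq (1, (s, s2)) | s <- s0 :: c] (tdeg s0) (tdeg s2).
rewrite big_map; under eq_bigr do rewrite scale1r; apply.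
  by move=> _ /mapP[s sc ->] /=; rewrite o1 E ot.
move=> J mJ; rewrite big_map; under eq_bigr do rewrite mul1r.
rewrite -shuf_sum -[RHS](shuf0 _ J); apply: eq_shuf => a b.
rewrite /= -mulr_suml -linear_sum -linear_sum H linear0 linear0; exact: mul0r.
Qed.

Section Kill.
Variable phi : seq edge -> trees.
Hypothesis H : forall (c : seq (seq edge)) S, {in c, forall s, otree S s} ->
     \sum_(s <- c) tree s = 0 -> \sum_(s <- c) phi s = 0.

Lemma kill_alternating : alternating phi.
Proof.
move=> S s1 e f s2 ot; apply/eqP; rewrite -addr_eq0; apply/eqP.
have := H (c := [:: s1 ++ e :: f :: s2; s1 ++ f :: e :: s2]) (S := S).
rewrite !big_cons !big_nil !addr0; apply.
  by move=> s; rewrite !inE => /orP[]/eqP-> //; apply: otree_perm ot; perm_count.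
by rewrite (tree_alternating K ot) addNr.
Qed.

Lemma kill3 S T1 T2 T3 : otree S T1 -> otree S T2 -> otree S T3 ->
  tree T1 + tree T2 + tree T3 = 0 -> phi T1 + phi T2 + phi T3 = 0.
Proof.
move=> o1 o2 o3; have := H (c := [:: T1; T2; T3]) (S := S).
rewrite !big_cons !big_nil !addr0 !addrA; apply.
by move=> s'; rewrite !inE => /or3P[]/eqP->.
Qed.

Lemma kill_triangular : triangular phi.
Proof.
move=> S s t x u tx tu xu o1 o2 o3.
exact: kill3 o1 o2 o3 (tree_triangular K tx tu xu o1 o2 o3).
Qed.

End Kill.

Definition star_with s1 : trees -> trees := plift (G := @tree_rel K r) (star_tree K s1).

Lemma star_with_tree s1 s2 : star_with s1 (tree s2) = star_tree K s1 s2.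
Proof.
exact: (plift_tree (kill_alternating (@star_tree_kill2 s1))
                   (kill_triangular (@star_tree_kill2 s1))).
Qed.

Lemma star_with_linear s1 : linear (star_with s1).
Proof.
exact: (plift_tree_linear (kill_alternating (@star_tree_kill2 s1))
                          (kill_triangular (@star_tree_kill2 s1))).
Qed.

HB.instance Definition _ s1 := GRing.isLinear.Build K trees trees _
  (star_with s1) (star_with_linear s1).

Lemma star_kill y (c : seq (seq edge)) S :
  {in c, forall s, otree S s} -> \sum_(s <- c) tree s = 0 ->
  \sum_(s <- c) star_with s y = 0.
Proof.
move=> ot H; elim/trees_ind: y => [|d s y IH].
  by rewrite big1 // => s _; rewrite linear0.
transitivity (\sum_(s1 <- c) (d *: star_tree K s1 s + star_with s1 y)).
  by apply: eq_bigr => s1 _; rewrite linearP /= star_with_tree.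
by rewrite big_split /= -scaler_sumr IH (star_tree_kill1 _ ot H) scaler0 addr0.
Qed.

Lemma star_tree_l s1 y : star (tree s1) y = star_with s1 y.
Proof.
exact: (plift_tree (kill_alternating (@star_kill y)) (kill_triangular (@star_kill y))).
Qed.

Lemma star_linear_l (y : trees) : linear (fun x : trees => star x y).
Proof.
exact: (plift_tree_linear (kill_alternating (@star_kill y)) (kill_triangular (@star_kill y))).
Qed.

Lemma star0l (w : trees) : star 0 w = 0 :> trees.
Proof. by have := star_linear_l w (-1) 0 0; rewrite scaler0 add0r scaleN1r addNr. Qed.

Lemma star_linear_r (x : trees) : linear (star x : trees -> trees).
Proof.
move=> c y z; elim/trees_ind: x => [|d s x IH].
  by rewrite !star0l scaler0 addr0.
rewrite !star_linear_l !star_tree_l linearP /= IH.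
rewrite !scalerDr !scalerA (mulrC c d).
exact: addrACA.
Qed.

Lemma in_span_tree k (x : trees) : calA k x ->
  exists2 c : seq (K * seq edge), {in c, forall d, otree (symset k) d.2} &
    x = \sum_(d <- c) d.1 *: tree d.2.
Proof.
move=> [[c [cG ->]] _]; elim: c cG => [|[d y] c IH] cG.
  by exists [::] => //; rewrite !big_nil.
have /= [s ot E] := cG _ (mem_head _ _).
have [c' ot' E'] := IH (fun z zc => cG z (mem_behead (s := (d, y) :: c) zc)).
exists ((d, s) :: c') => [z|]; last by rewrite !big_cons E' /= E.
by rewrite inE => /orP[/eqP->|/ot'].
Qed.

Lemma star_sum (I I' : Type) (c : seq I) (c' : seq I') a a' (s : I -> seq edge) (s' : I' -> seq edge) :
  star (\sum_(d <- c) a d *: tree (s d)) (\sum_(d <- c') a' d *: tree (s' d)) =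
  \sum_(d <- c) \sum_(d' <- c') (a d * a' d') *: star_tree K (s d) (s' d') :> trees.
Proof.
have H x : star x (\sum_(d <- c') a' d *: tree (s' d)) = \sum_(d <- c') a' d *: star x (tree (s' d)) :> trees.
  elim: c' => [|d c' IH]; last by rewrite !big_cons star_linear_r IH.
  by rewrite !big_nil; have := star_linear_r x (-1) 0 0; rewrite scaler0 add0r scaleN1r addNr.
elim: c => [|d c IH]; first by rewrite !big_nil star0l.
rewrite !big_cons star_linear_l IH; congr (_ + _); rewrite H scaler_sumr.
by apply: eq_bigr => d' _; rewrite scalerA star_tree_l star_with_tree.
Qed.

Lemma star_calA k l (x y : trees) : calA k x -> calA l y -> calA (k + l) (star x y).
Proof.
move=> /in_span_tree[c oc ->] /in_span_tree[c' oc' ->]; rewrite star_sum.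
elim: c oc => [|d c IH] oc; first by rewrite big_nil; apply: calA0.
have {}IH : calA (k + l) _ := IH (fun z zc => oc z (mem_behead (s := d :: c) zc)).
rewrite big_cons -[X in calA _ (X + _)]scale1r; apply: calA_lin => //.
elim: c' oc' {IH} => [|d' c' IH] oc'; first by rewrite big_nil; apply: calA0.
rewrite big_cons; apply: calA_lin.
  by apply: star_tree_calA; [apply/oc/mem_head | apply/oc'/mem_head].
by apply: IH => z zc; apply/oc'/(mem_behead (s := d' :: c')).
Qed.

Definition pair_ASym k J (x : trees) : K := pair_deg k J (ASym k x).

Lemma pair_ASym_lin k J c (x y : trees) : pair_ASym k J (c *: x + y) = c * pair_ASym k J x + pair_ASym k J y.
Proof.
rewrite /pair_ASym; transitivity (pair_deg k J (c *: ASym k x + ASym k y)).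
  by congr pair_deg; exact: ASym_linear.
exact: pair_deg_linear.
Qed.

Lemma pair_ASym_sum k J (s : seq (K * seq edge)) :
  pair_ASym k J (\sum_(d <- s) d.1 *: tree d.2) = \sum_(d <- s) d.1 * pair_ASym k J (tree d.2).
Proof.
elim: s => [|d s IH]; last by rewrite !big_cons pair_ASym_lin IH.
rewrite !big_nil; have := pair_ASym_lin k J (-1) 0 0.
by rewrite scaler0 add0r mulN1r addNr.
Qed.

Lemma pair_deg_calA k J (x : trees) : calA k x ->
  pair_deg k J x = (degfact k)%:R^-1 * pair_ASym k J x :> K.
Proof.
move=> ax; rewrite /pair_ASym (ASym_calA ax).
transitivity ((degfact k)%:R^-1 * ((degfact k)%:R * pair_deg k J x) : K).
  by rewrite mulKf ?degfact_neq0.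
congr (_ * _); symmetry; exact: linearZ.
Qed.

(** The star product is the transpose of the coproduct of the free algebra in which
    the generators are primitive. *)
Lemma pair_word_star k l (x y : trees) J : calA k x -> calA l y -> multiindex (k + l) J ->
  pair_word J (star x y) = shuf J (fun a b => pair_deg k a x * pair_deg l b y : K).
Proof.
move=> ax ay mJ; pose ik := (degfact k)%:R^-1 : K; pose il := (degfact l)%:R^-1 : K.
transitivity (shuf J (fun a b => (ik * pair_ASym k a x) * (il * pair_ASym l b y))); last first.
  by apply: eq_shuf => a b; rewrite -!pair_deg_calA.
have [c oc ->] := in_span_tree ax; have [c' oc' ->] := in_span_tree ay.
rewrite star_sum.
transitivity (\sum_(d <- c) \sum_(d' <- c')
    (d.1 * d'.1) * pair_word J (star_tree K d.2 d'.2) : K).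
  rewrite linear_sum; apply: eq_bigr => d _; rewrite linear_sum.
  by apply: eq_bigr => d' _; exact: linearZ.
transitivity (\sum_(d <- c) \sum_(d' <- c') shuf J (fun a b =>
   (d.1 * d'.1) * ((ik * pair_ASym k a (tree d.2)) * (il * pair_ASym l b (tree d'.2))))).
  apply: eq_big_seq => d dc; apply: eq_big_seq => d' dc'.
  by rewrite shuf_scale; congr (_ * _); apply: pair_word_star_tree; [exact: oc|exact: oc'|].
transitivity (\sum_(d <- c) shuf J (fun a b => \sum_(d' <- c') 
   (d.1 * d'.1) * ((ik * pair_ASym k a (tree d.2)) * (il * pair_ASym l b (tree d'.2))))).
  by apply: eq_bigr => d _; rewrite shuf_sum.
rewrite -shuf_sum; apply: eq_shuf => a b; rewrite !pair_ASym_sum.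
rewrite [RHS]mulrACA [in RHS]mulr_suml mulr_sumr; apply: eq_bigr => d _.
rewrite !mulr_sumr; apply: eq_bigr => d' _.
move: (pair_ASym _ _ _) (pair_ASym _ _ _) => u v; ring.
Qed.

End Separated.
End Star.

(** * Representative functionals on the enveloping algebra *)

Lemma linear_ex (K : fieldType) (V W : lmodType K) (f : V -> W) : linear f ->
  exists F : {linear V -> W}, F =1 f.
Proof.
move=> lf; pose F : {linear V -> W} := HB.pack f (GRing.isLinear.Build K V W _ f lf).
by exists F.
Qed.

Section Tensor.
Variable K : fieldType.

(** The Kronecker product, packaged so that its dimension has the form of a
    successor, as the ring of square matrices requires. *)
Lemma tens_ex N M : exists L (t : 'M[K]_N.+1 -> 'M[K]_M.+1 -> 'M[K]_L.+1),
  [/\ (forall A, linear (t A)), (forall B, linear (t^~ B)), t 1 1 = 1,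
      (forall A B C D, t A B * t C D = t (A * C) (B * D)) &
      forall A B, \tr (t A B) = \tr A * \tr B].
Proof.
exists (M + N * M.+1)%N, (fun A B => @tensmx K N.+1 N.+1 M.+1 M.+1 A B); split.
- move=> A c x y; apply/matrixP => i j; rewrite !mxE mulrDr; congr (_ + _).
  exact: mulrCA.
- by move=> B c x y; apply/matrixP => i j; rewrite !mxE mulrDl mulrA.
- apply/matrixP => i j; rewrite !mxE -natrM mulnb; congr (nat_of_bool _)%:R.
  rewrite -xpair_eqE -!surjective_pairing.
  exact: (inj_eq (can_inj (@mxtens_unindexK N.+1 M.+1))).
- by move=> A B C D; exact: (tensmx_mul A B C D).
move=> A B; rewrite /mxtrace mulr_sum; apply: eq_bigr => i _.
by rewrite mxE.
Qed.

End Tensor.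

Section Representative.
Variables (K : numFieldType) (g : vectType K) (br : g -> g -> g) (nm : {vspace g}).
Variables (U : algType K) (iota : {linear subvs_of nm -> U}).
Hypothesis ue : universal_enveloping br iota.

(** Linear combinations of the matrix coefficients of a finite-dimensional
    representation. They descend to the enveloping algebra by its universal
    property, and their products are given by tensor products of representations,
    so that they can be multiplied by means of a coproduct on words although the
    algebra U tensor U does not appear. *)
Definition representative (phi : U -> K) : Prop :=
  exists N (rho : {lrmorphism U -> 'M[K]_N.+1}) (A : 'M[K]_N.+1),
    forall u, phi u = \tr (A * rho u).

Lemma representative_lin phi c x y : representative phi ->
  phi (c *: x + y) = c * phi x + phi y.
Proof.
move=> [N [rho [A E]]]; rewrite !E linearP mulrDr mxtraceD -scalerAr mxtraceZ //.
Qed.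

Lemma representative_sum phi (I : Type) (s : seq I) (P : pred I) (c : I -> K) (x : I -> U) :
  representative phi ->
  phi (\sum_(i <- s | P i) c i *: x i) = \sum_(i <- s | P i) c i * phi (x i).
Proof.
move=> rp; elim: s => [|i s IH]; last first.
  rewrite !big_cons; case: ifP => _ //; by rewrite representative_lin // IH.
rewrite !big_nil; have := representative_lin (-1) 0 0 rp.
by rewrite scaler0 add0r mulN1r addNr.
Qed.

(** The convention for words of the free algebra: the last letter acts first. *)
Definition revprod (w : seq (subvs_of nm)) : U := \prod_(x <- rev w) iota x.

Lemma revprod_cons x w : revprod (x :: w) = revprod w * iota x.
Proof. by rewrite /revprod rev_cons -cats1 big_cat big_seq1. Qed.

Definition monom m (x : 'I_m -> subvs_of nm) (p : 'I_m -> nat) : U :=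
  \prod_j iota (x j) ^+ p j.

Lemma coproduct N M (rho : {lrmorphism U -> 'M[K]_N.+1})
    (sigma : {lrmorphism U -> 'M[K]_M.+1}) L
    (t : 'M[K]_N.+1 -> 'M[K]_M.+1 -> 'M[K]_L.+1) :
  (forall A, linear (t A)) -> (forall B, linear (t^~ B)) -> t 1 1 = 1 ->
  (forall A B C D, t A B * t C D = t (A * C) (B * D)) ->
  exists tau : {lrmorphism U -> 'M[K]_L.+1},
    forall x, tau (iota x) = t (rho (iota x)) 1 + t 1 (sigma (iota x)).
Proof.
move=> lr ll t1 tM; have [lm univ] := ue.
have [F FE] : exists F : {linear subvs_of nm -> 'M[K]_L.+1},
    F =1 fun x => t (rho (iota x)) 1 + t 1 (sigma (iota x)).
  apply: linear_ex => c x y; rewrite !linearP ll lr scalerDr; exact: addrACA.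
case: (univ _ F) => [x y z E|tau tauE _]; last by exists tau => x; rewrite tauE FE.
have tB A B C : t (A - B) C = t A C - t B C.
  by have := ll C (-1) B A; rewrite /= !scaleN1r => E'; rewrite addrC E' addrC.
have tB' A B C : t C (A - B) = t C A - t C B.
  by have := lr C (-1) B A; rewrite /= !scaleN1r => E'; rewrite addrC E' addrC.
rewrite !FE (lm _ _ _ E) !rmorphB !rmorphM tB tB' !mulrDl !mulrDr !tM !mulr1 !mul1r.
set a := t _ 1; set b := t _ 1; set c := t 1 _; set d := t 1 _.
set e := t (rho (iota x)) _; set f := t (rho (iota y)) _.
rewrite [f + c]addrC [e + d]addrC [a + e + _]addrACA [b + f + _]addrACA [f + e]addrC.
by rewrite [in RHS]opprD [RHS]addrACA subrr addr0 [LHS]addrACA opprD.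
Qed.

Lemma representative_unit : exists2 phi, representative phi & phi 1 = 1.
Proof.
have [_ univ] := ue.
have [F FE] : exists F : {linear subvs_of nm -> 'M[K]_1}, F =1 fun=> 0.
  by apply: linear_ex => c x y; rewrite scaler0 addr0.
case: (univ _ F) => [x y z E|tau _ _]; first by rewrite !FE mulr0 subrr.
exists (fun u => \tr (1 * tau u)); first by exists 0%N, tau, 1.
by rewrite mul1r rmorph1 mxtrace1.
Qed.

Lemma exprD_tens N M L (t : 'M[K]_N.+1 -> 'M[K]_M.+1 -> 'M[K]_L.+1) A B n b :
  (forall A, linear (t A)) -> (forall B, linear (t^~ B)) -> t 1 1 = 1 ->
  (forall A B C D, t A B * t C D = t (A * C) (B * D)) -> (n <= b)%N ->
  (t A 1 + t 1 B) ^+ n =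
  \sum_(i < b.+1) t ('C(n, i)%:R *: A ^+ (n - i)) (B ^+ i).
Proof.
move=> lr ll t1 tM nb.
have tZ c C D : t (c *: C) D = c *: t C D.
  have t0 : t 0 D = 0 by have := ll D (-1) 0 0; rewrite scaler0 add0r scaleN1r addNr.
  by have := ll D c C 0; rewrite /= !addr0 t0 addr0.
have tX1 C i : t C 1 ^+ i = t (C ^+ i) 1.
  by elim: i => [|i IH]; rewrite ?expr0 ?t1 // !exprS IH tM mulr1.
have t1X C i : t 1 C ^+ i = t 1 (C ^+ i).
  by elim: i => [|i IH]; rewrite ?expr0 ?t1 // !exprS IH tM mulr1.
rewrite exprDn_comm; last by rewrite /GRing.comm !tM !mulr1 !mul1r.
rewrite (big_ord_widen b.+1 (fun i => (t A 1 ^+ (n - i) * t 1 B ^+ i) *+ 'C(n, i))) //.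
rewrite [LHS]big_mkcond /=; apply: eq_bigr => i _.
rewrite tZ tX1 t1X tM mulr1 mul1r scaler_nat; case: ifPn => // ge.
by rewrite bin_small ?mulr0n // ltnNge -ltnS.
Qed.

(** In the tensor product of two representations an element of the Lie algebra acts
    as a sum of two commuting operators, so a word is distributed over the two
    factors in all possible ways, and powers are expanded by the binomial
    theorem. *)
Lemma representative_mul phi psi : representative phi -> representative psi ->
  exists chi, [/\ representative chi,
    forall w, chi (revprod w) = shuf w (fun a b => phi (revprod a) * psi (revprod b)) &
    forall m (x : 'I_m -> subvs_of nm) n (p : 'I_m -> nat), (forall j, p j <= n)%N ->
      chi (monom x p) = \sum_(b : {ffun 'I_m -> 'I_n.+1})
        (\prod_j 'C(p j, b j))%:R *
        (phi (monom x (fun j => p j - b j)%N) * psi (monom x (fun j => b j : nat)))].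
Proof.
move=> [N [rho [A phiE]]] [M [sigma [B psiE]]].
have [L [t [lr ll t1 tM trt]]] := tens_ex K N M.
have [tau tauE] := coproduct rho sigma lr ll t1 tM.
have tZ c C D : t (c *: C) D = c *: t C D.
  have t0 : t 0 D = 0 by have := ll D (-1) 0 0; rewrite scaler0 add0r scaleN1r addNr.
  by have := ll D c C 0; rewrite /= !addr0 t0 addr0.
pose chi u := \tr (t A B * tau u).
have rc : representative chi by exists L, tau, (t A B).
have chiD x y : chi (x + y) = chi x + chi y by rewrite /chi rmorphD mulrDr mxtraceD.
exists chi; split=> // [w|m x n p le].
  have : forall a0 b0, \tr (t A B * (tau (revprod w) * t a0 b0)) =
      shuf w (fun a b => \tr (A * (rho (revprod a) * a0)) * \tr (B * (sigma (revprod b) * b0))).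
    elim: w => [|x w IH] a0 b0 /=.
      by rewrite /revprod big_nil !rmorph1 !mul1r tM trt.
    rewrite revprod_cons rmorphM /= -[in LHS]mulrA tauE mulrDl !tM !mul1r mulrDr mulrDr mxtraceD !IH.
    by congr (_ + _); apply: eq_shuf => a b; rewrite revprod_cons rmorphM -!mulrA.
  move=> /(_ 1 1); rewrite t1 mulr1 /chi => ->; apply: eq_shuf => a b.
  by rewrite !mulr1 phiE psiE.
have monomE Q (s : {lrmorphism U -> 'M[K]_Q.+1}) (q : 'I_m -> nat) :
   s (monom x q) = \prod_j s (iota (x j)) ^+ q j.
  by rewrite /monom rmorph_prod; apply: eq_bigr => j _; rewrite rmorphXn.
rewrite /chi monomE.
under eq_bigr => j _ do rewrite tauE (exprD_tens _ _ lr ll t1 tM (le j)).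
rewrite bigA_distr_bigA /= mulr_sumr raddf_sum /=; apply: eq_bigr => b _.
have -> : \prod_(i < m) t ('C(p i, b i)%:R *: rho (iota (x i)) ^+ (p i - b i))
      (sigma (iota (x i)) ^+ b i) =
   t (\prod_i ('C(p i, b i)%:R *: rho (iota (x i)) ^+ (p i - b i)))
     (\prod_i sigma (iota (x i)) ^+ b i).
  by elim/big_rec3: _ => [|i a c d _ ->]; rewrite ?t1 // tM.
rewrite scaler_prod tZ -scalerAr mxtraceZ -natr_prod; congr (_ * _).
by rewrite tM trt phiE psiE !monomE.
Qed.

End Representative.

(** * Functionals dual to the ordered monomials *)

Section DualMonomials.
Variables (K : numFieldType) (g : vectType K) (br : g -> g -> g) (nm : {vspace g}).
Variables (U : algType K) (iota : {linear subvs_of nm -> U}).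
Hypothesis ue : universal_enveloping br iota.
Variables (m : nat) (x : 'I_m -> subvs_of nm).
Hypothesis coord : forall j, exists phi : U -> K,
  [/\ representative phi, phi 1 = 0 & forall i, phi (iota (x i)) = (i == j)%:R].
Local Notation mono := (monom iota x).

Lemma monom0 (p : 'I_m -> nat) : p =1 (fun=> 0%N) -> mono p = 1.
Proof. by move=> p0; rewrite /monom big1 // => j _; rewrite p0 expr0. Qed.

Lemma monom_delta (p : 'I_m -> nat) j : p =1 (fun i => (i == j) : nat) -> mono p = iota (x j).
Proof.
move=> pE; rewrite /monom.
transitivity (\prod_(i < m | i == j) iota (x i)); last by rewrite big_pred1_eq.
rewrite [RHS]big_mkcond; apply: eq_bigr => i _.
by rewrite pE; case: eqP => _; rewrite ?expr1 ?expr0.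
Qed.

Lemma eq_monom (p q : 'I_m -> nat) : p =1 q -> mono p = mono q.
Proof. by move=> pq; apply: eq_bigr => j _; rewrite pq. Qed.

(** Products of coordinate functionals. A coordinate functional vanishes at [1] and
    picks out one generator, so multiplying by it amounts, on monomials that are not
    too long, to removing one factor; longer monomials are not controlled. *)
Lemma dual_monomials (p : 'I_m -> nat) : exists2 phi : U -> K, representative phi &
  forall q, (\sum_j q j <= \sum_j p j)%N ->
    phi (mono q) = (\prod_j (p j)`!)%N%:R * [forall j, p j == q j]%:R.
Proof.
have [d] := ubnP (\sum_j p j)%N; elim: d p => [|d IH] p; first by rewrite ltn0.
move=> ltd; case: (boolP [forall j, p j == 0%N]) => [/forallP p0|/forallPn[j pj]].
  have [phi rp phi1] := representative_unit ue; exists phi => // q.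
  rewrite [X in (_ <= X)%N]big1 => [|j _]; last exact/eqP/p0.
  rewrite leqn0 sum_nat_eq0 => /forallP q0.
  have qz j : q j = 0%N by apply/eqP/q0.
  rewrite monom0 // phi1 big1 => [|j _]; last by rewrite (eqP (p0 j)).
  suff -> : [forall j, p j == q j] by rewrite mulr1.
  by apply/forallP => j; rewrite qz p0.
(* One factor [x j] is removed from the monomial. *)
pose p0 i := (p i - (i == j))%N.
have pE i : p i = (p0 i + (i == j))%N.
  by rewrite /p0 subnK //; case: eqP => // ->; rewrite lt0n.
have sd : (\sum_i (i == j) = 1)%N by rewrite (bigD1 j) //= eqxx big1 // => i /negbTE ->.
have sp : (\sum_i p i = (\sum_i p0 i).+1)%N.
  by rewrite -addn1 -sd -big_split; apply: eq_bigr => i _; rewrite pE.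
have ltp0 : (\sum_i p0 i < d)%N by move: ltd; rewrite sp ltnS.
have [phi0 rp0 phi0E] := IH p0 ltp0.
have [psi [rpsi psi1 psix]] := coord j.
have [chi [rc _ chiE]] := representative_mul ue rp0 rpsi.
exists chi => // q; rewrite sp => leq_q.
(* Any bound on the exponents of [q] works; it has to be positive for [e] to exist. *)
pose n := (\sum_i q i).+1.
have qn i : (q i <= n)%N by rewrite ltnW // /n ltnS (bigD1 i) //= leq_addr.
rewrite (chiE m x n q qn).
pose e : {ffun 'I_m -> 'I_n.+1} := [ffun i => inord (i == j)].
have eE i : e i = (i == j) :> nat.
  by rewrite ffunE inordK // ltnS; case: (i == j).
rewrite (bigD1 e) //= [X in _ + X]big1 ?addr0 => [|b be]; last first.
  have [bq|] := boolP [forall i, b i <= q i]%N; last first.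
    move=> /forallPn[k]; rewrite -ltnNge => lt.
    by rewrite (bigD1 k) //= bin_small // mul0n mul0r.
  have sqb : (\sum_i (q i - b i) + \sum_i b i = \sum_i q i)%N.
    by rewrite -big_split; apply: eq_bigr => i _; rewrite /= subnK // (forallP bq).
  (* The second factor vanishes if [b] is zero or another unit vector; if [b] is
     longer, what remains of [q] is too short for the first factor. *)
  have [b0|b0] := eqVneq (\sum_i b i)%N 0%N.
    move/eqP: b0; rewrite sum_nat_eq0 => /forallP b0.
    by rewrite [X in psi X]monom0 ?psi1 ?mulr0 // => i; apply/eqP/b0.
  have [b1|b1] := eqVneq (\sum_i b i)%N 1%N.
    have [i bi] : exists i, b i != 0%N :> nat.
      by apply/existsP; move: b0; rewrite sum_nat_eq0 negb_forall.
    have bE i' : b i' = (i' == i) :> nat.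
      move: b1 bi; rewrite (bigD1 i) //= -lt0n => b1 bi.
      case: eqVneq => [->|ne]; first by apply/eqP; rewrite eqn_leq bi andbT -[nat_of_bool true]/1%N -b1 leq_addr.
      move: b1; rewrite (bigD1 i') //=; case: (val (b i)) bi => // bi _.
      by case: (val (b i')) => // k; rewrite !addSn addnS.
    rewrite [X in psi X](monom_delta bE) psix.
    have -> : (i == j) = false.
      apply: contraNF be => /eqP ij; apply/eqP/ffunP => i'; apply: val_inj.
      by rewrite /= bE eE ij.
    by rewrite !mulr0.
  have lt : (\sum_i (q i - b i) < \sum_i p0 i)%N by lia.
  rewrite phi0E ?(ltnW lt) //.
  have -> : [forall i, p0 i == q i - b i]%N = false.
    apply: contraTF lt => /forallP E; rewrite -leqNgt.
    by under eq_bigr => i _ do rewrite (eqP (E i)).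
  by rewrite mulr0 mul0r mulr0.
rewrite [X in psi X](monom_delta eE) psix eqxx mulr1.
have bin : (\prod_i 'C(q i, e i) = q j)%N.
  rewrite (bigD1 j) //= eE eqxx bin1 big1 ?muln1 // => i ij.
  by rewrite eE (negbTE ij) bin0.
rewrite bin; have [q0|qj] := posnP (q j).
  rewrite q0 mul0r; suff -> : [forall i, p i == q i] = false by rewrite mulr0.
  by apply/negbTE/forallPn; exists j; rewrite q0.
have sq : (\sum_i (q i - e i) + 1 = \sum_i q i)%N.
  rewrite -sd -big_split; apply: eq_bigr => i _; rewrite /= eE subnK //.
  by case: eqP => // ->.
rewrite phi0E; last by rewrite -ltnS -sp; lia.
have -> : [forall i, p0 i == q i - e i]%N = [forall i, p i == q i].
  apply: eq_forallb => i; have := pE i; rewrite eE.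
  case: eqVneq => [->|_] /= ->; last by rewrite addn0 subn0.
  by rewrite -{2}(subnK qj) eqn_add2r.
case: forallP => [E|_]; last by rewrite !mulr0.
rewrite !mulr1 -natrM; congr (_%:R).
rewrite (bigD1 j) //= [RHS](bigD1 j) //= mulnA; congr (_ * _)%N.
  by rewrite -(eqP (E j)) pE eqxx addn1 factS.
by apply: eq_bigr => i ij; rewrite pE (negbTE ij) addn0.
Qed.

(** Linear independence in the PBW theorem, in a form detected by representative
    functionals: a longest monomial with nonzero coefficient is isolated by its dual
    functional. *)
Lemma monomials_indep n (a : {ffun 'I_m -> 'I_n.+1} -> K) :
  (forall phi, representative phi ->
     \sum_p a p * phi (mono (fun j => p j : nat)) = 0) -> forall p, a p = 0.
Proof.
move=> H p1; apply/eqP; apply: contraT => ap1.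
pose sz (p : {ffun 'I_m -> 'I_n.+1}) := (\sum_j p j)%N.
case: (@arg_maxnP _ p1 (fun p : {ffun 'I_m -> 'I_n.+1} => a p != 0) sz ap1) => p ap pmax.
have [phi rp phiE] := dual_monomials (fun j => p j : nat).
have := H _ rp; rewrite (bigD1 p) //= big1 ?addr0 => [|q qp].
  rewrite phiE //; have -> : [forall j, p j == p j :> nat] by apply/forallP.
  move=> /eqP; rewrite mulr1 mulf_eq0 (negbTE ap) /= pnatr_eq0 => /eqP E.
  have : (0 < \prod_j (p j)`!)%N.
    by elim/big_ind: _ => // [u v u0 v0|i _]; rewrite ?muln_gt0 ?u0 ?fact_gt0.
  by rewrite E.
have [->|aq] := eqVneq (a q) 0; first by rewrite mul0r.
rewrite phiE; last exact: pmax.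
have -> : [forall j, p j == q j :> nat] = false.
  apply: contraNF qp => /forallP E; apply/eqP/ffunP => j; apply/val_inj/esym/eqP/E.
by rewrite !mulr0.
Qed.

(** Both sides are coefficients of the coproduct of the same element, expanded as a
    word and as a combination of ordered monomials. They are compared by applying
    products of representative functionals. *)
Lemma shuffle_coef (I : eqType) (y : I -> subvs_of nm)
    (c : ('I_m -> nat) -> seq I -> K) n (w : seq I) :
  (forall v, (size v <= size w)%N ->
     revprod iota (map y v) = \sum_(p : {ffun 'I_m -> 'I_n.+1})
        c (fun j => p j : nat) v *: mono (fun j => p j : nat)) ->
  (forall p, ~~ [forall j, p j <= n]%N -> c p w = 0) ->
  (forall p q, p =1 q -> c p = c q) ->
  forall p q : {ffun 'I_m -> 'I_n.+1},
    shuf w (fun a b => c (fun j => p j : nat) a * c (fun j => q j : nat) b) =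
    (\prod_j 'C(p j + q j, q j))%N%:R * c (fun j => p j + q j)%N w.
Proof.
move=> exp cout cext.
pose H (p q : {ffun 'I_m -> 'I_n.+1}) : K :=
  shuf w (fun a b => c (fun j => p j : nat) a * c (fun j => q j : nat) b) -
  (\prod_j 'C(p j + q j, q j))%N%:R * c (fun j => p j + q j)%N w.
suff H0 (p q : {ffun 'I_m -> 'I_n.+1}) : H p q = 0 by move=> p q; apply/eqP; rewrite -subr_eq0; apply/eqP/H0.
pose v (p : {ffun 'I_m -> 'I_n.+1}) : 'I_m -> nat := fun j => p j.
suff key phi psi : representative phi -> representative psi ->
    \sum_p (\sum_q H p q * psi (mono (v q))) * phi (mono (v p)) = 0.
  apply: (monomials_indep (a := H p)) => psi rpsi.
  by apply: (monomials_indep (a := fun p : {ffun 'I_m -> 'I_n.+1} => \sum_q H p q * psi (mono (v q)))) => phi rphi;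
    apply: key.
move=> {p q} rphi rpsi; have [chi [rchi chiw chip]] := representative_mul ue rphi rpsi.
have szsh : forall (J : seq I) (G G' : seq I -> seq I -> K),
    (forall a b, (size a <= size J)%N -> (size b <= size J)%N -> G a b = G' a b) ->
    shuf J G = shuf J G'.
  elim=> [|i J IH] G G' E /=; first exact: E.
  congr (_ + _); apply: IH => a b la lb; apply: E => //=; exact: leqW.
have mapsh : forall (J : seq I) (G : seq (subvs_of nm) -> seq (subvs_of nm) -> K),
    shuf (map y J) G = shuf J (fun a b => G (map y a) (map y b)).
  by elim=> [|i J IH] G //=; rewrite !IH.
have E1 : chi (revprod iota (map y w)) =
   \sum_p \sum_q shuf w (fun a b => c (v p) a * c (v q) b) * (phi (mono (v p)) * psi (mono (v q))).
  rewrite chiw mapsh.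
  transitivity (shuf w (fun a b => \sum_p \sum_q
     (phi (mono (v p)) * psi (mono (v q))) * (c (v p) a * c (v q) b))).
    apply: szsh => a b la lb; rewrite !exp // !representative_sum //.
    rewrite mulr_suml; apply: eq_bigr => p _; rewrite mulr_sumr.
    by apply: eq_bigr => q _; rewrite mulrACA mulrC.
  rewrite shuf_sum; apply: eq_bigr => p _; rewrite shuf_sum; apply: eq_bigr => q _.
  by rewrite shuf_scale mulrC.
have E2 : chi (revprod iota (map y w)) =
   \sum_(p : {ffun 'I_m -> 'I_n.+1}) \sum_(q : {ffun 'I_m -> 'I_n.+1}) (\prod_j 'C(p j + q j, q j))%N%:R * c (fun j => p j + q j)%N w *
      (phi (mono (v p)) * psi (mono (v q))).
  rewrite exp // representative_sum //.
  under eq_bigr => p _.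
    rewrite (chip m x n (v p)); last by move=> j; rewrite /v -ltnS ltn_ord.
    rewrite mulr_sumr; over.
  rewrite exchange_big [RHS]exchange_big /=; apply: eq_bigr => q _.
  rewrite (bigID (fun p : {ffun 'I_m -> 'I_n.+1} => [forall j, q j <= p j]%N)) /=.
  rewrite [X in _ + X]big1 ?addr0 => [|p /forallPn[j]]; last first.
    by rewrite -ltnNge => lt; rewrite (bigD1 j) //= bin_small // mul0n mul0r mulr0.
  rewrite [RHS](bigID (fun p : {ffun 'I_m -> 'I_n.+1} => [forall j, p j + q j <= n]%N)) /=.
  rewrite [X in _ = _ + X]big1 ?addr0 => [|p nle]; last by rewrite cout // mulr0 mul0r.
  (* The substitution of [p + q] for [p], which is a bijection on the exponents in
     range; the others contribute zero. *)
  pose up (p : {ffun 'I_m -> 'I_n.+1}) : {ffun 'I_m -> 'I_n.+1} := [ffun j => inord (p j + q j)].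
  pose dn (p : {ffun 'I_m -> 'I_n.+1}) : {ffun 'I_m -> 'I_n.+1} := [ffun j => inord (p j - q j)].
  have dnE p j : dn p j = (p j - q j)%N :> nat.
    by rewrite ffunE inordK // (leq_ltn_trans (leq_subr _ _)).
  have upE (p : {ffun 'I_m -> 'I_n.+1}) j : (p j + q j <= n)%N -> up p j = (p j + q j)%N :> nat.
    by move=> le; rewrite ffunE inordK.
  rewrite (reindex_onto up dn) /=; last first.
    move=> p /forallP le; apply/ffunP => j; apply: val_inj => /=.
    by rewrite upE dnE subnK // -ltnS.
  apply: eq_big => p.
    apply/andP/forallP => [[/forallP qu /eqP du] j|le].
      have := congr1 (fun f : {ffun 'I_m -> 'I_n.+1} => val (f j)) du => /= Ed.
      by rewrite -Ed dnE subnK // -ltnS.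
    split; first by apply/forallP => j; rewrite upE // leq_addl.
    by apply/eqP/ffunP => j; apply: val_inj; rewrite /= dnE upE // addnK.
  move=> /andP[/forallP qu /eqP du].
  have le j : (p j + q j <= n)%N.
    have := congr1 (fun f : {ffun 'I_m -> 'I_n.+1} => val (f j)) du => /= Ed.
    by rewrite -Ed dnE subnK // -ltnS.
  rewrite mulrCA mulrA; congr (_ * _ * (_ * _)).
  - by congr (_%:R); apply: eq_bigr => j _; rewrite /v upE.
  - by congr (c _ w); apply/funext => j; rewrite /v upE.
  by congr phi; apply: eq_monom => j; rewrite /v upE // addnK.
rewrite E1 in E2; move/eqP: E2; rewrite -subr_eq0 => /eqP E2; rewrite -[RHS]E2 -sumrB.
apply: eq_bigr => p _; rewrite -sumrB mulr_suml; apply: eq_bigr => q _.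
by rewrite /H -mulrBl -mulrA [psi _ * _]mulrC.
Qed.

End DualMonomials.

(** * Coordinate functionals from the adjoint representation *)

Section WeightVectors.
Variables (K : fieldType) (g : vectType K) (br : g -> g -> g) (h : {vspace g}).
Hypothesis brl : lie_bracket br.
Variables (m : nat) (wt : 'I_m -> weight h) (F : 'I_m -> g).
Hypotheses (wt_inj : injective wt) (Fwt : forall j, weight_vector br (wt j) (F j))
  (Fn0 : forall j, F j != 0).

(** Given a relation with two nonzero coefficients, an element of the Cartan
    subalgebra on which the two weights differ produces a shorter relation. *)
Lemma weight_vectors_free (c : 'I_m -> K) : \sum_j c j *: F j = 0 -> forall j, c j = 0.
Proof.
have [d] := ubnP #|[pred j | c j != 0]|; elim: d c => // d IH c; rewrite ltnS => lec S0 j0.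
apply/eqP; apply: contraT => cj0.
have [j1 /andP[j10 cj1]|none] := pickP [pred j | (j != j0) && (c j != 0)]; last first.
  move: S0; rewrite (bigD1 j0) //= big1 ?addr0 => [/eqP|j jj0].
    by rewrite scaler_eq0 (negbTE cj0) (negbTE (Fn0 j0)).
  by have /= := none j; rewrite jj0 => /negbFE/eqP ->; rewrite scale0r.
have [y wy] : exists y, wt j1 y != wt j0 y.
  apply: contrapT => ne; case/eqP: j10; apply: wt_inj; apply/lfunP => y.
  by apply/eqP; apply: contraT => E; case: ne; exists y.
(* The coefficient of [j0] becomes zero, and that of [j1] does not. *)
pose c' j : K := c j * (wt j y - wt j0 y).
suff /(_ j1)/eqP : forall j, c' j = 0.
  by rewrite mulf_eq0 (negbTE cj1) subr_eq0 (negbTE wy).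
apply: IH.
  apply: leq_trans lec; apply: proper_card; apply/properP; split.
    by apply/fintype.subsetP => j; rewrite !inE /c' mulf_eq0 negb_or => /andP[].
  by exists j0; rewrite !inE // /c' subrr mulr0 eqxx.
have [bl br' _ _] := brl.
have : br (vsval y) (\sum_j c j *: F j) = \sum_j (c j * wt j y) *: F j.
  have [B BE] := linear_ex (bl (vsval y)).
  rewrite -BE linear_sum; apply: eq_bigr => j _.
  by rewrite linearZ /= BE Fwt scalerA.
rewrite S0 => E; have E0 : \sum_j (c j * wt j y) *: F j = 0.
  by rewrite -E; have [B BE] := linear_ex (bl (vsval y)); rewrite -BE linear0.
transitivity (\sum_j (c j * wt j y) *: F j - (wt j0 y : K) *: \sum_j c j *: F j).
  rewrite scaler_sumr -sumrB; apply: eq_bigr => j _.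
  by rewrite /c' mulrBr scalerBl scalerA [c j * wt j0 y]mulrC.
by rewrite E0 S0 scaler0 subr0.
Qed.

End WeightVectors.

Import VectorInternalTheory.

Section Adjoint.
Variables (K : numFieldType) (g : vectType K) (br : g -> g -> g).
Hypothesis simple_g : simple_lie br.

Let brl : lie_bracket br. Proof. by have [] := simple_g. Qed.

Lemma br_linr x : exists B : {linear g -> g}, forall y, B y = br x y.
Proof. by have [bl _ _ _] := brl; apply: linear_ex. Qed.

Lemma br_linl y : exists B : {linear g -> g}, forall x, B x = br x y.
Proof. by have [_ bl _ _] := brl; apply: linear_ex. Qed.

Lemma br_anti x y : br x y = - br y x.
Proof.
have [_ _ alt _] := brl; apply/eqP; rewrite -addr_eq0; apply/eqP.
have D1 a b c : br (a + b) c = br a c + br b c.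
  by have [B BE] := br_linl c; rewrite -!BE linearD.
have D2 a b c : br c (a + b) = br c a + br c b.
  by have [B BE] := br_linr c; rewrite -!BE linearD.
by have := alt (x + y); rewrite D1 !D2 !alt add0r addr0.
Qed.

(** A central element spans an ideal. *)
Lemma centre_eq0 y : (forall u, br u y = 0) -> y = 0.
Proof.
move=> cy; have [_ [a [b ab]] ideal] := simple_g.
have kill u z : z \in <[y]>%VS -> br u z = 0.
  move=> /vlineP[c ->]; have [B BE] := br_linr u.
  by rewrite -BE linearZ /= BE cy scaler0.
case: (ideal <[y]>%VS) => [u z zy|E|E].
- by rewrite kill ?mem0v.
- by apply/eqP; rewrite -memv0 -E memv_line.
by move: ab; rewrite kill ?eqxx // E memvf.
Qed.

(** Matrices act on row vectors from the right, so the right multiplication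
    [u |-> br u y] gives a representation rather than an antirepresentation. *)
Definition admx (y : g) : 'M[K]_(dim g) :=
  lin1_mx (fun u : 'rV_(dim g) => v2r (br (r2v u) y)).

Lemma mul_admx u y : u *m admx y = v2r (br (r2v u) y).
Proof.
have [B BE] := br_linl y.
have [G GE] : exists G : {linear 'rV[K]_(dim g) -> 'rV[K]_(dim g)},
    G =1 (fun u : 'rV_(dim g) => v2r (br (r2v u) y)).
  by apply: linear_ex => c x z; rewrite -!BE !linearP.
have -> : admx y = lin1_mx G by apply/matrixP => i j; rewrite !mxE GE.
by rewrite mul_rV_lin1 GE.
Qed.

Lemma mx_eq_mulmx n (A B : 'M[K]_n) : (forall u : 'rV_n, u *m A = u *m B) -> A = B.
Proof. by move=> E; apply/row_matrixP => i; rewrite !rowE E. Qed.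

Lemma admx_linear : linear admx.
Proof.
move=> c x y; apply: mx_eq_mulmx => u.
rewrite mulmxDr -scalemxAr !mul_admx; have [B BE] := br_linr (r2v u).
by rewrite -!BE !linearP.
Qed.

Lemma admx_br x y : admx (br x y) = admx x *m admx y - admx y *m admx x.
Proof.
apply: mx_eq_mulmx => u; rewrite mulmxBr !mulmxA !mul_admx !v2rK -linearB /=.
congr v2r; set v := r2v u; have [_ _ _ jac] := brl.
have /eqP := jac x y v; rewrite addrC addr_eq0 => /eqP ->.
rewrite opprD [br x _]br_anti opprK; have [B BE] := br_linl x.
rewrite [br y v]br_anti -BE linearN /= BE addrC; congr (_ + _).
by rewrite [br y _]br_anti opprK.
Qed.

Lemma admx_inj y : admx y = 0 -> y = 0.
Proof.
move=> A0; apply: centre_eq0 => u; apply: (can_inj v2rK).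
by rewrite -{1}[u]v2rK -mul_admx A0 mulmx0 linear0.
Qed.

Lemma trace_functional n (lam : {linear 'M[K]_n -> K^o}) :
  exists A : 'M[K]_n, forall M, lam M = \tr (A *m M).
Proof.
exists (\matrix_(a, b) lam (delta_mx b a)) => M.
rewrite {1}(matrix_sum_delta M) linear_sum /=.
under eq_bigr do rewrite linear_sum.
rewrite exchange_big /=; apply: eq_bigr => a _; rewrite mxE; apply: eq_bigr => b _.
by rewrite linearZ mxE /=; apply: mulrC.
Qed.

Variables (nm : {vspace g}) (U : algType K) (iota : {linear subvs_of nm -> U}).
Hypothesis ue : universal_enveloping br iota.
Variables (m : nat) (x : 'I_m -> subvs_of nm).
Hypothesis x_free : forall c : 'I_m -> K, \sum_j c j *: vsval (x j) = 0 -> forall j, c j = 0.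

(** The adjoint representation is faithful, so there is a linear form on matrices
    dual to the images of the [x i]. Adding a trivial summand to the representation
    makes the identity linearly independent of the image of the Lie algebra, so that
    the value at [1] can be adjusted to zero. *)
Lemma coordinate_functional j : exists phi : U -> K,
  [/\ representative phi, phi 1 = 0 & forall i, phi (iota (x i)) = (i == j)%:R].
Proof.
pose X := [tuple admx (vsval (x i)) | i < m].
have fX : free X.
  apply/freeP => c; under eq_bigr => i _ do rewrite -tnth_nth tnth_mktuple.
  have [A AE] := linear_ex admx_linear.
  under eq_bigr => i _ do rewrite -AE -linearZ.
  by rewrite -linear_sum /= AE => /admx_inj/x_free.
have [A' A'E] := trace_functional (coord X j).
have A'x i : \tr (A' *m admx (vsval (x i))) = (i == j)%:R.
  rewrite -A'E /=; have -> : admx (vsval (x i)) = X`_i by rewrite -tnth_nth tnth_mktuple.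
  by rewrite coord_free.
have [_ univ] := ue.
pose n := dim g.
pose blk (a : 'M[K]_1) (M : 'M[K]_n) : 'M[K]_(1 + n) := block_mx a 0 0 M.
have blkM a b M N : blk a M *m blk b N = blk (a *m b) (M *m N).
  by rewrite /blk mulmx_block !(mul0mx, mulmx0, addr0, add0r).
have blkD c a b M N : c *: blk a M + blk b N = blk (c *: a + b) (c *: M + N).
  by rewrite /blk scale_block_mx add_block_mx !scaler0 !addr0.
pose rep (y : subvs_of nm) : 'M[K]_n.+1 := blk 0 (admx (vsval y)).
have rep_lin : linear rep.
  move=> c y z; rewrite /rep linearP admx_linear /=; symmetry.
  by apply: etrans (blkD _ _ _ _ _) _; rewrite scaler0 addr0.
have [P PE] := linear_ex rep_lin.
case: (univ _ P) => [y z v E|rho rhoE _].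
  rewrite !PE /rep E admx_br.
  transitivity ((-1) *: (blk 0 (admx (vsval z)) *m blk 0 (admx (vsval y))) +
    blk 0 (admx (vsval y)) *m blk 0 (admx (vsval z))).
    by rewrite !blkM blkD mulmx0 scaler0 addr0 scaleN1r addrC.
  by rewrite scaleN1r addrC.
(* The trivial summand compensates for the trace of [A']. *)
pose A : 'M[K]_n.+1 := blk (- \tr A')%:M A'.
exists (fun u => \tr (A * rho u)); split.
- by exists n, rho, A.
- rewrite rmorph1 mulr1 /A; transitivity (\tr ((- \tr A')%:M : 'M[K]_1) + \tr A').
    exact: (@mxtrace_block _ 1 n (- \tr A')%:M 0 0 A').
  by rewrite mxtrace_scalar mulr1n addNr.
move=> i; rewrite rhoE PE /rep /A.
transitivity (\tr (blk (- \tr A')%:M A' *m blk 0 (admx (vsval (x i))))) => //.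
by rewrite blkM mulmx0 /blk mxtrace_block mxtrace0 add0r A'x.
Qed.

End Adjoint.

(** * Applying functionals to canonical elements *)

Section TensorEval.
Variables (K : fieldType).

Section Bilinear.
Variables (M N W : lmodType K) (b : M * N -> W).
Hypotheses (bl : forall n, linear (fun m => b (m, n))) (br : forall m, linear (fun n => b (m, n))).

Lemma bilinear_kill y : tens_rel y -> linext b y = 0.
Proof.
have D1 m m' n : b (m + m', n) = b (m, n) + b (m', n).
  by have := bl n 1 m m'; rewrite !scale1r.
have D2 m n n' : b (m, n + n') = b (m, n) + b (m, n').
  by have := br m 1 n n'; rewrite !scale1r.
have b0 n : b (0, n) = 0 by have := bl n (-1) 0 0; rewrite scaler0 add0r scaleN1r addNr.
have b0' m : b (m, 0) = 0 by have := br m (-1) 0 0; rewrite scaler0 add0r scaleN1r addNr.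
have Z1 c m n : b (c *: m, n) = c *: b (m, n).
  by have := bl n c m 0; rewrite !addr0 b0 addr0.
have Z2 c m n : b (m, c *: n) = c *: b (m, n).
  by have := br m c n 0; rewrite !addr0 b0' addr0.
case=> [m m' n|m n n'|c m n|c m n].
- by rewrite !linearB /= !linextU D1 [b (m, n) + _]addrC addrK subrr.
- by rewrite !linearB /= !linextU D2 [b (m, n) + _]addrC addrK subrr.
- by rewrite linearB linearZ /= !linextU Z1 subrr.
by rewrite linearB linearZ /= !linextU Z2 subrr.
Qed.

Lemma plift_tens m n : plift b (tens m n) = b (m, n).
Proof. exact/plift_pgen/bilinear_kill. Qed.

Lemma plift_tens_linear : linear (plift b : tensor M N -> W).
Proof. exact/plift_linear/bilinear_kill. Qed.

End Bilinear.

Lemma sub_sub_eq0 (V : zmodType) (a b c : V) : a - b - c = 0 -> a = b + c.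
Proof. by move/eqP; rewrite -addrA -opprD subr_eq0 => /eqP. Qed.

Lemma tensDr (M N : lmodType K) (m : M) (n n' : N) : tens m (n + n') = tens m n + tens m n'.
Proof.
have := pi_rel0 (TensDr m n n'); rewrite !raddfB /=.
exact: sub_sub_eq0.
Qed.

Lemma tensDl (M N : lmodType K) (m m' : M) (n : N) : tens (m + m') n = tens m n + tens m' n.
Proof.
have := pi_rel0 (TensDl m m' n); rewrite !raddfB /=.
exact: sub_sub_eq0.
Qed.

Lemma tensZr (M N : lmodType K) c (m : M) (n : N) : tens m (c *: n) = c *: tens m n.
Proof.
have := pi_rel0 (TensZr c m n); rewrite !raddfB /= => /eqP; rewrite subr_eq0 => /eqP E.
exact: etrans E (esym (pi_scale (@tens_rel K M N) c _)).
Qed.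

Lemma tensZl (M N : lmodType K) c (m : M) (n : N) : tens (c *: m) n = c *: tens m n.
Proof.
have := pi_rel0 (TensZl c m n); rewrite !raddfB /= => /eqP; rewrite subr_eq0 => /eqP E.
exact: etrans E (esym (pi_scale (@tens_rel K M N) c _)).
Qed.

Section Map.
Variables (M N N' : lmodType K) (phi : {linear N -> N'}).

Let tm_l n : linear (fun m : M => tens m (phi n)).
Proof. by move=> c m m'; rewrite tensDl tensZl. Qed.

Let tm_r (m : M) : linear (fun n => tens m (phi n)).
Proof. by move=> c n n'; rewrite linearP tensDr tensZr. Qed.

Lemma tensmap_tens (m : M) n : tensmap phi (tens m n) = tens m (phi n).
Proof. exact: (plift_tens (b := fun mn => tens mn.1 (phi mn.2)) tm_l tm_r). Qed.

Lemma tensmap_linear : linear (@tensmap K M N N' phi).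
Proof. exact: (plift_tens_linear (b := fun mn => tens mn.1 (phi mn.2)) tm_l tm_r). Qed.

End Map.

Definition tens_eval (M N : lmodType K) (lam : {linear M -> K^o}) :
    tensor M N -> N :=
  plift (fun mn : M * N => (lam mn.1 : K) *: mn.2).

Section Eval.
Variables (M N : lmodType K) (lam : {linear M -> K^o}).

Let te_l (n : N) : linear (fun m : M => (lam m : K) *: n).
Proof. by move=> c m m'; rewrite linearP scalerDl scalerA. Qed.

Let te_r (m : M) : linear (fun n : N => (lam m : K) *: n).
Proof. by move=> c n n'; rewrite scalerDr !scalerA mulrC. Qed.

Lemma tens_eval_tens m (n : N) : tens_eval lam (tens m n) = (lam m : K) *: n.
Proof. exact: (plift_tens (b := fun mn => (lam mn.1 : K) *: mn.2) te_l te_r). Qed.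

Lemma tens_eval_linear : linear (@tens_eval M N lam).
Proof. exact: (plift_tens_linear (b := fun mn => (lam mn.1 : K) *: mn.2) te_l te_r). Qed.

End Eval.

Lemma linear_fun_sum (V W : lmodType K) (F : V -> W) : linear F ->
  forall (I : Type) (s : seq I) (P : pred I) (G : I -> V),
  F (\sum_(i <- s | P i) G i) = \sum_(i <- s | P i) F (G i).
Proof. by move=> /linear_ex[L LE] I s P G; rewrite -LE linear_sum; apply: eq_bigr => i _; rewrite LE. Qed.

End TensorEval.

Section FreeAlgebra.
Variables (K : fieldType) (r : nat) (U : algType K) (f : 'I_r -> U).

Lemma freeeval_linear : linear (freeeval f).
Proof. exact: linextP. Qed.

Lemma freeeval_word J : freeeval f (freeword K J) = \prod_(i <- rev J) f i.
Proof.
have -> : freeword K J = << FMonom (rev J) >> :> {malg K[{fmonom 'I_r}]}.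
  rewrite /freeword; elim: (rev J) => [|i l IH].
    rewrite big_nil; congr (<< _ >>); apply/eqP; rewrite -val_eqE /=.
    by rewrite fm1.
  rewrite big_cons IH /freegen malgM_def fgmulUU mulr1; congr << _ >>.
  by apply: val_inj; rewrite /= fmM /= fmuE.
exact: linextU.
Qed.

End FreeAlgebra.

(** * The coefficients of the canonical element multiply like divided powers *)

Section Degrees.
Variable r : nat.
Implicit Types (k l : degree r) (J : seq 'I_r).

Lemma size_multiindex k J : multiindex k J -> size J = wt k.
Proof.
rewrite multiindexE => /perm_size ->; rewrite size_map /syms size_allpairs_dep.
rewrite /wt -big_enum /=; elim: (enum 'I_r) => [|i l IH] /=; first by rewrite big_nil.
by rewrite big_cons size_iota IH.
Qed.

Definition word_deg J : degree r := [ffun i => count_mem i J].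

Lemma word_degP J : multiindex (word_deg J) J.
Proof. by apply/forallP => i; rewrite ffunE. Qed.

Lemma multiindex_deg k J : multiindex k J = (k == word_deg J).
Proof.
apply/forallP/eqP => [H|-> i]; last by rewrite ffunE.
by apply/ffunP => i; rewrite ffunE (eqP (H i)).
Qed.

Lemma multiindex0 J : multiindex (0 : degree r) J = (J == [::]).
Proof.
rewrite multiindex_deg; case: J => [|i J].
  suff -> : word_deg [::] = 0 :> degree r by rewrite !eqxx.
  by apply/ffunP => i; rewrite !ffunE.
transitivity false => //; apply/negbTE/eqP => /ffunP/(_ i).
by rewrite !ffunE /= eqxx.
Qed.

End Degrees.

Section Separation.
Variables (K : numFieldType) (r : nat) (k : degree r).
Variable fs : (wt k).-tuple 'I_r -> trees K r.
Hypothesis dual : dual_basis fs.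

Lemma dual_pair_word (J J' : (wt k).-tuple 'I_r) : multiindex k J -> multiindex k J' ->
  pair_word J (fs J') = (J == J')%:R :> K.
Proof. by move=> mJ mJ'; have [_ pf _] := dual; apply: pairing_pair_word; apply: pf. Qed.

(** The dual basis spans, so its coordinates, which are the pairings with words,
    determine an element. *)
Lemma dual_sep (x : trees K r) : calA k x -> (forall J, multiindex k J -> pair_word J x = 0) -> x = 0.
Proof.
move=> ax H; have [_ _ /(_ _ ax)[s [sG E]]] := dual.
have [a aE] : exists a : (wt k).-tuple 'I_r -> K, x = \sum_(J : (wt k).-tuple 'I_r | multiindex k J) a J *: fs J.
  rewrite {}E; elim: s sG => [|[c y] s IH] sG.
    by exists (fun=> 0); rewrite big_nil big1 // => J _; rewrite scale0r.
  have [a aE] := IH (fun z zs => sG z (mem_behead (s := (c, y) :: s) zs)).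
  have /= [J0 mJ0 ->] := sG _ (mem_head _ _).
  exists (fun J => (if J == J0 then c else 0) + a J).
  rewrite big_cons aE /=; under [RHS]eq_bigr do rewrite scalerDl.
  rewrite big_split /=; congr (_ + _).
  rewrite (bigD1 J0) //= eqxx big1 ?addr0 // => J /andP[_ /negbTE ->].
  by rewrite scale0r.
rewrite aE big1 // => J mJ; suff -> : a J = 0 by rewrite scale0r.
have := H J mJ; rewrite aE (linear_fun_sum (@pair_word_linear K r J)).
rewrite (bigD1 J) //= big1 => [|J' /andP[mJ' ne]].
  rewrite addr0 => <-; transitivity (a J * pair_word J (fs J)); last by rewrite linearZ.
  by rewrite dual_pair_word // eqxx mulr1.
transitivity (a J' * pair_word J (fs J')); first by rewrite linearZ.
by rewrite dual_pair_word // eq_sym (negbTE ne) mulr0.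
Qed.

End Separation.

Section DividedPowers.
Variables (K : numFieldType) (r m : nat).
Variables (g : vectType K) (br : g -> g -> g) (nm : {vspace g}).
Variables (U : algType K) (iota : {linear subvs_of nm -> U}).
Hypothesis ue : universal_enveloping br iota.
Variables (x : 'I_m -> subvs_of nm) (y : 'I_r -> subvs_of nm) (kd : 'I_m -> degree r).
Hypothesis coord : forall j, exists phi : U -> K,
  [/\ representative phi, phi 1 = 0 & forall i, phi (iota (x i)) = (i == j)%:R].
Hypothesis kd0 : forall j, kd j != 0.
Variables (fs : forall k : degree r, (wt k).-tuple 'I_r -> trees K r)
  (T : {ffun 'I_m -> nat} -> trees K r).
Hypothesis dual : forall k, dual_basis (@fs k).
Hypothesis T_calA : forall p, calA (pdeg kd p) (T p).
Hypothesis expansion : forall k,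
  tensmap (freeeval (fun i => iota (y i))) (Omega (@fs k)) =
  pbw_expansion kd (fun j => iota (x j)) T k.

Lemma pdeg_linear (p q : {ffun 'I_m -> nat}) : pdeg kd (p + q) = pdeg kd p + pdeg kd q.
Proof.
rewrite /pdeg -big_split; apply: eq_bigr => j _; rewrite ffunE.
exact: mulrnDr.
Qed.

Lemma wtD (k l : degree r) : wt (k + l) = (wt k + wt l)%N.
Proof. by rewrite /wt -big_split; apply: eq_bigr => i _; rewrite degD. Qed.

Lemma wt_gt0 (k : degree r) : k != 0 -> (0 < wt k)%N.
Proof.
move=> k0; rewrite lt0n; apply: contra k0; rewrite /wt sum_nat_eq0 => /forallP H.
by apply/eqP/ffunP => i; rewrite ffunE; apply/eqP/H.
Qed.

(** A factor of nonzero degree cannot occur more often than the total degree. *)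
Lemma pdeg_bound (p : {ffun 'I_m -> nat}) j : (p j <= wt (pdeg kd p))%N.
Proof.
rewrite /pdeg (bigD1 j) //= wtD; apply: leq_trans (leq_addr _ _).
have -> : wt (kd j *+ p j) = (p j * wt (kd j))%N.
  elim: (p j) => [|n IH]; last by rewrite mulrS wtD IH mulSn.
  by rewrite mulr0n /wt big1 // => i _; rewrite ffunE.
by rewrite leq_pmulr // wt_gt0.
Qed.

(** Pairing the trees in the expansion of the canonical element with a word gives the
    expansion of that word, as the canonical element is built from dual bases. *)
Lemma word_expansion k (J : (wt k).-tuple 'I_r) : multiindex k J ->
  revprod iota (map y J) =
  \sum_(p : {ffun 'I_m -> 'I_(wt k).+1} | pdeg kd [ffun j => val (p j)] == k)
    (pair_word J (T [ffun j => val (p j)]) : K) *: monom iota x (fun j => p j : nat).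
Proof.
move=> mJ; have [P PE] := linear_ex (@pair_word_linear K r J).
have [q qE] := linear_ex (freeeval_linear (fun i => iota (y i))).
have te := @tens_eval_linear K (trees K r) U P; have sumE := linear_fun_sum te.
have := congr1 (tens_eval (N := U) P) (expansion k).
have -> : freeeval (fun i => iota (y i)) = q by apply/funext => u; rewrite qE.
rewrite /Omega /pbw_expansion (linear_fun_sum (@tensmap_linear _ _ _ _ q)) !sumE.
rewrite (bigD1 J) //= big1 => [|J' /andP[mJ' ne]]; last first.
  rewrite tensmap_tens; apply: etrans (tens_eval_tens P _ _) _.
  by rewrite PE dual_pair_word // eq_sym (negbTE ne) scale0r.
rewrite addr0 tensmap_tens => E.
transitivity (tens_eval P (tens (fs J) (q (freeword K J)))).
  rewrite tens_eval_tens PE dual_pair_word // eqxx scale1r qE freeeval_word.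
  by rewrite /revprod -map_rev big_map.
rewrite {}E; apply: eq_bigr => p _; rewrite tens_eval_tens PE; congr (_ *: _).
by apply: eq_bigr => j _; rewrite ffunE.
Qed.

(** The coefficient of the monomial [p] in the image of the word [v]. *)
Definition coef (p : 'I_m -> nat) (v : seq 'I_r) : K :=
  pair_deg (pdeg kd (finfun p)) v (T (finfun p)).

Lemma coef_out n p v : (size v <= n)%N -> ~~ [forall j, p j <= n]%N -> coef p v = 0.
Proof.
move=> sv; rewrite /coef /pair_deg; case: ifP => // mv /negP[]; apply/forallP => j.
apply: leq_trans sv; rewrite (size_multiindex mv).
by have := pdeg_bound (finfun p) j; rewrite ffunE.
Qed.

(** The expansion with a bound on the exponents that does not depend on the word, so
    that all subwords of a word can be treated at once. *)
Lemma word_expansion_box n v : (size v <= n)%N ->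
  revprod iota (map y v) = \sum_(p : {ffun 'I_m -> 'I_n.+1})
     coef (fun j => p j : nat) v *: monom iota x (fun j => p j : nat).
Proof.
move=> sv; pose k := word_deg v; have mv : multiindex k v := word_degP v.
have sk : size v = wt k := size_multiindex mv.
pose J := @Tuple (wt k) _ v (introT eqP sk).
rewrite (@word_expansion k J mv).
pose fin N (p : {ffun 'I_m -> 'I_N.+1}) : {ffun 'I_m -> nat} := [ffun j => val (p j)].
rewrite [RHS](bigID (fun p => pdeg kd (fin n p) == k)) /=.
rewrite [X in _ = _ + X]big1 ?addr0 => [|p ne]; last first.
  rewrite /coef /pair_deg multiindex_deg -/k -/(fin n p) (negbTE ne).
  by rewrite scale0r.
have kn : (wt k <= n)%N by rewrite -sk.
pose up (p : {ffun 'I_m -> 'I_(wt k).+1}) : {ffun 'I_m -> 'I_n.+1} := [ffun j => inord (p j)].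
pose dn (p : {ffun 'I_m -> 'I_n.+1}) : {ffun 'I_m -> 'I_(wt k).+1} := [ffun j => inord (p j)].
have upE p j : up p j = p j :> nat by rewrite ffunE inordK // (leq_trans (ltn_ord _)).
have finup p : fin n (up p) = fin (wt k) p by apply/ffunP => j; rewrite [LHS]ffunE [RHS]ffunE /= upE.
rewrite [RHS](reindex_onto up dn) /=; last first.
  move=> p /eqP pk; apply/ffunP => j; apply: val_inj; rewrite /= upE ffunE inordK //.
  by rewrite ltnS -pk; have := pdeg_bound (fin n p) j; rewrite ffunE.
apply: eq_big => p.
  rewrite -/(fin (wt k) p) finup; case: eqP => //= _; apply/esym/eqP/ffunP => j.
  by apply: val_inj; rewrite /= ffunE upE inordK.
move=> pk; have E : (fun j => up p j : nat) = (fun j => p j : nat) by apply/funext => j; rewrite upE.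
rewrite E /coef /pair_deg multiindex_deg -/k.
have -> : pdeg kd (finfun (fun j => p j : nat)) == k by [].
by [].
Qed.

Lemma coef_shuf (p q : {ffun 'I_m -> nat}) v :
  shuf v (fun a b => coef p a * coef q b) =
  (\prod_j 'C(p j + q j, q j))%N%:R * coef (fun j => p j + q j)%N v.
Proof.
(* Large enough for [p], [q] and all exponents that occur for subwords of [v]. *)
pose n := (size v + \sum_j (p j + q j))%N.
have pn j : (p j <= n)%N.
  by apply: leq_trans (leq_addl _ _); rewrite (bigD1 j) //= -addnA leq_addr.
have qn j : (q j <= n)%N.
  by apply: leq_trans (leq_addl _ _); rewrite (bigD1 j) //= addnAC leq_addl.
pose P : {ffun 'I_m -> 'I_n.+1} := [ffun j => inord (p j)].
pose Q : {ffun 'I_m -> 'I_n.+1} := [ffun j => inord (q j)].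
have PE : (fun j => P j : nat) = p by apply/funext => j; rewrite ffunE inordK ?ltnS ?pn.
have QE : (fun j => Q j : nat) = q by apply/funext => j; rewrite ffunE inordK ?ltnS ?qn.
have := @shuffle_coef K g br nm U iota ue m x coord _ y coef n v _ _ _ P Q.
rewrite PE QE => -> //.
- congr (_ * _); first by congr (_%:R); apply: eq_bigr => j _; rewrite -PE -QE.
  by congr (coef _ v); apply/funext => j; rewrite -[p j]/((p : 'I_m -> nat) j) -PE -[q j]/((q : 'I_m -> nat) j) -QE.
- by move=> u su; apply: word_expansion_box; rewrite (leq_trans su) // leq_addr.
- by move=> s; apply: coef_out; rewrite leq_addr.
by move=> s t st; congr coef; apply/funext.
Qed.


Lemma separation k (z : trees K r) : calA k z ->
  (forall J, multiindex k J -> pair_word J z = 0) -> z = 0.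
Proof. exact: (dual_sep (@dual k)). Qed.

Lemma pair_word_inj k (z z' : trees K r) : calA k z -> calA k z' ->
  (forall J, multiindex k J -> pair_word J z = pair_word J z') -> z = z'.
Proof.
move=> az az' E; apply/eqP; rewrite -subr_eq0; apply/eqP.
have -> : z - z' = (-1) *: z' + z by rewrite scaleN1r addrC.
apply: (separation (k := k)) => [|J mJ]; first exact: calA_lin.
have := pair_word_linear J (-1) z' z => ->; rewrite E // -[_ *: _]/(_ * _).
by rewrite mulN1r addNr.
Qed.

Lemma starZ a b (z z' : trees K r) : star (a *: z) (b *: z') = (a * b) *: star z z' :> trees K r.
Proof.
have sl := star_linear_l separation; have sr := star_linear_r separation.
have l0 w : star 0 w = 0 :> trees K r by exact: (star0l separation).
have r0 w : star w 0 = 0 :> trees K r.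
  by have := sr w (-1) 0 0; rewrite scaler0 add0r scaleN1r addNr.
have := sl (b *: z') a z 0; rewrite addr0 l0 addr0 => ->.
by have := sr z b z' 0; rewrite addr0 r0 addr0 => ->; rewrite scalerA.
Qed.

(** The coefficients are dual to the monomials, whose coproducts have binomial
    coefficients. *)
Lemma T_star (p q : {ffun 'I_m -> nat}) :
  star (T p) (T q) = (\prod_j 'C(p j + q j, q j))%N%:R *: T (p + q).
Proof.
have apq : calA (pdeg kd p + pdeg kd q) (T (p + q)) by rewrite -pdeg_linear.
apply: (pair_word_inj (k := pdeg kd p + pdeg kd q)).
- exact: (star_calA separation).
- by rewrite -[X in calA _ X]addr0; apply: calA_lin => //; apply: calA0.
move=> J mJ; rewrite (pair_word_star separation (T_calA p) (T_calA q) mJ).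
transitivity (shuf J (fun a b => coef p a * coef q b)).
  apply: eq_shuf => a b; rewrite /coef.
  have fp (s : {ffun 'I_m -> nat}) : finfun s = s by apply/ffunP => j; rewrite ffunE.
  by rewrite !fp.
rewrite coef_shuf /coef.
have -> : finfun (fun j => p j + q j)%N = p + q by apply/ffunP => j; rewrite !ffunE.
by rewrite /pair_deg pdeg_linear mJ; apply/esym/linearZ.
Qed.

Lemma T0_calA : calA 0 (T0 K r).
Proof.
split=> [|pi].
  exists [:: (1, T0 K r)]; split; last by rewrite big_seq1 scale1r.
  move=> c; rewrite inE => /eqP ->; exists [::] => //.
  have /fsetP E : symset (0 : degree r) = fset0.
    by apply/fsetP => t; rewrite symset_mem symsP ffunE ltn0 inE.
  apply/otreeP; split=> //; last first.
    by move=> B B0 _; apply/fsubsetP => -[t|//]; rewrite in_vset E inE.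
  by move/fsetP: E => ->; rewrite cardfs0.
rewrite perm_act_tree /sgnG big1 ?scale1r // => i _.
have odd0 n (s : 'S_n) : n = 0%N -> odd_perm s = false.
  by move=> n0; move: s; rewrite n0 => s; rewrite permS0 odd_perm1.
by rewrite odd0 ?expr0 // ffunE.
Qed.

Lemma pair_deg_T0 J : pair_deg 0 J (T0 K r) = (J == [::])%:R :> K.
Proof.
rewrite /pair_deg multiindex0; case: eqP => [->|//].
rewrite /pair_word /= expr0 scale1r; exact: root_coef_T0.
Qed.

Lemma shuf_nilr (I : eqType) (J : seq I) (G : seq I -> K) :
  shuf J (fun a b => G a * (b == [::])%:R) = G J.
Proof.
elim: J G => [|i J IH] G /=; first by rewrite mulr1.
rewrite (IH (fun a => G (i :: a))) -[RHS]addr0; congr (_ + _).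
by rewrite -[RHS](shuf0 K J); apply: eq_shuf => a b; rewrite mulr0.
Qed.

Lemma shuf_nill (I : eqType) (J : seq I) (G : seq I -> K) :
  shuf J (fun a b => (a == [::])%:R * G b) = G J.
Proof.
elim: J G => [|i J IH] G /=; first by rewrite mul1r.
rewrite (IH (fun a => G (i :: a))) -[RHS]add0r; congr (_ + _).
by rewrite -[RHS](shuf0 K J); apply: eq_shuf => a b; rewrite mul0r.
Qed.

Lemma star_T0r k (z : trees K r) : calA k z -> star z (T0 K r) = z.
Proof.
move=> az; have az0 : calA (k + 0) (star z (T0 K r)).
  by apply: (star_calA separation) => //; apply: T0_calA.
rewrite addr0 in az0; apply: (pair_word_inj az0 az) => J mJ.
rewrite (pair_word_star separation az T0_calA); last by rewrite addr0.
transitivity (shuf J (fun a b => pair_deg k a z * (b == [::])%:R : K)).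
  by apply: eq_shuf => a b; rewrite pair_deg_T0.
by rewrite shuf_nilr /pair_deg mJ.
Qed.

Lemma star_T0l k (z : trees K r) : calA k z -> star (T0 K r) z = z.
Proof.
move=> az; have az0 : calA (0 + k) (star (T0 K r) z).
  by apply: (star_calA separation) => //; apply: T0_calA.
rewrite add0r in az0; apply: (pair_word_inj az0 az) => J mJ.
rewrite (pair_word_star separation T0_calA az); last by rewrite add0r.
transitivity (shuf J (fun a b => (a == [::])%:R * pair_deg k b z : K)).
  by apply: eq_shuf => a b; rewrite pair_deg_T0.
by rewrite shuf_nill /pair_deg mJ.
Qed.

(** The empty word maps to [1], which is the monomial with exponent zero. *)
Lemma T_zero : T 0 = T0 K r.
Proof.
have p0 : pdeg kd 0 = 0 by rewrite /pdeg big1 // => j _; rewrite ffunE mulr0n.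
have a0 : calA 0 (T 0) by have := T_calA 0; rewrite p0.
apply: (pair_word_inj a0 T0_calA) => J; rewrite multiindex0 => /eqP ->.
have E0 : pair_word [::] (T0 K r) = 1 :> K.
  by rewrite /pair_word /= expr0 scale1r; exact: root_coef_T0.
rewrite E0.
have [phi rphi phi1] := representative_unit ue.
have := @word_expansion_box 0 [::] isT => /(congr1 phi).
rewrite /revprod /= big_nil phi1 (representative_sum _ _ _ _ rphi).
rewrite (bigD1 [ffun=> ord0]) //= big1 ?addr0 => [|p pn]; last first.
  by case/eqP: pn; apply/ffunP => j; rewrite ffunE; apply/val_inj; case: (p j) => -[].
rewrite monom0 ?phi1 ?mulr1 /coef => [|j]; last by rewrite ffunE.
have -> : finfun (fun j : 'I_m => ([ffun=> ord0] : {ffun 'I_m -> 'I_1}) j : nat) = 0.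
  by apply/ffunP => j; rewrite !ffunE.
by rewrite /pair_deg p0 multiindex0.
Qed.

Definition multifact (p : {ffun 'I_m -> nat}) : nat := \prod_j (p j)`!.

Lemma multifact_neq0 p : (multifact p)%:R != 0 :> K.
Proof.
rewrite pnatr_eq0 -lt0n /multifact; elim/big_ind: _ => // [u v u0 v0|j _].
  by rewrite muln_gt0 u0.
exact: fact_gt0.
Qed.

(** Normalized so that the star product adds exponents. *)
Definition scaledT (p : {ffun 'I_m -> nat}) : trees K r := (multifact p)%:R *: T p.

Lemma scaledT_star p q : star (scaledT p) (scaledT q) = scaledT (p + q).
Proof.
rewrite /scaledT starZ T_star scalerA -!natrM; congr (_%:R *: _).
rewrite /multifact -!big_split; apply: eq_bigr => j _ /=.
have -> : (p + q) j = (p j + q j)%N by rewrite ffunE.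
by rewrite -(bin_fact (leq_addl (p j) (q j))) addnK [RHS]mulnC [((q j)`! * _)%N]mulnC.
Qed.

Lemma scaledT_zero : scaledT 0 = T0 K r.
Proof.
rewrite /scaledT T_zero /multifact big1 ?scale1r // => j _.
by rewrite ffunE fact0.
Qed.

Definition delta (j : 'I_m) : {ffun 'I_m -> nat} := [ffun i => (i == j) : nat].

Lemma multifact_delta j : multifact (delta j) = 1%N.
Proof. by apply: big1 => i _; rewrite ffunE; case: eqP. Qed.

Lemma scaledT_delta j : scaledT (delta j) = T (delta j).
Proof. by rewrite /scaledT multifact_delta scale1r. Qed.

Lemma pdeg_delta j : pdeg kd (delta j) = kd j.
Proof.
rewrite /pdeg (bigD1 j) //= ffunE eqxx big1 ?addr0 // => i ij.
by rewrite ffunE (negbTE ij) mulr0n.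
Qed.

Lemma delta_sum (p : {ffun 'I_m -> nat}) : \sum_j delta j *+ p j = p.
Proof.
have dE j n i : (delta j *+ n) i = ((i == j) * n)%N.
  elim: n => [|n IH]; first by rewrite mulr0n ffunE muln0.
  by rewrite mulrS ffunE IH ffunE mulnS.
apply/ffunP => i; rewrite sum_ffunE (bigD1 i) //= dE eqxx mul1n big1 ?addr0 // => j ij.
by rewrite dE eq_sym (negbTE ij).
Qed.

Lemma star_monomial_scaledT (p : {ffun 'I_m -> nat}) :
  star_monomial (fun j => T (delta j)) p = scaledT p.
Proof.
rewrite /star_monomial -[in RHS](delta_sum p).
elim: (index_enum _) => [|j l IH]; first by rewrite !big_nil scaledT_zero.
rewrite !big_cons IH -scaledT_star; congr star.
elim: (p j) => [|n IHn]; first by rewrite mulr0n scaledT_zero.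
by rewrite iterS IHn mulrS -scaledT_star scaledT_delta.
Qed.

Lemma star_monomial_delta (eta : 'I_m -> trees K r) j :
  (forall j, calA (kd j) (eta j)) -> star_monomial eta (delta j) = eta j.
Proof.
move=> ae; rewrite /star_monomial.
have H l : uniq l -> \big[@star K r/T0 K r]_(i <- l) iter (delta j i) (star (eta i)) (T0 K r) =
    if j \in l then eta j else T0 K r.
  elim: l => [|i l IH] /=; first by rewrite big_nil.
  move=> /andP[il ul]; rewrite big_cons IH // ffunE inE [j == i]eq_sym.
  case: eqVneq il => [-> jl|_ _] /=.
    by rewrite (negbTE jl) !(star_T0r (ae j)).
  case: ifP => _; first exact: (star_T0l (ae j)).
  exact: (star_T0l T0_calA).
by rewrite H ?index_enum_uniq // mem_index_enum.
Qed.

(** The Lie algebra enters only through the coordinate functionals on the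
    generators [x]. For uniqueness, the exponent [delta j] forces the value of the
    [j]-th element, since the one-vertex tree is a unit. *)
Theorem divided_powers :
  exists! eta : {ffun 'I_m -> trees K r},
    (forall j, calA (kd j) (eta j)) /\
    forall p : {ffun 'I_m -> nat},
      T p = (\prod_l (p l)`!)%N%:R^-1 *: star_monomial eta p.
Proof.
pose eta : {ffun 'I_m -> trees K r} := [ffun j => T (delta j)].
have etaE : (eta : 'I_m -> trees K r) = fun j => T (delta j).
  by apply/funext => j; rewrite ffunE.
exists eta; split; first split.
- by move=> j; rewrite ffunE -{1}(pdeg_delta j).
- move=> p; rewrite etaE star_monomial_scaledT /scaledT scalerA mulVf ?scale1r //.
  exact: multifact_neq0.
move=> eta' [ae' E]; apply/ffunP => j; rewrite ffunE E star_monomial_delta //.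
by rewrite -/(multifact (delta j)) multifact_delta invr1 scale1r.
Qed.

End DividedPowers.

Theorem theorem3p3
  (R : realType) (g : vectType R[i]) (br : g -> g -> g) (h nm np : {vspace g})
  (r : nat) (simple : 'I_r -> weight h) (f : 'I_r -> g)
  (U : algType R[i]) (iota : {linear subvs_of nm -> U})
  (m : nat) (beta : 'I_m -> weight h) (F : 'I_m -> g) (kd : 'I_m -> degree r)
  (fs : forall k : degree r, (wt k).-tuple 'I_r -> trees R[i] r)
  (T : {ffun 'I_m -> nat} -> trees R[i] r) :
  simple_lie br -> cartan_subalgebra br h -> simple_roots br simple ->
  cartan_decomposition br simple nm np -> chevalley_generators br simple f ->
  universal_enveloping br iota ->
  injective beta ->
  (forall al, positive_root br simple al <-> exists j, beta j = al) ->
  (forall j, weight_generator br (- beta j) (F j)) ->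
  (forall j, beta j = nat_comb simple (kd j)) ->
  (forall k, dual_basis (fs k)) ->
  (forall p, calA (pdeg kd p) (T p)) ->
  (forall k,
     tensmap (freeeval (fun i => iota (vsproj nm (f i)))) (Omega (fs k)) =
     pbw_expansion kd (fun j => iota (vsproj nm (F j))) T k) ->
  exists! eta : {ffun 'I_m -> trees R[i] r},
    (forall j, calA (kd j) (eta j)) /\
    forall p : {ffun 'I_m -> nat},
      T p = (\prod_l (p l)`!)%N%:R^-1 *: star_monomial eta p.
Proof.
move=> simple_g _ _ [wnm _ _ _ _] _ ue beta_inj posP gen betaE dual TA H.
have brl : lie_bracket br by have [] := simple_g.
have Fnm j : F j \in nm.
  apply/wnm; exists [:: (1, F j)]; split; last by rewrite big_seq1 scale1r.
  move=> c; rewrite inE => /eqP ->; exists (- beta j); last by have [] := gen j.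
  by rewrite opprK; apply/posP; exists j.
have F_free : forall c : 'I_m -> R[i],
    \sum_j c j *: vsval (vsproj nm (F j)) = 0 -> forall j, c j = 0.
  move=> c; under eq_bigr => j _ do rewrite vsprojK //.
  apply: (weight_vectors_free brl (wt := fun j => - beta j)).
  - by move=> j j' /oppr_inj/beta_inj.
  - by move=> j; have [] := gen j.
  - by move=> j; have [] := gen j.
have kd0 j : kd j != 0.
  have [[b0 _] _] : positive_root br simple (beta j) by apply/posP; exists j.
  apply: contraNneq b0 => k0; rewrite betaE k0 /nat_comb big1 // => i _.
  by rewrite ffunE mulr0n.
exact: (divided_powers ue (coordinate_functional simple_g ue F_free) kd0 dual TA H).
Qed.
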